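(* Let $q\equiv1\pmod4$ be a prime, $a\in\mathbb{Z}$, and $J\ge1$ an integer. There are constants $c_{j,a}$ ($0\le j\le J$, depending on $q,a,j$) with $$c_{0,a}=1,\qquad c_{1,a}=\begin{cases}c_1+\frac{\log q}{2}&\text{if }a\equiv0\pmod q,\\ c_1-\frac{\log q}{2(q-1)}&\text{otherwise,}\end{cases}$$ such that, as $x\to\infty$, $$\sum_{\substack{n\le x\\ n\equiv a\pmod q}}\mathbf{1}_{\mathbf E}(n)=\frac{K}{q}\,x\sum_{j=0}^J\frac{c_{j,a}}{(\log x)^{1/2+j}}+O\Big(\frac{x}{(\log x)^{J+3/2}}\Big).$$
   Context: $\mathbf{1}_{\mathbf E}$ is the indicator of the set of integers of the form $a^2+b^2$ with $a,b\in\mathbb{Z}$. $K=\frac{1}{\sqrt2}\prod_{p\equiv 3\,(4)}(1-p^{-2})^{-1/2}$. The constants $c_0=1,c_1,c_2,\dots$ are those in the classical expansion (valid for every $J\ge1$) $\sum_{n\le x}\mathbf{1}_{\mathbf E}(n)=Kx\sum_{j=0}^J c_j(\log x)^{-1/2-j}+O(x(\log x)^{-3/2-J})$; numerically $c_1=0.581948659\ldots$. *)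

(* Defs.v *)
From Stdlib Require Import Reals ZArith Znumtheory ClassicalEpsilon.
From Coquelicot Require Import Coquelicot.
Open Scope R_scope.

Definition inE (n : nat) : Prop :=
  exists a b : Z, Z.of_nat n = (a * a + b * b)%Z.

Fixpoint count_upto (P : nat -> Prop) (N : nat) : R :=
  match N with
  | O => 0
  | S m => count_upto P m +
           (if excluded_middle_informative (P (S m)) then 1 else 0)
  end.

Definition count_le (P : nat -> Prop) (x : R) : R :=
  count_upto P (Z.to_nat (Int_part x)).

Fixpoint Kpartial (N : nat) : R :=
  match N with
  | O => 1
  | S m => Kpartial m *
      (if excluded_middle_informative
            (prime (Z.of_nat (S m)) /\ Z.modulo (Z.of_nat (S m)) 4 = 3%Z)
       then Rpower (1 - / (INR (S m) ^ 2)) (-1/2)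
       else 1)
  end.

Definition Kconst : R := / sqrt 2 * real (Lim_seq Kpartial).

Definition classical_c1 (c1 : R) : Prop :=
  exists c : nat -> R, c 0%nat = 1 /\ c 1%nat = c1 /\
  forall J : nat, (1 <= J)%nat ->
    exists C X0 : R, forall x : R, X0 <= x ->
      Rabs (count_le inE x
            - Kconst * x * sum_f_R0 (fun j => c j / Rpower (ln x) (1/2 + INR j)) J)
      <= C * (x / Rpower (ln x) (INR J + 3/2)).

(* Main.v *)
(* Sums of two squares prime to q are equidistributed among the q - 1 classes prime to q, up to
   O(x / (log x)^A) for every A. So, B(x) counting the sums of two squares up to x, such a class
   gets (B(x) - B(x/q))/(q - 1), while the class 0 gets exactly B(x/q), because q is a sum of two
   squares. The expansions then follow from that of B by expanding (log x - log q)^{-1/2-j}.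

   For the equidistribution, let chi be a nonprincipal character mod q and
   F(s) = sum 1_E(n) chi(n) n^{-s}. Then F'/F is half the sum of L'/L(chi) and L'/L(chi chi_4), plus
   an absolutely convergent series. On 1 < Re s <= 2 the derivatives of L are bounded by powers of
   log |t| (partial summation), and so is 1/L (3-4-1 inequality; for real characters also
   L(1) <> 0, by Monsky's argument). Hence (s-1) F^(k)(s) is bounded by a power of log |t|, for
   every k, uniformly up to the line Re s = 1. Smoothing by a Poisson kernel of width (log x)^{-2D}
   turns this into a bound for sum 1_E(n) chi(n) (log n)^k n^{-s} over short intervals, and k large
   gives any power of log x. Everything happens in Re s > 1: there is no analytic continuation. *)

(* F behaves like a square root of L(chi) L(chi chi_4), so partial summation does not reach it: only
   F'/F is expressed by L-functions. The derivatives of F are recovered from F' = (F'/F) F by the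
   Leibniz rule, starting from the trivial bound |F| <= zeta(s) <= 1 + 1/(s-1). However high the
   order, this costs one factor 1/(s-1) and powers of log |t|. There lies the gain: at s = 1 + 1/log
   x the trivial bound for F^(k) is (log x)^(k+1), the one obtained is log x up to powers of log
   |t|, and removing the weight (log n)^k then divides by (log x)^k.

   The character chi chi_4 is nonprincipal for every chi mod q, the principal one included, because
   q is odd. The 3-4-1 inequality compares chi with chi^2. When chi is real, zeta takes the place of
   the series of chi^2 and its pole spoils the inequality near t = 0; this is the gap that L(1) <> 0
   fills. *)
Require Import Defs.
From Stdlib Require Import Reals ZArith Znumtheory ClassicalEpsilon.
From Stdlib Require Import Lra Lia FunctionalExtensionality.
From Coquelicot Require Import Coquelicot.
From HB Require Import structures.
From mathcomp Require all_boot all_fingroup all_algebra cyclic zify.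
Open Scope R_scope.

(** * Primitive roots modulo a prime *)

Module PrimitiveRoot.
Import all_boot all_fingroup all_algebra cyclic GRing.Theory.
Set Implicit Arguments.
Unset Strict Implicit.
Local Open Scope nat_scope.

(** The unit group of the field ['F_p] is cyclic, and [g] represents a generator. Both properties
    are phrased as congruences of natural numbers, so that ['F_p] does not appear outside this
    module. *)
Lemma primitive_root (p : nat) : prime p -> exists g : nat,
  (forall n, ~~ (p %| n) -> exists i, (i < p.-1) /\ n = g ^ i %[mod p]) /\
  (forall i, g ^ i = 1 %[mod p] <-> p.-1 %| i).
Proof.
move=> pp.
have /cyclicP [x Ux] := field_unit_group_cyclic [set: {unit 'F_p}]%G.
have ox : #[x]%g = p.-1.
  have := card_finField_unit 'F_p; rewrite card_Fp // => <-.
  by rewrite Ux.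
pose g : nat := val x.
have gE i : ((g ^ i)%:R : 'F_p)%R = val (x ^+ i)%g.
  by rewrite FinRing.val_unitX natrX natr_Zp.
have modE m n : ((m%:R : 'F_p) = n%:R)%R -> m = n %[mod p].
  by move=> /(congr1 val) /=; rewrite !val_Fp_nat.
exists g; split=> [n pn | i].
  have nU : (n%:R : 'F_p)%R \is a GRing.unit by rewrite unitFpE // prime_coprime.
  have : FinRing.unit 'F_p nU \in <[x]>%g by rewrite -Ux inE.
  move=> /cyclePmin [i]; rewrite ox => ip E; exists i; split=> //.
  by apply: modE; rewrite gE -E.
rewrite -ox order_dvdn; split=> [Hi|/eqP Hi].
  apply/eqP; apply: val_inj; rewrite -gE /=.
  by apply: val_inj => /=; rewrite val_Fp_nat // Hi -(val_Fp_nat pp 1).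
by apply: modE; rewrite gE Hi.
Qed.

End PrimitiveRoot.

Module Equidistribution.
Import all_boot zify Coquelicot.Coquelicot Defs PrimitiveRoot.
Set Implicit Arguments.
Unset Strict Implicit.
Unset Printing Implicit Defensive.
(* MathComp binds the key R to ring_scope. *)
Delimit Scope R_scope with R.
Open Scope R_scope.

(** * Complex sums and Dirichlet convolution *)

(** These instances make the [bigop] lemmas (splitting, exchange of sums, distributivity) available
    over [C] and [R]. *)
Fact CplusA : associative Cplus. Proof. by move=> x y z; ring. Qed.
Fact CplusC : commutative Cplus. Proof. by move=> x y; ring. Qed.
Fact Cplus0 : left_id (RtoC 0) Cplus. Proof. by move=> x; ring. Qed.
HB.instance Definition _ :=
  Monoid.isComLaw.Build C (RtoC 0) Cplus CplusA CplusC Cplus0.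
Fact CmultA : associative Cmult. Proof. by move=> x y z; ring. Qed.
Fact CmultC : commutative Cmult. Proof. by move=> x y; ring. Qed.
Fact Cmult1 : left_id (RtoC 1) Cmult. Proof. by move=> x; ring. Qed.
HB.instance Definition _ :=
  Monoid.isComLaw.Build C (RtoC 1) Cmult CmultA CmultC Cmult1.
Fact Cmul0l : left_zero (RtoC 0) Cmult. Proof. by move=> x; ring. Qed.
Fact Cmul0r : right_zero (RtoC 0) Cmult. Proof. by move=> x; ring. Qed.
HB.instance Definition _ := Monoid.isMulLaw.Build C (RtoC 0) Cmult Cmul0l Cmul0r.
Fact CmulDl : left_distributive Cmult Cplus. Proof. by move=> x y z; ring. Qed.
Fact CmulDr : right_distributive Cmult Cplus. Proof. by move=> x y z; ring. Qed.
HB.instance Definition _ := Monoid.isAddLaw.Build C Cmult Cplus CmulDl CmulDr.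
Fact RplusA : associative Rplus. Proof. by move=> x y z; ring. Qed.
Fact RplusC : commutative Rplus. Proof. by move=> x y; ring. Qed.
Fact Rplus0 : left_id 0 Rplus. Proof. by move=> x; ring. Qed.
HB.instance Definition _ := Monoid.isComLaw.Build R 0 Rplus RplusA RplusC Rplus0.
Fact RmultA : associative Rmult. Proof. by move=> x y z; ring. Qed.
Fact RmultC : commutative Rmult. Proof. by move=> x y; ring. Qed.
Fact Rmult1 : left_id 1 Rmult. Proof. by move=> x; ring. Qed.
HB.instance Definition _ := Monoid.isComLaw.Build R 1 Rmult RmultA RmultC Rmult1.
Fact Rmul0l : left_zero 0 Rmult. Proof. by move=> x; ring. Qed.
Fact Rmul0r : right_zero 0 Rmult. Proof. by move=> x; ring. Qed.
HB.instance Definition _ := Monoid.isMulLaw.Build R 0 Rmult Rmul0l Rmul0r.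
Fact RmulDl : left_distributive Rmult Rplus. Proof. by move=> x y z; ring. Qed.
Fact RmulDr : right_distributive Rmult Rplus. Proof. by move=> x y z; ring. Qed.
HB.instance Definition _ := Monoid.isAddLaw.Build R Rmult Rplus RmulDl RmulDr.

Notation "\Rsum_ ( i <- r | P ) F" := (\big[Rplus/IZR Z0]_(i <- r | P%B) F%R)
  (at level 41, F at level 41, i, r at level 50).
Notation "\Rsum_ ( i <- r ) F" := (\big[Rplus/IZR Z0]_(i <- r) F%R)
  (at level 41, F at level 41, i, r at level 50).
Notation "\Rsum_ ( m <= i < n | P ) F" :=
  (\big[Rplus/IZR Z0]_(m <= i < n | P%B) F%R)
  (at level 41, F at level 41, i, m, n at level 50).
Notation "\Rsum_ ( m <= i < n ) F" := (\big[Rplus/IZR Z0]_(m <= i < n) F%R)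
  (at level 41, F at level 41, i, m, n at level 50).
Notation "\Csum_ ( i <- r | P ) F" := (\big[Cplus/RtoC (IZR Z0)]_(i <- r | P%B) F%C)
  (at level 41, F at level 41, i, r at level 50).
Notation "\Csum_ ( i <- r ) F" := (\big[Cplus/RtoC (IZR Z0)]_(i <- r) F%C)
  (at level 41, F at level 41, i, r at level 50).
Notation "\Csum_ ( m <= i < n | P ) F" :=
  (\big[Cplus/RtoC (IZR Z0)]_(m <= i < n | P%B) F%C)
  (at level 41, F at level 41, i, m, n at level 50).
Notation "\Csum_ ( m <= i < n ) F" := (\big[Cplus/RtoC (IZR Z0)]_(m <= i < n) F%C)
  (at level 41, F at level 41, i, m, n at level 50).

Lemma Cmod_sum_le (I : Type) (r : seq I) (P : pred I) (F : I -> C) :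
  Cmod (\Csum_(i <- r | P i) F i) <= \Rsum_(i <- r | P i) Cmod (F i).
Proof.
elim/big_ind2: _ => [|x1 x2 y1 y2 H1 H2|i _].
- rewrite Cmod_0; lra.
- apply: Rle_trans (Cmod_triangle _ _) _; lra.
- lra.
Qed.

Lemma Rsum_le (I : Type) (r : seq I) (P : pred I) (F G : I -> R) :
  (forall i, P i -> F i <= G i) ->
  \Rsum_(i <- r | P i) F i <= \Rsum_(i <- r | P i) G i.
Proof.
move=> H; elim/big_ind2: _ => [|x1 x2 y1 y2 H1 H2|i Pi]; try lra.
exact: H.
Qed.

Lemma Rsum_le_nat m n (F G : nat -> R) :
  (forall i, (m <= i < n)%N -> F i <= G i) ->
  \Rsum_(m <= i < n) F i <= \Rsum_(m <= i < n) G i.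
Proof.
move=> H; rewrite !big_nat; exact: Rsum_le.
Qed.

Lemma Rsum_ge0 (I : Type) (r : seq I) (P : pred I) (F : I -> R) :
  (forall i, P i -> 0 <= F i) -> 0 <= \Rsum_(i <- r | P i) F i.
Proof.
move=> H; elim/big_ind: _ => [|x y|i Pi]; try lra.
exact: H.
Qed.

Lemma Rsum_ge0_nat m n (F : nat -> R) :
  (forall i, (m <= i < n)%N -> 0 <= F i) -> 0 <= \Rsum_(m <= i < n) F i.
Proof. by move=> H; rewrite big_nat; apply: Rsum_ge0. Qed.

Lemma Rsum_const_nat m n (c : R) : (m <= n)%N ->
  \Rsum_(m <= i < n) c = INR (n - m) * c.
Proof.
move=> mn; rewrite big_const_nat.
elim: (n - m)%N => [|k IH]; first by rewrite /=; ring.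
rewrite iterS IH S_INR; ring.
Qed.

Lemma Rsum_telescope m n (F : nat -> R) : (m <= n)%N ->
  \Rsum_(m <= i < n) (F i - F i.+1) = F m - F n.
Proof.
elim: n => [|n IH]; first by rewrite leqn0 => /eqP ->; rewrite big_geq //; ring.
rewrite leq_eqVlt => /orP[/eqP <-|]; first by rewrite big_geq //; ring.
rewrite ltnS => mn; rewrite big_nat_recr //= IH //; ring.
Qed.

Lemma Csum_telescope m n (F : nat -> C) : (m <= n)%N ->
  \Csum_(m <= i < n) (F i - F i.+1) = (F m - F n)%C.
Proof.
elim: n => [|n IH]; first by rewrite leqn0 => /eqP ->; rewrite big_geq //; ring.
rewrite leq_eqVlt => /orP[/eqP <-|]; first by rewrite big_geq //; ring.
rewrite ltnS => mn; rewrite big_nat_recr //= IH //; ring.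
Qed.

Lemma Re_sum (I : Type) (r : seq I) (P : pred I) (F : I -> C) :
  Re (\Csum_(i <- r | P i) F i) = \Rsum_(i <- r | P i) Re (F i).
Proof. by apply: (big_morph Re) => //= x y. Qed.

Lemma Rsum_opp (I : Type) (r : seq I) (P : pred I) (F : I -> R) :
  \Rsum_(i <- r | P i) (- F i) = - \Rsum_(i <- r | P i) F i.
Proof. symmetry; apply: (big_morph Ropp) => [x y|]; ring. Qed.

Lemma Csum_opp (I : Type) (r : seq I) (P : pred I) (F : I -> C) :
  \Csum_(i <- r | P i) (- F i) = (- \Csum_(i <- r | P i) F i)%C.
Proof. symmetry; apply: (big_morph Copp) => [x y|]; ring. Qed.

Lemma Re_le_Cmod (z : C) : Rabs (Re z) <= Cmod z.
Proof. exact: Rle_trans (Rmax_l _ _) (Rmax_Cmod z). Qed.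

Lemma Im_le_Cmod (z : C) : Rabs (Im z) <= Cmod z.
Proof. exact: Rle_trans (Rmax_r _ _) (Rmax_Cmod z). Qed.

Lemma Cmod_le_ReIm (z : C) : Cmod z <= Rabs (Re z) + Rabs (Im z).
Proof.
rewrite {1}(_ : z = RtoC (Re z) + Ci * RtoC (Im z))%C; last first.
  by case: z => x y; rewrite /Cplus /Cmult /=; congr (_, _); ring.
apply: Rle_trans (Cmod_triangle _ _) _.
rewrite Cmod_mult !Cmod_R (_ : Cmod Ci = 1); first lra.
by rewrite /Cmod /= -[X in _ = X]sqrt_1; congr sqrt; ring.
Qed.

Definition Psum (f : nat -> C) (N : nat) : C := \Csum_(1 <= n < N.+1) f n.

Definition is_csum (f : nat -> C) (l : C) : Prop :=
  forall e, 0 < e -> exists N0, forall N, (N0 <= N)%N -> Cmod (Psum f N - l) < e.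

(** Total, hence meaningful only when the partial sums converge; [csum_unique] and [asum_csum] are
    the ways to reach its value. *)
Definition CS (f : nat -> C) : C :=
  (real (Lim_seq (fun N => Re (Psum f N))), real (Lim_seq (fun N => Im (Psum f N)))).

(** One number [B] expresses absolute convergence and bounds the sum, so the sum of the absolute
    values never has to be named. *)
Definition asum (f : nat -> C) (B : R) : Prop :=
  forall N, \Rsum_(1 <= n < N.+1) Cmod (f n) <= B.

Lemma Rsum_split m n p (F : nat -> R) : (m <= n)%N -> (n <= p)%N ->
  \Rsum_(m <= i < p) F i = \Rsum_(m <= i < n) F i + \Rsum_(n <= i < p) F i.
Proof. by move=> mn np; rewrite (@big_cat_nat _ _ _ n). Qed.

Lemma Csum_split m n p (F : nat -> C) : (m <= n)%N -> (n <= p)%N ->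
  \Csum_(m <= i < p) F i = (\Csum_(m <= i < n) F i + \Csum_(n <= i < p) F i)%C.
Proof. by move=> mn np; rewrite (@big_cat_nat _ _ _ n). Qed.

Lemma Psum_diff f N M : (N <= M)%N ->
  (Psum f M - Psum f N)%C = \Csum_(N.+1 <= n < M.+1) f n.
Proof. by move=> NM; rewrite /Psum (@Csum_split _ N.+1 M.+1) //; ring. Qed.

Lemma asum_tail f B : asum f B -> forall e, 0 < e -> exists N0, forall N M,
  (N0 <= N)%N -> \Rsum_(N.+1 <= n < M.+1) Cmod (f n) < e.
Proof.
move=> fB e e0; pose S N := \Rsum_(1 <= n < N.+1) Cmod (f n).
have S_incr n : S n <= S n.+1.
  rewrite /S [X in _ <= X]big_nat_recr //=; have := Cmod_ge_0 (f n.+1); lra.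
have [l Hl] : ex_finite_lim_seq S by apply: (@ex_finite_lim_seq_incr S B).
have Sl n : S n <= l.
  by have := @is_lim_seq_incr_compare S l Hl S_incr n.
move/is_lim_seq_spec: Hl => /(_ (mkposreal e e0)) [N0 HN0].
exists N0 => N M NN0.
have [MN|NM] := leqP M N; first by rewrite big_geq // ltnS.
have -> : \Rsum_(N.+1 <= n < M.+1) Cmod (f n) = S M - S N.
  by rewrite /S (@Rsum_split 1 N.+1 M.+1) //; [ring | lia].
have /= := HN0 N (elimT leP NN0); have := Sl M; have := Sl N.
rewrite /Rabs; case: Rcase_abs; lra.
Qed.

Lemma csum_lim f l : is_csum f l ->
  is_lim_seq (fun N => Re (Psum f N)) (Re l) /\
  is_lim_seq (fun N => Im (Psum f N)) (Im l).
Proof.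
move=> H; split; apply/is_lim_seq_spec => e;
  have [N0 HN0] := H e (cond_pos e); exists N0 => n /leP /HN0 Hn.
- by apply: Rle_lt_trans Hn; rewrite -[_ - _]/(Re (Psum f n - l)); apply: Re_le_Cmod.
- by apply: Rle_lt_trans Hn; rewrite -[_ - _]/(Im (Psum f n - l)); apply: Im_le_Cmod.
Qed.

Lemma csum_unique f l : is_csum f l -> CS f = l.
Proof.
move/csum_lim => [H1 H2]; rewrite /CS.
by rewrite (is_lim_seq_unique _ _ H1) (is_lim_seq_unique _ _ H2) /=; case: (l).
Qed.

Lemma asum_csum f B : asum f B -> is_csum f (CS f).
Proof.
move=> fB.
(* Real and imaginary parts at once: the Cauchy criterion uses only that the projection is additive
   and does not increase the modulus. *)
have cauchy (g : C -> R) : (forall z, Rabs (g z) <= Cmod z) ->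
    (forall x y, g (x - y)%C = g x - g y) ->
    ex_finite_lim_seq (fun N => g (Psum f N)).
  move=> gl gB; apply/ex_lim_seq_cauchy_corr => e.
  have [N0 HN0] := asum_tail fB (cond_pos e).
  exists N0 => n m /leP N0n /leP N0m.
  wlog nm : n m N0n N0m / (n <= m)%N.
    move=> W; case/orP: (leq_total n m) => ?; first exact: W.
    by rewrite Rabs_minus_sym; apply: W.
  rewrite Rabs_minus_sym -gB Psum_diff //.
  apply: Rle_lt_trans (gl _) _; apply: Rle_lt_trans (Cmod_sum_le _ _ _) _.
  exact: HN0.
have /Lim_seq_correct' /is_lim_seq_spec H1 := cauchy Re Re_le_Cmod (fun _ _ => erefl).
have /Lim_seq_correct' /is_lim_seq_spec H2 := cauchy Im Im_le_Cmod (fun _ _ => erefl).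
move=> e e0; have e2 : 0 < e / 2 by lra.
have [N1 HN1] := H1 (mkposreal _ e2); have [N2 HN2] := H2 (mkposreal _ e2).
exists (maxn N1 N2) => N; rewrite geq_max => /andP[/leP L1 /leP L2].
have /= := HN1 _ L1; have /= := HN2 _ L2.
have := Cmod_le_ReIm (Psum f N - CS f)%C; rewrite /CS /Re /Im /=; rewrite /Rminus; lra.
Qed.

Lemma csum_bound f l B N0 : is_csum f l ->
  (forall N, (N0 <= N)%N -> Cmod (Psum f N) <= B) -> Cmod l <= B.
Proof.
move=> H HB; apply: le_epsilon => e /H [N1 HN1].
pose N := maxn N0 N1.
have H1 := HB N (leq_maxl _ _); have H2 := HN1 N (leq_maxr _ _).
have := Cmod_triangle (Psum f N) (- (Psum f N - l)); rewrite Cmod_opp.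
have -> : (Psum f N + - (Psum f N - l))%C = l by ring.
lra.
Qed.

Lemma asum_bound f B : asum f B -> Cmod (CS f) <= B.
Proof.
move=> fB; apply: (csum_bound (N0 := 0%N) (asum_csum fB)) => N _.
exact: Rle_trans (Cmod_sum_le _ _ _) (fB N).
Qed.

Lemma asum_ge0 f B : asum f B -> 0 <= B.
Proof. by move/(_ 0%N); rewrite big_geq. Qed.

Lemma csum_ext f g l : (forall n, (0 < n)%N -> f n = g n) -> is_csum f l -> is_csum g l.
Proof.
move=> fg H e /H [N0 HN0]; exists N0 => N /HN0.
rewrite /Psum (@eq_big_nat _ _ _ 1%N N.+1 f g) // => i /andP[i0 _]; exact: fg.
Qed.

Lemma CS_ext f g : (forall n, (0 < n)%N -> f n = g n) -> CS f = CS g.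
Proof.
move=> fg; rewrite /CS.
have E N : Psum f N = Psum g N.
  by rewrite /Psum; apply: eq_big_nat => i /andP[i0 _]; apply: fg.
by congr (_, _); congr real; apply: Lim_seq_ext => n; rewrite E.
Qed.

Lemma csum_plus f g l m : is_csum f l -> is_csum g m ->
  is_csum (fun n => f n + g n)%C (l + m)%C.
Proof.
move=> Hf Hg e e0; have e2 : 0 < e / 2 by lra.
have [N1 H1] := Hf _ e2; have [N2 H2] := Hg _ e2.
exists (maxn N1 N2) => N; rewrite geq_max => /andP[/H1 L1 /H2 L2].
rewrite /Psum big_split /= -!/(Psum _ _).
have -> : (Psum f N + Psum g N - (l + m) = (Psum f N - l) + (Psum g N - m))%C by ring.
apply: Rle_lt_trans (Cmod_triangle _ _) _; lra.
Qed.

Lemma csum_scal c f l : is_csum f l -> is_csum (fun n => c * f n)%C (c * l)%C.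
Proof.
move=> Hf e e0; have c0 := Cmod_ge_0 c.
have [|N0 H0] := Hf (e / (Cmod c + 1)); first by apply: Rdiv_lt_0_compat; lra.
exists N0 => N /H0 L; rewrite /Psum -big_distrr /= -/(Psum _ _).
have -> : (c * Psum f N - c * l = c * (Psum f N - l))%C by ring.
rewrite Cmod_mult; apply: Rle_lt_trans (_ : _ <= (Cmod c + 1) * Cmod (Psum f N - l)) _.
  by apply: Rmult_le_compat_r; [exact: Cmod_ge_0 | lra].
apply: Rlt_le_trans (_ : _ < (Cmod c + 1) * (e / (Cmod c + 1))) _.
  by apply: Rmult_lt_compat_l => //; lra.
by right; field; lra.
Qed.

Lemma asum_le f g B : (forall n, (0 < n)%N -> Cmod (f n) <= Cmod (g n)) ->
  asum g B -> asum f B.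
Proof.
move=> fg gB N; apply: Rle_trans (gB N); apply: Rsum_le_nat => i /andP[i0 _]; exact: fg.
Qed.

Lemma asum_scal c f B : asum f B -> asum (fun n => c * f n)%C (Cmod c * B).
Proof.
move=> fB N; apply: Rle_trans (_ : _ <= Cmod c * \Rsum_(1 <= n < N.+1) Cmod (f n)) _.
  by rewrite big_distrr /=; apply: Rsum_le => i _; rewrite Cmod_mult; lra.
by apply: Rmult_le_compat_l (fB N); exact: Cmod_ge_0.
Qed.

Definition conv (f g : nat -> C) (n : nat) : C :=
  \Csum_(1 <= d < n.+1 | (d %| n)%N) (f d * g (n %/ d)%N).


Lemma big_multiples (T : Type) (idx : T) (op : Monoid.law idx) (F : nat -> T) d N :
  (0 < d)%N ->
  \big[op/idx]_(1 <= n < N.+1 | (d %| n)%N) F n =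
  \big[op/idx]_(1 <= e < (N %/ d).+1) F (d * e)%N.
Proof.
move=> d0; elim: N => [|N IH]; first by rewrite div0n !big_geq.
rewrite big_mkcond big_nat_recr //= -big_mkcond IH divnS //.
case: (boolP (d %| N.+1)%N) => [dN|_]; last by rewrite Monoid.mulm1.
rewrite add1n [in RHS]big_nat_recr //=; congr (op _ (F _)).
by rewrite -{1}(divnK dN) divnS // dN mulnC.
Qed.

(** Groups the pairs with product at most N by their first factor. *)
Lemma Psum_conv f g N :
  Psum (conv f g) N = \Csum_(1 <= d < N.+1) (f d * Psum g (N %/ d)).
Proof.
rewrite /Psum /conv.
transitivity (\Csum_(1 <= n < N.+1) \Csum_(1 <= d < N.+1 | (d %| n)%N) (f d * g (n %/ d)%N)).
  apply: eq_big_nat => n /andP[n0 nN].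
  rewrite [in RHS](@big_cat_nat _ _ _ n.+1) //=.
  rewrite [X in (_ + X)%C]big1_seq ?Monoid.mulm1 // => i /andP[/dvdn_leq]; move/(_ n0).
  rewrite mem_index_iota; lia.
rewrite (exchange_big_dep_nat xpredT) //=.
apply: eq_big_nat => d /andP[d0 dN]; rewrite -big_distrr /=; congr Cmult.
by rewrite (@big_multiples _ _ _ (fun n => g (n %/ d)%N)) // /Psum; under eq_bigr do rewrite mulKn //.
Qed.

(** For small d the cofactor runs over a long range and its sum is close to [CS g]; the large d lie
    in the tail of the absolutely convergent series of [f]. *)
Lemma csum_conv f g Bf Bg : asum f Bf -> asum g Bg ->
  is_csum (conv f g) (CS f * CS g)%C.
Proof.
move=> Hf Hg e e0.
have Bf0 := asum_ge0 Hf; have Bg0 := asum_ge0 Hg.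
(* The three errors add up to d (Bf + 3 Bg): small d, tail of [f], and replacing [Psum f N] by
   [CS f]. *)
pose d := e / (4 * (Bf + Bg + 1)).
have d0 : 0 < d by apply: Rdiv_lt_0_compat; lra.
have dE : d * (4 * (Bf + Bg + 1)) = e by rewrite /d; field; lra.
have [K0 HK] := asum_csum Hg d0.
have [N1 HN1] := asum_tail Hf d0.
have [N2 HN2] := asum_csum Hf d0.
pose K := K0.+1.
exists (maxn (K * N1.+1)%N N2) => N; rewrite geq_max => /andP[L1 L2].
rewrite Psum_conv.
(* For indices up to [P] the quotient of N is at least [K], past which the partial sums of [g] have
   settled. *)
pose P := (N %/ K)%N.
have PN : (P <= N)%N by exact: leq_div.
have N1P : (N1 <= P)%N by rewrite /P leq_divRL //; lia.
have -> : (\Csum_(1 <= d < N.+1) (f d * Psum g (N %/ d)) - CS f * CS g =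
   \Csum_(1 <= d < N.+1) (f d * (Psum g (N %/ d) - CS g)) + (Psum f N - CS f) * CS g)%C.
  have -> : \Csum_(1 <= d < N.+1) (f d * (Psum g (N %/ d) - CS g)) =
     (\Csum_(1 <= d < N.+1) (f d * Psum g (N %/ d)) - Psum f N * CS g)%C.
    rewrite /Psum big_distrl /= /Cminus -Csum_opp -big_split /=.
    by apply: eq_bigr => i _; ring.
  ring.
apply: Rle_lt_trans (Cmod_triangle _ _) _.
have T2 : Cmod ((Psum f N - CS f) * CS g) <= d * Bg.
  rewrite Cmod_mult; apply: Rmult_le_compat; try exact: Cmod_ge_0.
    by left; apply: HN2.
  exact: asum_bound Hg.
have T1 : Cmod (\Csum_(1 <= d < N.+1) (f d * (Psum g (N %/ d) - CS g))) <= d * Bf + d * (2 * Bg).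
  apply: Rle_trans (Cmod_sum_le _ _ _) _.
  rewrite (@Rsum_split 1 P.+1 N.+1) //.
  apply: Rplus_le_compat.
    apply: Rle_trans (_ : _ <= \Rsum_(1 <= i < P.+1) (d * Cmod (f i))) _.
      apply: Rsum_le_nat => i /andP[i0 iP]; rewrite Cmod_mult Rmult_comm.
      apply: Rmult_le_compat_r; first exact: Cmod_ge_0.
      left; apply: HK; rewrite leq_divRL //.
      have : (i * K <= N)%N by rewrite -leq_divRL.
      lia.
    rewrite -big_distrr /=; apply: Rmult_le_compat_l; [lra | exact: Hf].
  apply: Rle_trans (_ : _ <= \Rsum_(P.+1 <= i < N.+1) (Cmod (f i) * (2 * Bg))) _.
    apply: Rsum_le => i _; rewrite Cmod_mult.
    apply: Rmult_le_compat_l; first exact: Cmod_ge_0.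
    apply: Rle_trans (Cmod_triangle _ _) _; rewrite Cmod_opp.
    have := asum_bound Hg.
    have := Rle_trans _ _ _ (Cmod_sum_le (index_iota 1 (N %/ i).+1) xpredT g) (Hg (N %/ i)%N).
    rewrite -/(Psum g _); lra.
  rewrite -big_distrl /=; apply: Rmult_le_compat_r; first lra.
  by left; apply: HN1.
have : d * Bf + d * (2 * Bg) + d * Bg < d * (4 * (Bf + Bg + 1)).
  have -> : d * Bf + d * (2 * Bg) + d * Bg = d * (Bf + 3 * Bg) by ring.
  apply: Rmult_lt_compat_l => //; lra.
lra.
Qed.

(** * Dirichlet series in a real variable *)

Lemma Cmod_sqr z : Cmod z * Cmod z = Re z * Re z + Im z * Im z.
Proof.
rewrite /Cmod sqrt_sqrt; first by rewrite /Re /Im /=; ring.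
by apply: Rplus_le_le_0_compat; apply: pow2_ge_0.
Qed.

Lemma nonincr_of_derive (f f' : R -> R) a b : a <= b ->
  (forall t, a <= t <= b -> is_derive f t (f' t)) ->
  (forall t, a <= t <= b -> f' t <= 0) -> f b <= f a.
Proof.
move=> ab Hd Hle; have [E|ab'] : a = b \/ a < b by lra.
  by rewrite E; lra.
have [||c [Hc1 Hc2]] := @MVT_gen f a b f'.
- by move=> x; rewrite Rmin_left // Rmax_right // => ?; apply: Hd; lra.
- move=> x; rewrite Rmin_left // Rmax_right // => ?.
  apply/continuity_pt_filterlim.
  by apply: (@ex_derive_continuous _ _ f x); exists (f' x); apply: Hd; lra.
move: Hc1; rewrite Rmin_left // Rmax_right // => /Hle; nra.
Qed.

(** The equality of the mean value theorem fails for complex values. Projecting on the direction of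
    F b - F a makes the function real, and by Cauchy-Schwarz its derivative is at most [Cmod (f t)].
    This lemma stands in for every estimate of an integral by a primitive [phi] of a majorant. *)
Lemma Cmod_mean_value (F f : R -> C) (phi phi' : R -> R) a b : a <= b ->
  (forall t, a <= t <= b -> is_derive (fun t => Re (F t)) t (Re (f t))) ->
  (forall t, a <= t <= b -> is_derive (fun t => Im (F t)) t (Im (f t))) ->
  (forall t, a <= t <= b -> is_derive phi t (phi' t)) ->
  (forall t, a <= t <= b -> Cmod (f t) <= phi' t) ->
  Cmod (F b - F a) <= phi b - phi a.
Proof.
move=> ab HR HI Hp Hle.
set z := (F b - F a)%C.
have [z0|z0] := Req_dec (Cmod z) 0.
  have H := @nonincr_of_derive (fun t => - phi t) (fun t => - phi' t) a b ab.
  suff : - phi b <= - phi a by lra.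
  apply: H => t Ht; first by apply: is_derive_opp; apply: Hp.
  have := Hle t Ht; have := Cmod_ge_0 (f t); lra.
have zpos : 0 < Cmod z by have := Cmod_ge_0 z; lra.
pose cr := Re z / Cmod z; pose ci := Im z / Cmod z.
have zsq : Cmod z * Cmod z = Re z * Re z + Im z * Im z.
  exact: Cmod_sqr.
have c1 : cr * cr + ci * ci = 1.
  rewrite /cr /ci (_ : _ + _ = (Re z * Re z + Im z * Im z) / (Cmod z * Cmod z)); last by field.
  by rewrite -zsq; field.
have cz : cr * Re z + ci * Im z = Cmod z.
  rewrite /cr /ci (_ : _ + _ = (Re z * Re z + Im z * Im z) / Cmod z); last by field.
  by rewrite -zsq; field.
pose g t := cr * Re (F t) + ci * Im (F t) - phi t.
pose g' t := cr * Re (f t) + ci * Im (f t) - phi' t.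
have gab : g b <= g a.
  apply: (@nonincr_of_derive g g') => // t Ht.
    apply: is_derive_minus; last exact: Hp.
    by apply: is_derive_plus; apply: is_derive_scal; [apply: HR | apply: HI].
  have L := Hle t Ht; have K0 := Cmod_ge_0 (f t).
  have fsq : Cmod (f t) * Cmod (f t) = Re (f t) * Re (f t) + Im (f t) * Im (f t).
    exact: Cmod_sqr.
  rewrite /g'; suff : cr * Re (f t) + ci * Im (f t) <= Cmod (f t) by lra.
  set A := Re (f t) in fsq *; set B := Im (f t) in fsq *.
  have : (cr * A + ci * B) * (cr * A + ci * B) <= Cmod (f t) * Cmod (f t).
    have -> : Cmod (f t) * Cmod (f t) = (cr * cr + ci * ci) * (A * A + B * B).
      by rewrite c1 fsq; ring.
    have := Rle_0_sqr (cr * B - ci * A); rewrite /Rsqr; lra.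
  nra.
have -> : Cmod z = (cr * Re (F b) + ci * Im (F b)) - (cr * Re (F a) + ci * Im (F a)).
  have ER : Re z = Re (F b) - Re (F a) by [].
  have EI : Im z = Im (F b) - Im (F a) by [].
  by rewrite -cz ER EI; ring.
move: gab; rewrite /g; lra.
Qed.

Lemma exp_le_mono x y : x <= y -> exp x <= exp y.
Proof. by case=> [H|->]; [left; apply: exp_increasing | lra]. Qed.

Lemma exp_sub1_le x : exp x - 1 <= x * exp x.
Proof.
have := exp_ineq1_le (- x); rewrite exp_Ropp => H.
have e0 := exp_pos x.
have : (1 + - x) * exp x <= / exp x * exp x by apply: Rmult_le_compat_r; lra.
rewrite Rinv_l; lra.
Qed.

Lemma exp_taylor1 x : Rabs (exp x - 1 - x) <= x ^ 2 * exp (Rabs x).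
Proof.
have L1 : 1 + x <= exp x by apply: exp_ineq1_le.
have L2 := exp_sub1_le x.
rewrite Rabs_pos_eq; last lra.
have [x0|x0] := Rle_dec 0 x.
  rewrite Rabs_pos_eq //=; nra.
rewrite Rabs_left; last lra.
have : 1 <= exp (- x) by have := exp_ineq1_le (- x); lra.
have := exp_pos x => e0 H /=.
have : x * x <= x * x * exp (- x) by have : 0 <= x * x; nra.
nra.
Qed.

(** From z <= e^z at z = c u / (k+1), raised to the power k; taking k+1 instead of k keeps the
    denominator positive. All bounds of powers of logarithms by small powers come from here. *)
Lemma pow_le_exp k c u : 0 < c -> 0 <= u ->
  u ^ k <= (INR k.+1 / c) ^ k * exp (c * u).
Proof.
move=> c0 u0.
have k0 : 0 < INR k.+1 by apply: lt_0_INR; lia.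
have -> : u = (INR k.+1 / c) * (c * u / INR k.+1) by field; lra.
rewrite {1}Rpow_mult_distr.
apply: Rmult_le_compat_l; first by apply: pow_le; left; apply: Rdiv_lt_0_compat.
pose z := c * u / INR k.+1; rewrite -/z.
have z0 : 0 <= z by apply: Rdiv_le_0_compat => //; nra.
have -> : c * (INR k.+1 / c * z) = INR k.+1 * z by field; lra.
apply: Rle_trans (_ : _ <= exp z ^ k) _.
  by apply: pow_incr; split => //; have := exp_ineq1_le z; lra.
have {}z0 := z0; move: {k0} (z) z0 => {}z z0; elim: k => [|k IH].
  rewrite /= Rmult_1_l; have := exp_ineq1_le z; lra.
have -> : INR k.+2 * z = z + INR k.+1 * z by rewrite [INR k.+2]S_INR; ring.
rewrite exp_plus /=; apply: Rmult_le_compat_l; [by left; exact: exp_pos | exact: IH].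
Qed.

Definition lnN (n : nat) : R := ln (INR n).
(* [wt s n] is n^{-s} and [zit t n] is n^{-it}. Both equal 1 at [n = 0], where Stdlib's [ln]
   vanishes; every series starts at [n = 1]. *)
Definition wt (s : R) (n : nat) : R := exp (- s * lnN n).
Definition zit (t : R) (n : nat) : C := (cos (t * lnN n), - sin (t * lnN n)).

Lemma INR_ge1 n : (0 < n)%N -> 1 <= INR n.
Proof. by move=> n0; rewrite -[1]/(INR 1); apply: le_INR; lia. Qed.

Lemma lnN_ge0 n : 0 <= lnN n.
Proof.
case: n => [|n]; first by rewrite /lnN /ln; case: Rlt_dec => [H|_]; [case: (Rlt_irrefl _ H) | lra].
by rewrite /lnN -ln_1; apply: ln_le; [lra | apply: INR_ge1].
Qed.

Lemma lnN1 : lnN 1 = 0. Proof. by rewrite /lnN /= ln_1. Qed.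

Lemma lnN_mul m n : (0 < m)%N -> (0 < n)%N -> lnN (m * n) = lnN m + lnN n.
Proof.
by move=> /INR_ge1 m0 /INR_ge1 n0; rewrite /lnN mult_INR ln_mult //; lra.
Qed.

Lemma exp_lnN n : (0 < n)%N -> exp (lnN n) = INR n.
Proof. by move/INR_ge1 => n0; rewrite /lnN exp_ln //; lra. Qed.

Lemma lnN_le m n : (0 < m)%N -> (m <= n)%N -> lnN m <= lnN n.
Proof.
move=> m0 mn; apply: ln_le; first by have := INR_ge1 m0; lra.
by apply: le_INR; lia.
Qed.

Lemma wt_pos s n : 0 < wt s n. Proof. exact: exp_pos. Qed.

Lemma wt_mul s m n : (0 < m)%N -> (0 < n)%N -> wt s (m * n) = wt s m * wt s n.
Proof. by move=> m0 n0; rewrite /wt lnN_mul // -exp_plus; congr exp; ring. Qed.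

Lemma wt_1 s : wt s 1 = 1. Proof. by rewrite /wt lnN1 Rmult_0_r exp_0. Qed.

Lemma wt1E n : (0 < n)%N -> wt 1 n = / INR n.
Proof.
move=> n0; rewrite /wt (_ : - (1) * lnN n = - lnN n); last by ring.
by rewrite exp_Ropp exp_lnN.
Qed.

Lemma wt_le s s' n : s <= s' -> wt s' n <= wt s n.
Proof.
move=> ss; have l0 := lnN_ge0 n.
have [E|E] : - s' * lnN n < - s * lnN n \/ - s' * lnN n = - s * lnN n by nra.
  by left; apply: exp_increasing.
by rewrite /wt E; lra.
Qed.

Lemma zit_mul t m n : (0 < m)%N -> (0 < n)%N -> zit t (m * n) = (zit t m * zit t n)%C.
Proof.
move=> m0 n0; rewrite /zit lnN_mul // Rmult_plus_distr_l cos_plus sin_plus /Cmult /=.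
by congr (_, _); ring.
Qed.

Lemma zit_1 t : zit t 1 = RtoC 1.
Proof. by rewrite /zit lnN1 Rmult_0_r cos_0 sin_0 Ropp_0. Qed.

Lemma Cmod_zit t n : Cmod (zit t n) = 1.
Proof.
rewrite /Cmod /zit /= -[RHS]sqrt_1; congr sqrt.
have := sin2_cos2 (t * lnN n); rewrite /Rsqr; lra.
Qed.

Lemma lnN_succ_diff n : (0 < n)%N -> / INR n.+1 <= lnN n.+1 - lnN n.
Proof.
move=> n0; have n1 := INR_ge1 n0; have n2 : 0 < INR n.+1 by apply: lt_0_INR; lia.
have H := exp_ineq1_le (lnN n - lnN n.+1).
rewrite {2}/Rminus exp_plus exp_Ropp !exp_lnN // in H.
suff : INR n * / INR n.+1 = 1 - / INR n.+1 by lra.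
rewrite S_INR in n2 *; field; lra.
Qed.

(** Discrete form of comparing (n+1)^{-s} with the integral of u^{-s} from n to n+1; the tails of
    the series then telescope. *)
Lemma wt_telescope s n : 1 < s -> (0 < n)%N ->
  wt s n.+1 <= (wt (s - 1) n - wt (s - 1) n.+1) / (s - 1).
Proof.
move=> s1 n0.
have d := lnN_succ_diff n0.
have n2 : 0 < INR n.+1 by apply: lt_0_INR; lia.
have -> : wt s n.+1 = wt (s - 1) n.+1 * / INR n.+1.
  by rewrite -wt1E // /wt -exp_plus; congr exp; ring.
have -> : wt (s - 1) n = wt (s - 1) n.+1 * exp ((s - 1) * (lnN n.+1 - lnN n)).
  by rewrite /wt -exp_plus; congr exp; ring.
have H := exp_ineq1_le ((s - 1) * (lnN n.+1 - lnN n)).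
have w0 := wt_pos (s - 1) n.+1.
rewrite (_ : (_ - _) / _ = wt (s - 1) n.+1 * ((exp ((s - 1) * (lnN n.+1 - lnN n)) - 1) / (s - 1))); last by field; lra.
apply: Rmult_le_compat_l; first lra.
apply: Rle_trans d _.
apply: (Rmult_le_reg_r (s - 1)); first lra.
rewrite /Rdiv Rmult_assoc Rinv_l; lra.
Qed.

Lemma wt_tail_sum s N M : 1 < s -> (0 < N)%N ->
  \Rsum_(N.+1 <= n < M.+1) wt s n <= wt (s - 1) N / (s - 1).
Proof.
move=> s1 N0.
have pos : 0 < / (s - 1) by apply: Rinv_0_lt_compat; lra.
have [NM|NM] := leqP N M; last first.
  rewrite big_geq; last lia.
  by have := wt_pos (s - 1) N; rewrite /Rdiv; nra.
rewrite big_add1 /=.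
apply: Rle_trans (_ : _ <= \Rsum_(N <= n < M) (wt (s - 1) n / (s - 1) - wt (s - 1) n.+1 / (s - 1))) _.
  apply: Rsum_le_nat => i /andP[Ni _].
  have := @wt_telescope s i s1 (leq_trans N0 Ni); rewrite /Rdiv; lra.
rewrite Rsum_telescope //; have := wt_pos (s - 1) M; rewrite /Rdiv; nra.
Qed.

Lemma wt_sum s N : 1 < s -> \Rsum_(1 <= n < N.+1) wt s n <= 1 + 1 / (s - 1).
Proof.
move=> s1; have pos : 0 < / (s - 1) by apply: Rinv_0_lt_compat; lra.
case: N => [|N]; first by rewrite big_geq //; rewrite /Rdiv; lra.
rewrite (@Rsum_split 1 2 N.+2) // big_nat1 wt_1.
have := @wt_tail_sum s 1 N.+1 s1 isT; rewrite wt_1; lra.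
Qed.

(** k = 0 covers characters and their twists, k = 1 covers coefficients weighted by the von Mangoldt
    function, and j differentiations raise k by j. *)
Definition adm (k : nat) (a : nat -> C) : Prop :=
  forall n, (0 < n)%N -> Cmod (a n) <= lnN n ^ k.

Definition wterm (a : nat -> C) (s : R) (n : nat) : C := (a n * RtoC (wt s n))%C.
Definition Dser (a : nat -> C) (s : R) : C := CS (wterm a s).
(** [Dser (lnk k a)] is (-1)^k times the k-th derivative of [Dser a]. Leaving the sign out keeps the
    Leibniz formulas free of signs. *)
Definition lnk (k : nat) (a : nat -> C) (n : nat) : C := (a n * RtoC (lnN n ^ k))%C.

Lemma Cmod_wterm a s n : Cmod (wterm a s n) = Cmod (a n) * wt s n.
Proof. by rewrite Cmod_mult Cmod_R Rabs_pos_eq //; left; exact: wt_pos. Qed.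

(** Half of the margin s - 1 absorbs (log n)^k through [pow_le_exp]; the other half keeps the
    remaining series convergent. *)
Definition admB (k : nat) (s : R) : R :=
  (INR k.+1 / ((s - 1) / 2)) ^ k * (1 + 1 / ((s - 1) / 2)).

Lemma adm_asum k a s : adm k a -> 1 < s -> asum (wterm a s) (admB k s).
Proof.
move=> ad s1 N.
have d0 : 0 < (s - 1) / 2 by lra.
apply: Rle_trans (_ : _ <= \Rsum_(1 <= n < N.+1) ((INR k.+1 / ((s - 1) / 2)) ^ k * wt (1 + (s - 1) / 2) n)) _.
  apply: Rsum_le_nat => i /andP[i0 _]; rewrite Cmod_wterm.
  apply: Rle_trans (_ : _ <= lnN i ^ k * wt s i) _.
    by apply: Rmult_le_compat_r; [left; exact: wt_pos | exact: ad].
  apply: Rle_trans (_ : _ <= ((INR k.+1 / ((s - 1) / 2)) ^ k * exp ((s - 1) / 2 * lnN i)) * wt s i) _.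
    apply: Rmult_le_compat_r; first by left; exact: wt_pos.
    by apply: pow_le_exp => //; exact: lnN_ge0.
  right; rewrite Rmult_assoc; congr Rmult; rewrite /wt -exp_plus; congr exp; field.
rewrite -big_distrr /= /admB; apply: Rmult_le_compat_l.
  by apply: pow_le; apply: Rdiv_le_0_compat => //; exact: (pos_INR k.+1).
have := @wt_sum (1 + (s - 1) / 2) N; rewrite (_ : 1 + _ - 1 = (s - 1) / 2); last by ring.
by apply; lra.
Qed.

Lemma Dser_csum k a s : adm k a -> 1 < s -> is_csum (wterm a s) (Dser a s).
Proof. by move=> ad s1; apply: asum_csum (adm_asum ad s1). Qed.

Lemma Dser_ext a b s : (forall n, (0 < n)%N -> a n = b n) -> Dser a s = Dser b s.
Proof. by move=> H; apply: CS_ext => n n0; rewrite /wterm H. Qed.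

Lemma adm_lnk j k a : adm k a -> adm (k + j) (lnk j a).
Proof.
move=> ad n n0; rewrite Cmod_mult Cmod_R Rabs_pos_eq; last by apply: pow_le; exact: lnN_ge0.
rewrite -[(k + j)%N]/(Nat.add k j) pow_add; apply: Rmult_le_compat_r; last exact: ad.
by apply: pow_le; exact: lnN_ge0.
Qed.

Lemma lnk0 a n : lnk 0 a n = a n.
Proof. by rewrite /lnk /=; ring. Qed.

Lemma lnk_lnk i j a n : lnk i (lnk j a) n = lnk (i + j) a n.
Proof.
by rewrite /lnk -[(i + j)%N]/(Nat.add i j) pow_add RtoC_mult; ring.
Qed.

Lemma Dser_conv ka kb a b c s : adm ka a -> adm kb b -> 1 < s ->
  (forall n, (0 < n)%N -> c n = conv a b n) -> Dser c s = (Dser a s * Dser b s)%C.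
Proof.
move=> aa ab s1 H; apply: csum_unique.
apply: csum_ext (csum_conv (adm_asum aa s1) (adm_asum ab s1)) => n n0.
rewrite /conv /wterm H // /conv big_distrl /=.
rewrite big_seq_cond [RHS]big_seq_cond; apply: eq_bigr => d /andP[].
rewrite mem_index_iota => /andP[d0 _] /dvdnP [e E].
rewrite {}E mulnK // in n0 *.
have e0 : (0 < e)%N by move: n0; rewrite muln_gt0 => /andP[].
by rewrite wt_mul // RtoC_mult; ring.
Qed.

(** Second-order Taylor expansion of n^{-h} in each term. As |h| <= (s-1)/2, the factor n^{|h|} of
    the remainder lowers the exponent to 1 + (s-1)/2 at worst, where the series weighted by (log
    n)^2 still converges. *)
Lemma Dser_diff k a s h : adm k a -> 1 < s -> Rabs h <= (s - 1) / 2 ->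
  Cmod (Dser a (s + h) - Dser a s + RtoC h * Dser (lnk 1 a) s)
    <= h ^ 2 * admB (k + 2) (s - (s - 1) / 2).
Proof.
move=> ad s1 hs.
have hle := Rle_abs (- h); rewrite Rabs_Ropp in hle.
have sh : 1 < s + h by lra.
have -> : (Dser a (s + h) - Dser a s + RtoC h * Dser (lnk 1 a) s)%C =
   CS (fun n => wterm a (s + h) n + (RtoC (-1) * wterm a s n + RtoC h * wterm (lnk 1 a) s n))%C.
  symmetry; rewrite (_ : (Dser a (s + h) - Dser a s + RtoC h * Dser (lnk 1 a) s)%C =
    (Dser a (s + h) + (RtoC (-1) * Dser a s + RtoC h * Dser (lnk 1 a) s))%C); last by ring.
  apply: csum_unique; apply: csum_plus; first exact: Dser_csum ad sh.
  apply: csum_plus; apply: csum_scal; first exact: Dser_csum ad s1.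
  exact: Dser_csum (adm_lnk 1 ad) s1.
apply: asum_bound.
have -> : h ^ 2 = Cmod (RtoC (h ^ 2)) by rewrite Cmod_R Rabs_pos_eq //; nra.
apply: asum_le (asum_scal _ (adm_asum (adm_lnk 2 ad) (_ : 1 < s - (s - 1) / 2))); last lra.
move=> n n0.
have -> : (wterm a (s + h) n + (RtoC (-1) * wterm a s n + RtoC h * wterm (lnk 1 a) s n))%C =
   (a n * RtoC (wt s n * (exp (- h * lnN n) - 1 - (- h * lnN n))))%C.
  have -> : wt s n * (exp (- h * lnN n) - 1 - (- h * lnN n)) =
     wt (s + h) n + (-1 * wt s n + h * (lnN n ^ 1 * wt s n)).
    rewrite /wt (_ : - (s + h) * lnN n = - s * lnN n + - h * lnN n); last by ring.
    rewrite exp_plus; ring.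
  by rewrite /wterm /lnk !RtoC_plus !RtoC_mult; ring.
rewrite /wterm /lnk !Cmod_mult !Cmod_R.
rewrite (_ : Rabs (h ^ 2) * (Cmod (a n) * Rabs (lnN n ^ 2) * Rabs (wt (s - (s - 1) / 2) n)) = Cmod (a n) * (Rabs (h ^ 2) * Rabs (lnN n ^ 2) * Rabs (wt (s - (s - 1) / 2) n))); last by ring.
apply: Rmult_le_compat_l; first exact: Cmod_ge_0.
have l0 := lnN_ge0 n.
rewrite -!Rabs_mult Rabs_mult [Rabs (wt s n)]Rabs_pos_eq; last by left; exact: wt_pos.
apply: Rle_trans (_ : _ <= wt s n * ((- h * lnN n) ^ 2 * exp (Rabs (- h * lnN n)))) _.
  apply: Rmult_le_compat_l; [by left; exact: wt_pos | exact: exp_taylor1].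
rewrite [X in _ <= X]Rabs_pos_eq; last first.
  by apply: Rmult_le_pos; [nra | left; exact: wt_pos].
rewrite (_ : wt s n * _ = h ^ 2 * lnN n ^ 2 * (wt s n * exp (Rabs (- h * lnN n)))); last by ring.
apply: Rmult_le_compat_l; first by nra.
rewrite /wt -exp_plus.
have E : - s * lnN n + Rabs (- h * lnN n) <= - (s - (s - 1) / 2) * lnN n.
  rewrite Rabs_mult Rabs_Ropp (Rabs_pos_eq (lnN n)) //; nra.
exact: exp_le_mono.
Qed.

Lemma derivable_quadratic (f : R -> R) x l r B : 0 < r ->
  (forall h, Rabs h <= r -> Rabs (f (x + h) - f x - h * l) <= h ^ 2 * B) ->
  is_derive f x l.
Proof.
move=> r0 H; apply/is_derive_Reals => e e0.
have B0 : 0 <= B.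
  have := H r (Req_le _ _ (Rabs_pos_eq _ (Rlt_le _ _ r0))).
  have := Rabs_pos (f (x + r) - f x - r * l) => H1 H2.
  have : 0 < r ^ 2 by apply: pow_lt.
  nra.
have d0 : 0 < Rmin r (e / (B + 1)).
  by apply: Rmin_pos => //; apply: Rdiv_lt_0_compat; lra.
exists (mkposreal _ d0) => h h0 /= hd.
have h1 : Rabs h <= r by have := Rmin_l r (e / (B + 1)); lra.
have h2 : Rabs h < e / (B + 1) by have := Rmin_r r (e / (B + 1)); lra.
have -> : (f (x + h) - f x) / h - l = (f (x + h) - f x - h * l) / h by field.
have hp : 0 < Rabs h by apply: Rabs_pos_lt.
rewrite Rabs_div //.
apply: (Rmult_lt_reg_r (Rabs h)) => //.
rewrite /Rdiv Rmult_assoc Rinv_l; last lra.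
rewrite Rmult_1_r; apply: Rle_lt_trans (H h h1) _.
have -> : h ^ 2 = Rabs h * Rabs h by rewrite -Rabs_mult Rabs_pos_eq; [ring | nra].
have : Rabs h * (B + 1) < e.
  have := Rmult_lt_compat_r (B + 1) _ _ _ h2; rewrite /Rdiv Rmult_assoc Rinv_l; lra.
nra.
Qed.

Lemma Dser_derive k a s : adm k a -> 1 < s ->
  is_derive (fun s => Re (Dser a s)) s (Re (- Dser (lnk 1 a) s)%C) /\
  is_derive (fun s => Im (Dser a s)) s (Im (- Dser (lnk 1 a) s)%C).
Proof.
move=> ad s1; split;
  apply: (@derivable_quadratic _ _ _ ((s - 1) / 2) (admB (k + 2) (s - (s - 1) / 2))); try lra;
  move=> h hs; apply: Rle_trans (Dser_diff ad s1 hs);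
  [apply: Rle_trans (Re_le_Cmod _) | apply: Rle_trans (Im_le_Cmod _)];
  right; congr Rabs; rewrite /=; ring.
Qed.

Lemma Dser_lipschitz k a s s' B : adm k a -> 1 < s -> s <= s' ->
  (forall r, s <= r <= s' -> Cmod (Dser (lnk 1 a) r) <= B) ->
  Cmod (Dser a s' - Dser a s) <= B * (s' - s).
Proof.
move=> ad s1 ss HB.
rewrite (_ : B * (s' - s) = B * s' - B * s); last by ring.
apply: (@Cmod_mean_value (Dser a) (fun s => - Dser (lnk 1 a) s)%C (fun s => B * s) (fun _ => B)) => //.
- by move=> t Ht; apply: (Dser_derive ad _).1; lra.
- by move=> t Ht; apply: (Dser_derive ad _).2; lra.
- by move=> t Ht; auto_derive => //; ring.
- by move=> t Ht; rewrite Cmod_opp; apply: HB.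
Qed.

(** * Zero-mean coefficients and the zeta function near the line of abscissa 1 *)

Arguments INR n : simpl never.

(** The shift by 3, which is at least e, makes [ell] at least 1, so that its powers increase with
    the exponent. *)
Definition ell (t : R) : R := ln (Rabs t + 3).

Lemma ell_ge1 t : 1 <= ell t.
Proof.
rewrite /ell -[X in X <= _](ln_exp 1); apply: ln_le; first exact: exp_pos.
have := exp_le_3; have := Rabs_pos t; lra.
Qed.

(** What partial summation uses of a nonprincipal character; multiplicativity is kept apart, in
    [cmult]. *)
Record zero_mean (M : nat) (psi : nat -> C) : Prop := ZeroMean {
  zm_pos : (0 < M)%N;
  zm_per : forall n, psi (n + M)%N = psi n;
  zm_sum : \Csum_(0 <= i < M) psi i = RtoC 0;
  zm_le1 : forall n, Cmod (psi n) <= 1 }.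

Lemma zm_window M psi m : zero_mean M psi -> \Csum_(m <= i < m + M) psi i = RtoC 0.
Proof.
move=> [M0 per s0 _]; elim: m => [|m IH]; first by rewrite add0n.
have E1 : \Csum_(m <= i < (m + M).+1) psi i = (\Csum_(m <= i < m + M) psi i + psi (m + M)%N)%C.
  by rewrite big_nat_recr //=; lia.
have E2 : \Csum_(m <= i < (m + M).+1) psi i = (psi m + \Csum_(m.+1 <= i < m.+1 + M) psi i)%C.
  by rewrite addSn (@Csum_split m m.+1) ?big_nat1 //; lia.
have : (psi m + \Csum_(m.+1 <= i < m.+1 + M) psi i = psi m)%C.
  by rewrite -E2 E1 IH per; ring.
move=> E; rewrite (_ : \Csum_(m.+1 <= i < m.+1 + M) psi i = (psi m + \Csum_(m.+1 <= i < m.+1 + M) psi i) - psi m)%C; last by ring.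
by rewrite E; ring.
Qed.

(** Whole periods cancel, and fewer than M terms of modulus at most 1 remain. *)
Lemma zm_partial M psi m n : zero_mean M psi ->
  Cmod (\Csum_(m <= i < n) psi i) <= INR M.
Proof.
move=> zm; have [d] := ubnP (n - m); elim: d m => // d IH m nm.
have [Mn|nM] := leqP (m + M) n.
  rewrite (@Csum_split m (m + M) n) //; last lia.
  rewrite zm_window // Cplus_0_l; apply: IH; have := zm_pos zm; lia.
apply: Rle_trans (Cmod_sum_le _ _ _) _.
have [mn|nm'] := leqP m n; last first.
  by rewrite big_geq; [exact: pos_INR | lia].
apply: Rle_trans (_ : _ <= \Rsum_(m <= i < n) 1) _.
  by apply: Rsum_le => i _; apply: zm_le1 zm i.
by rewrite Rsum_const_nat // Rmult_1_r; apply: le_INR; lia.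
Qed.

(** Partial summation. Since [phi] dominates both the values of [f] and its increments, the total
    variation telescopes and only [phi N] survives. *)
Lemma abel_bound (psi f : nat -> C) (phi : nat -> R) B N N' : (N <= N')%N ->
  (forall n, (N <= n)%N -> Cmod (\Csum_(N <= i < n) psi i) <= B) ->
  (forall n, (N <= n)%N -> Cmod (f n) <= phi n) ->
  (forall n, (N <= n)%N -> Cmod (f n - f n.+1) <= phi n - phi n.+1) ->
  Cmod (\Csum_(N <= n < N') (psi n * f n)) <= B * phi N.
Proof.
move=> NN HB Hf Hd.
have B0 : 0 <= B by apply: Rle_trans (HB N (leqnn N)); exact: Cmod_ge_0.
have key : Cmod (\Csum_(N <= n < N') (psi n * f n) - (\Csum_(N <= i < N') psi i) * f N')
    <= B * (phi N - phi N').
  elim: N' NN => [|n IH].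
    rewrite leqn0 => /eqP ->; rewrite !big_geq //.
    by rewrite (_ : (_ - _)%C = RtoC 0) ?Cmod_0; [lra | ring].
  rewrite leq_eqVlt => /orP[/eqP <-|].
    rewrite !big_geq //.
    by rewrite (_ : (_ - _)%C = RtoC 0) ?Cmod_0; [lra | ring].
  rewrite ltnS => Nn; have {}IH := IH Nn.
  have E : (\Csum_(N <= i < n.+1) (psi i * f i) - (\Csum_(N <= i < n.+1) psi i) * f n.+1 =
     (\Csum_(N <= i < n) (psi i * f i) - (\Csum_(N <= i < n) psi i) * f n) +
     (\Csum_(N <= i < n.+1) psi i) * (f n - f n.+1))%C.
    by rewrite !big_nat_recr //=; ring.
  rewrite E; apply: Rle_trans (Cmod_triangle _ _) _; rewrite Cmod_mult.
  have : Cmod (\Csum_(N <= i < n.+1) psi i) * Cmod (f n - f n.+1) <= B * (phi n - phi n.+1).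
    by apply: Rmult_le_compat; try exact: Cmod_ge_0; [apply: HB; lia | apply: Hd].
  lra.
have -> : \Csum_(N <= n < N') (psi n * f n) =
   ((\Csum_(N <= n < N') (psi n * f n) - (\Csum_(N <= i < N') psi i) * f N') +
   (\Csum_(N <= i < N') psi i) * f N')%C by ring.
apply: Rle_trans (Cmod_triangle _ _) _; rewrite Cmod_mult.
have : Cmod (\Csum_(N <= i < N') psi i) * Cmod (f N') <= B * phi N'.
  by apply: Rmult_le_compat; try exact: Cmod_ge_0; [apply: HB | apply: Hf].
lra.
Qed.

Lemma Cmod_unit_cs x : Cmod (cos x, - sin x) = 1.
Proof.
rewrite /Cmod /= -[RHS]sqrt_1; congr sqrt; have := sin2_cos2 x; rewrite /Rsqr; lra.
Qed.

Lemma Cmod_unit_sc x : Cmod (sin x, cos x) = 1.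
Proof.
rewrite /Cmod /= -[RHS]sqrt_1; congr sqrt; have := sin2_cos2 x; rewrite /Rsqr; lra.
Qed.

(** At v = log n, [F] is the weight (log n)^k n^{-s-it}. Half of the exponent absorbs v^k and leaves
    e^{-v/2}. The three summands of INR k + 2 + Rabs t come from differentiating the power, the
    exponential (s <= 2) and the oscillation; the factor 2 in [phi] undoes the 1/2 that
    differentiation brings down. *)
Section PowExpOsc.
Variables (k : nat) (s t : R).
Hypothesis s12 : 1 <= s <= 2.
Let F (v : R) : C := (v ^ k * exp (- s * v) * cos (t * v), - (v ^ k * exp (- s * v) * sin (t * v))).
Let K : R := (2 * INR k.+1) ^ k.
Let phi (v : R) : R := 2 * K * (INR k + 2 + Rabs t) * exp (- (v / 2)).

Lemma osc_K_ge1 : 1 <= K.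
Proof. by apply: pow_R1_Rle; have := @INR_ge1 k.+1 isT; lra. Qed.

Lemma osc_pow v : 0 <= v -> v ^ k * exp (- s * v) <= K * exp (- (v / 2)).
Proof.
move=> v0; have := @pow_le_exp k (1/2) v; rewrite (_ : INR k.+1 / (1/2) = 2 * INR k.+1); last by field.
move=> /(_ ltac:(lra) v0) H.
apply: Rle_trans (_ : _ <= K * exp (1 / 2 * v) * exp (- s * v)) _.
  by apply: Rmult_le_compat_r => //; left; exact: exp_pos.
rewrite Rmult_assoc -exp_plus; apply: Rmult_le_compat_l; first by have := osc_K_ge1; lra.
have : 1 / 2 * v + - s * v <= - (v / 2) by nra.
exact: exp_le_mono.
Qed.

Lemma osc_pow_pred v : 0 <= v ->
  INR k * v ^ (Nat.pred k) * exp (- s * v) <= INR k * (K * exp (- (v / 2))).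
Proof.
case: k @K F phi osc_pow => [|j] K' _ _ _ v0; first by rewrite INR_0 !Rmult_0_l; lra.
rewrite Rmult_assoc; apply: Rmult_le_compat_l; first exact: (pos_INR j.+1).
rewrite [Nat.pred _]/=.
have := @pow_le_exp j (1/2) v; rewrite (_ : INR j.+1 / (1/2) = 2 * INR j.+1); last by field.
move=> /(_ ltac:(lra) v0) H.
have jj : (2 * INR j.+1) ^ j <= K'.
  rewrite /K'; apply: Rle_trans (_ : _ <= (2 * INR j.+2) ^ j) _.
    apply: pow_incr; have := pos_INR j.+1; rewrite [INR j.+2]S_INR; lra.
  rewrite [X in _ <= X]/=; have : 0 <= (2 * INR j.+2) ^ j.
    by apply: pow_le; have := pos_INR j.+2; lra.
  by have := @INR_ge1 j.+2 isT; nra.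
apply: Rle_trans (_ : _ <= K' * exp (1 / 2 * v) * exp (- s * v)) _.
  apply: Rmult_le_compat_r; first by left; exact: exp_pos.
  apply: Rle_trans H _; apply: Rmult_le_compat_r => //; left; exact: exp_pos.
rewrite Rmult_assoc -exp_plus; apply: Rmult_le_compat_l.
  by apply: Rle_trans jj; apply: pow_le; have := pos_INR j.+1; lra.
have : 1 / 2 * v + - s * v <= - (v / 2) by nra.
exact: exp_le_mono.
Qed.

Lemma osc_le v : 0 <= v -> Cmod (F v) <= phi v.
Proof.
move=> v0; have -> : F v = (RtoC (v ^ k * exp (- s * v)) * (cos (t * v), - sin (t * v))%R)%C.
  by rewrite /F /Cmult /=; congr (_, _); ring.
rewrite Cmod_mult Cmod_unit_cs Rmult_1_r Cmod_R Rabs_pos_eq; last first.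
  by apply: Rmult_le_pos; [apply: pow_le | left; exact: exp_pos].
apply: Rle_trans (osc_pow v0) _; rewrite /phi.
apply: Rmult_le_compat_r; first by left; exact: exp_pos.
have := osc_K_ge1; have := pos_INR k; have := Rabs_pos t; nra.
Qed.

Lemma osc_diff u v : 0 <= u <= v -> Cmod (F u - F v) <= phi u - phi v.
Proof.
move=> uv; have -> : (F u - F v = - (F v - F u))%C by ring.
rewrite Cmod_opp (_ : phi u - phi v = - phi v - - phi u); last by ring.
pose A v := INR k * v ^ (Nat.pred k) * exp (- s * v) - s * (v ^ k * exp (- s * v)).
pose B v := - t * (v ^ k * exp (- s * v)).
apply: (@Cmod_mean_value F
  (fun v => RtoC (A v) * (cos (t * v), - sin (t * v))%R + RtoC (B v) * (sin (t * v), cos (t * v)))%C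
  (fun v => - phi v) (fun v => K * (INR k + 2 + Rabs t) * exp (- (v / 2)))).
- lra.
- move=> x Hx; rewrite /F /A /B /=; auto_derive => //.
  rewrite /=; ring.
- move=> x Hx; rewrite /F /A /B /=; auto_derive => //.
  rewrite /=; ring.
- move=> x Hx; rewrite /phi; auto_derive => //; rewrite /Rdiv; lra.
- move=> x Hx; apply: Rle_trans (Cmod_triangle _ _) _.
  rewrite !Cmod_mult Cmod_unit_cs Cmod_unit_sc !Rmult_1_r !Cmod_R.
  have x0 : 0 <= x by lra.
  have H1 := osc_pow x0; have H2 := osc_pow_pred x0.
  have P1 : 0 <= x ^ k * exp (- s * x).
    by apply: Rmult_le_pos; [apply: pow_le | left; exact: exp_pos].
  have P2 : 0 <= INR k * x ^ (Nat.pred k) * exp (- s * x).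
    apply: Rmult_le_pos; last by left; exact: exp_pos.
    by apply: Rmult_le_pos; [exact: pos_INR | apply: pow_le].
  have HA : Rabs (A x) <= INR k * (K * exp (- (x / 2))) + 2 * (K * exp (- (x / 2))).
    rewrite /A; apply: Rle_trans (Rabs_triang _ _) _; rewrite Rabs_Ropp.
    rewrite Rabs_pos_eq // Rabs_pos_eq; last by nra.
    have : s * (x ^ k * exp (- s * x)) <= 2 * (K * exp (- (x / 2))).
      by apply: Rmult_le_compat; lra.
    lra.
  have HB : Rabs (B x) <= Rabs t * (K * exp (- (x / 2))).
    rewrite /B Rabs_mult Rabs_Ropp; apply: Rmult_le_compat_l; first exact: Rabs_pos.
    by rewrite Rabs_pos_eq.
  lra.
Qed.

Lemma osc_lterm n : F (lnN n) = (RtoC (lnN n ^ k) * RtoC (wt s n) * zit t n)%C.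
Proof. by rewrite /F /wt /zit /Cmult /=; congr (_, _); ring. Qed.

End PowExpOsc.

(** The imaginary part of the complex variable is carried by the coefficients, so that series are
    differentiated in the real variable s only and no complex analysis enters. *)
Definition tw (psi : nat -> C) (t : R) (n : nat) : C := (psi n * zit t n)%C.

(** The constant does not depend on s, down to and including s = 1. The factor Rabs t + 1 is repaid
    by N^{-1/2} once N exceeds t^2. *)
Lemma Ltail M psi k : zero_mean M psi -> exists C, 0 <= C /\
  forall s t N N', 1 <= s <= 2 -> (0 < N)%N ->
  Cmod (\Csum_(N <= n < N') wterm (lnk k (tw psi t)) s n) <= C * (Rabs t + 1) * wt (1/2) N.
Proof.
move=> zm; pose K := (2 * INR k.+1) ^ k.
have K1 := osc_K_ge1 k; rewrite -/K in K1.
have k0 := pos_INR k; have M0 := pos_INR M.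
exists (INR M * (2 * K * (INR k + 2))); split.
  by apply: Rmult_le_pos => //; nra.
move=> s t N N' s12 N0.
have t0 := Rabs_pos t.
have [NN|NN] := leqP N N'; last first.
  rewrite big_geq ?Cmod_0; last lia.
  apply: Rmult_le_pos; last by left; exact: wt_pos.
  by apply: Rmult_le_pos; last lra; apply: Rmult_le_pos => //; nra.
pose F v : C := (v ^ k * exp (- s * v) * cos (t * v), - (v ^ k * exp (- s * v) * sin (t * v))).
pose phi v := 2 * K * (INR k + 2 + Rabs t) * exp (- (v / 2)).
have -> : \Csum_(N <= n < N') wterm (lnk k (tw psi t)) s n = \Csum_(N <= n < N') (psi n * F (lnN n)).
  by apply: eq_bigr => n _; rewrite /F osc_lterm /wterm /lnk /tw; ring.
apply: Rle_trans (_ : _ <= INR M * phi (lnN N)) _.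
  apply: (@abel_bound psi (fun n => F (lnN n)) (fun n => phi (lnN n))) => // n Nn.
  - exact: zm_partial.
  - by apply: osc_le => //; exact: lnN_ge0.
  - apply: osc_diff => //; split; first exact: lnN_ge0.
    by apply: lnN_le; lia.
have -> : phi (lnN N) = 2 * K * (INR k + 2 + Rabs t) * wt (1 / 2) N.
  by rewrite /phi /wt; congr Rmult; congr exp; field.
rewrite -Rmult_assoc; apply: Rmult_le_compat_r; first by left; exact: wt_pos.
rewrite [X in _ <= X]Rmult_assoc; apply: Rmult_le_compat_l => //.
rewrite [X in _ <= X]Rmult_assoc; apply: Rmult_le_compat_l; first lra.
nra.
Qed.

Lemma harmonic_le N : (0 < N)%N -> \Rsum_(1 <= n < N.+1) / INR n <= 1 + lnN N.
Proof.
elim: N => // N IH _; rewrite big_nat_recr //=.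
case: N IH => [|N] IH; first by rewrite big_geq // lnN1 INR_1; lra.
have := IH isT; have := @lnN_succ_diff N.+1 isT; lra.
Qed.

(** An integer just above (|t|+3)^2: large enough that N^{-1/2} absorbs |t|+3, small enough that log
    N is O([ell t]). Rounding up stays below the cube, whence the 3. *)
Lemma cutoff t : exists N, [/\ (0 < N)%N, (Rabs t + 3) ^ 2 <= INR N & lnN N <= 3 * ell t].
Proof.
have t0 := Rabs_pos t; set x := (Rabs t + 3) ^ 2.
have x9 : 9 <= x by rewrite /x /=; nra.
have [H1 H2] := archimed x.
exists (Z.to_nat (up x)).
have up0 : (0 < up x)%Z by apply: lt_IZR; lra.
have E : INR (Z.to_nat (up x)) = IZR (up x) by rewrite INR_IZR_INZ Z2Nat.id //; lia.
split; [lia | by rewrite E; lra |].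
rewrite /lnN E; apply: Rle_trans (_ : _ <= ln ((Rabs t + 3) ^ 3)) _.
  apply: ln_le; first lra.
  have : x * 3 <= x * (Rabs t + 3) by apply: Rmult_le_compat_l; lra.
  rewrite (_ : x * (Rabs t + 3) = (Rabs t + 3) ^ 3); last by rewrite /x; ring.
  lra.
by rewrite ln_pow; [rewrite /ell INR_IZR_INZ /=; lra | lra].
Qed.

Lemma wt_half_cutoff t N : (0 < N)%N -> (Rabs t + 3) ^ 2 <= INR N ->
  (Rabs t + 3) * wt (1/2) N <= 1.
Proof.
move=> N0 H; have t0 := Rabs_pos t.
rewrite -{1}(exp_ln (Rabs t + 3)); last lra.
rewrite /wt -exp_plus -[X in _ <= X]exp_0.
have : 2 * ln (Rabs t + 3) <= lnN N.
  rewrite /lnN -[2]/(INR 2) -ln_pow; last lra.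
  by apply: ln_le => //; apply: pow_lt; lra.
move=> L; have : ln (Rabs t + 3) + - (1 / 2) * lnN N <= 0 by lra.
exact: exp_le_mono.
Qed.

Lemma ell_pow_le i j t : (i <= j)%N -> ell t ^ i <= ell t ^ j.
Proof. by move=> ij; apply: Rle_pow; [exact: ell_ge1 | lia]. Qed.

Lemma Cmod_tw psi t n : Cmod (tw psi t n) = Cmod (psi n).
Proof. by rewrite Cmod_mult Cmod_zit Rmult_1_r. Qed.

Lemma adm_tw psi t : (forall n, Cmod (psi n) <= 1) -> adm 0 (tw psi t).
Proof. by move=> H n n0; rewrite Cmod_tw. Qed.

(** Trivial estimate at s = 1: each logarithm is at most log N <= 3 [ell t], and the harmonic sum is
    at most 1 + 3 [ell t] <= 4 [ell t]. *)
Lemma head_bound (b : nat -> C) k s t N : (forall n, Cmod (b n) <= 1) -> 1 <= s ->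
  (0 < N)%N -> lnN N <= 3 * ell t ->
  Cmod (\Csum_(1 <= n < N.+1) wterm (lnk k b) s n) <= 4 * 3 ^ k * ell t ^ k.+1.
Proof.
move=> b1 s1 N0 Nt; have e1 := ell_ge1 t; have l0 := lnN_ge0 N.
apply: Rle_trans (Cmod_sum_le _ _ _) _.
apply: Rle_trans (_ : _ <= \Rsum_(1 <= n < N.+1) ((3 * ell t) ^ k * / INR n)) _.
  apply: Rsum_le_nat => n /andP[n0 nN]; rewrite Cmod_wterm.
  apply: Rmult_le_compat; try exact: Cmod_ge_0; first by left; exact: wt_pos.
    rewrite Cmod_mult Cmod_R; apply: Rle_trans (_ : _ <= 1 * (3 * ell t) ^ k) _; last lra.
    apply: Rmult_le_compat; [exact: Cmod_ge_0 | exact: Rabs_pos | exact: b1 |].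
    rewrite Rabs_pos_eq; last by apply: pow_le; exact: lnN_ge0.
    apply: pow_incr; split; first exact: lnN_ge0.
    by apply: Rle_trans Nt; apply: lnN_le; lia.
  by rewrite -wt1E //; apply: wt_le.
rewrite -big_distrr /= Rpow_mult_distr.
have h := harmonic_le N0.
rewrite (_ : 4 * 3 ^ k * (ell t * ell t ^ k) = 3 ^ k * ell t ^ k * (4 * ell t)); last by ring.
apply: Rmult_le_compat_l; last lra.
by apply: Rmult_le_pos; apply: pow_le; lra.
Qed.

(** Split at the N of [cutoff]: the head costs powers of [ell t] only, and the tail is bounded by a
    constant. *)
Lemma L_bound M psi k : zero_mean M psi -> exists C, 0 <= C /\
  forall s t, 1 < s <= 2 -> Cmod (Dser (lnk k (tw psi t)) s) <= C * ell t ^ k.+1.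
Proof.
move=> zm; have [C [C0 HC]] := Ltail k zm.
exists (4 * 3 ^ k + C); split.
  have : 0 <= 3 ^ k by apply: pow_le; lra.
  lra.
move=> s t s12; have [N0 [N0p N0x N0l]] := cutoff t.
have ad := adm_tw t (zm_le1 zm).
apply: (csum_bound (N0 := N0) (Dser_csum (adm_lnk k ad) _)); first lra.
move=> N NN; rewrite /Psum (@Csum_split 1 N0.+1 N.+1) //.
apply: Rle_trans (Cmod_triangle _ _) _.
rewrite Rmult_plus_distr_r; apply: Rplus_le_compat.
  apply: head_bound => //; last lra.
  by move=> n; rewrite Cmod_tw; apply: zm_le1 zm n.
apply: Rle_trans (HC s t N0.+1 N.+1 _ _) _ => //; first lra.
rewrite Rmult_assoc; apply: Rmult_le_compat_l => //.
have t0 := Rabs_pos t.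
apply: Rle_trans (_ : _ <= 1) _; last by apply: pow_R1_Rle; exact: ell_ge1.
have := @wt_half_cutoff t N0.+1 isT; rewrite [INR N0.+1]S_INR => /(_ ltac:(lra)).
have := wt_pos (1/2) N0.+1; nra.
Qed.

(* n^{-s-it} is a difference of values of u^{1-s-it}/(s-1+it) up to an absolutely summable error. *)
Section Zeta.
Variables (s t : R).
Hypothesis s12 : 1 < s <= 2.
Hypothesis t0 : t <> 0.
Let g (u : R) : C := (exp (- s * ln u) * cos (t * ln u), - (exp (- s * ln u) * sin (t * ln u))).
Let D := (s - 1) ^ 2 + t ^ 2.
Let E (u : R) : C :=
  (u * exp (- s * ln u) * ((s - 1) * cos (t * ln u) - t * sin (t * ln u)) / D,
   - (u * exp (- s * ln u) * (t * cos (t * ln u) + (s - 1) * sin (t * ln u)) / D)).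

Lemma zeta_D_pos : 0 < D.
Proof. by rewrite /D; have : 0 < t ^ 2; [apply: pow2_gt_0 | nra]. Qed.

Lemma zeta_wt n u : (0 < n)%N -> INR n <= u -> exp (- s * ln u) * / u <= wt 2 n.
Proof.
move=> n0 nu; have n1 := INR_ge1 n0.
have -> : / u = exp (- ln u) by rewrite exp_Ropp exp_ln //; lra.
rewrite -exp_plus /wt.
have L : lnN n <= ln u by apply: ln_le; lra.
have L0 := lnN_ge0 n.
have : - s * ln u + - ln u <= - (2) * lnN n by nra.
exact: exp_le_mono.
Qed.

Lemma zeta_g_diff n u : (0 < n)%N -> INR n <= u <= INR n + 1 ->
  Cmod (g u - g (INR n)) <= (2 + Rabs t) * wt 2 n.
Proof.
move=> n0 nu; have n1 := INR_ge1 n0.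
set c := (2 + Rabs t) * wt 2 n.
have c0 : 0 <= c by apply: Rmult_le_pos; [have := Rabs_pos t; lra | left; exact: wt_pos].
apply: Rle_trans (_ : _ <= c * u - c * INR n) _; last nra.
pose A u := - s * (exp (- s * ln u) * / u); pose B u := - t * (exp (- s * ln u) * / u).
apply: (@Cmod_mean_value g
  (fun u => RtoC (A u) * (cos (t * ln u), - sin (t * ln u))%R + RtoC (B u) * (sin (t * ln u), cos (t * ln u)))%C
  (fun u => c * u) (fun _ => c)) => [|x Hx|x Hx|x Hx|x Hx].
- lra.
- rewrite /g /A /B /=; auto_derive; [lra | field; lra].
- rewrite /g /A /B /=; auto_derive; [lra | field; lra].
- by auto_derive => //; ring.
- apply: Rle_trans (Cmod_triangle _ _) _.
  rewrite !Cmod_mult Cmod_unit_cs Cmod_unit_sc !Rmult_1_r !Cmod_R /A /B !Rabs_mult !Rabs_Ropp.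
  have w := @zeta_wt n x n0 ltac:(lra).
  have w0 : 0 <= exp (- s * ln x) * / x.
    by apply: Rmult_le_pos; left; [exact: exp_pos | apply: Rinv_0_lt_compat; lra].
  rewrite -Rabs_mult (Rabs_pos_eq _ w0) (Rabs_pos_eq s); last lra.
  rewrite /c; have := Rabs_pos t; nra.
Qed.

Lemma zeta_E_diff n : (0 < n)%N ->
  Cmod (E (INR n.+1) - E (INR n) + g (INR n)) <= (2 + Rabs t) * wt 2 n.
Proof.
move=> n0; have n1 := INR_ge1 n0; have D0 := zeta_D_pos.
set c := (2 + Rabs t) * wt 2 n.
rewrite S_INR.
(* Adding the linear function u g(n) turns the left side into a single increment, of a function
   whose derivative is g(n) - g(u). *)
have -> : (E (INR n + 1) - E (INR n) + g (INR n) =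
  (E (INR n + 1) + RtoC (INR n + 1) * g (INR n)) - (E (INR n) + RtoC (INR n) * g (INR n)))%C.
  by rewrite RtoC_plus; ring.
apply: Rle_trans (_ : _ <= c * (INR n + 1) - c * INR n) _; last lra.
apply: (@Cmod_mean_value (fun u => E u + RtoC u * g (INR n))%C (fun u => - (g u - g (INR n)))%C
  (fun u => c * u) (fun _ => c)) => [|x Hx|x Hx|x Hx|x Hx].
- lra.
- rewrite /g /E /=; auto_derive; first lra.
  rewrite /D in D0 *; field; split; nra.
- rewrite /g /E /=; auto_derive; first lra.
  rewrite /D in D0 *; field; split; nra.
- by auto_derive => //; ring.
- by rewrite Cmod_opp; apply: zeta_g_diff.
Qed.

Lemma zeta_E_le n : (0 < n)%N -> Cmod (E (INR n)) <= 2 / Rabs t.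
Proof.
move=> n0; have n1 := INR_ge1 n0; have D0 := zeta_D_pos.
have tp : 0 < Rabs t by apply: Rabs_pos_lt.
have -> : E (INR n) = (RtoC (INR n * exp (- s * ln (INR n)) * / D) *
   (RtoC (s - 1) * (cos (t * ln (INR n)), - sin (t * ln (INR n)))%R +
    RtoC (- t) * (sin (t * ln (INR n)), cos (t * ln (INR n)))))%C.
  by rewrite /E /Cmult /Cplus /=; congr (_, _); field; lra.
rewrite Cmod_mult.
apply: Rle_trans (_ : _ <= Rabs (INR n * exp (- s * ln (INR n)) * / D) * (Rabs (s - 1) + Rabs t)) _.
  rewrite Cmod_R; apply: Rmult_le_compat_l; first exact: Rabs_pos.
  apply: Rle_trans (Cmod_triangle _ _) _.
  by rewrite !Cmod_mult Cmod_unit_cs Cmod_unit_sc !Cmod_R Rabs_Ropp; lra.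
have -> : INR n * exp (- s * ln (INR n)) = wt (s - 1) n.
  rewrite -{1}(exp_lnN n0) -exp_plus /wt /lnN; congr exp; ring.
have w1 : wt (s - 1) n <= 1.
  by apply: Rle_trans (@wt_le 0 (s - 1) n _) _; [lra | rewrite /wt Ropp_0 Rmult_0_l exp_0; lra].
have w0 := wt_pos (s - 1) n.
have Dp : 0 < / D by apply: Rinv_0_lt_compat.
rewrite Rabs_pos_eq; last by nra.
rewrite (Rabs_pos_eq (s - 1)); last lra.
apply: Rle_trans (_ : _ <= 1 * / D * (s - 1 + Rabs t)) _.
  apply: Rmult_le_compat_r; first lra.
  by apply: Rmult_le_compat_r; lra.
apply: (Rmult_le_reg_r (D * Rabs t)); first by apply: Rmult_lt_0_compat.
have -> : 1 * / D * (s - 1 + Rabs t) * (D * Rabs t) = (s - 1 + Rabs t) * Rabs t by field; lra.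
have -> : 2 / Rabs t * (D * Rabs t) = 2 * D by field; lra.
have : t ^ 2 = Rabs t * Rabs t by rewrite -Rabs_mult Rabs_pos_eq; [ring | nra].
rewrite /D => ->; have := Rle_0_sqr (s - 1 - Rabs t); rewrite /Rsqr; nra.
Qed.

Lemma zeta_partial N N' : (0 < N)%N -> (N <= N')%N ->
  Cmod (\Csum_(N.+1 <= n < N'.+1) wterm (zit t) s n) <=
  4 / Rabs t + (2 + Rabs t) / INR N.
Proof.
move=> N0 NN; have n1 := INR_ge1 N0.
have -> : \Csum_(N.+1 <= n < N'.+1) wterm (zit t) s n =
  ((E (INR N.+1) - E (INR N'.+1)) +
   \Csum_(N.+1 <= n < N'.+1) (E (INR n.+1) - E (INR n) + g (INR n)))%C.
  rewrite -(@Csum_telescope N.+1 N'.+1 (fun n => E (INR n))) // -big_split /=.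
  apply: eq_bigr => n _.
  have -> : wterm (zit t) s n = g (INR n).
    by rewrite /wterm /g /wt /zit /Cmult /= /lnN; congr (_, _); ring.
  ring.
apply: Rle_trans (Cmod_triangle _ _) _; apply: Rplus_le_compat.
  apply: Rle_trans (Cmod_triangle _ _) _; rewrite Cmod_opp.
  have := @zeta_E_le N.+1 isT; have := @zeta_E_le N'.+1 isT; rewrite /Rdiv; lra.
apply: Rle_trans (Cmod_sum_le _ _ _) _.
apply: Rle_trans (_ : _ <= \Rsum_(N.+1 <= n < N'.+1) ((2 + Rabs t) * wt 2 n)) _.
  by apply: Rsum_le_nat => n Hn; apply: zeta_E_diff; lia.
rewrite -big_distrr /=; apply: Rmult_le_compat_l; first by have := Rabs_pos t; lra.
have := @wt_tail_sum 2 N N' ltac:(lra) N0.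
rewrite (_ : 2 - 1 = 1); last by ring.
by rewrite wt1E // Rdiv_1_r.
Qed.

(** The term 4 / Rabs t is the trace of the pole at 1; the lemma is applied only where t stays away
    from 0. *)
Lemma zeta_bound : Cmod (Dser (zit t) s) <= 5 * ell t + 4 / Rabs t.
Proof.
have [N0 [N0p N0x N0l]] := cutoff t.
have ad : adm 0 (zit t) by move=> n _; rewrite Cmod_zit /=; lra.
apply: (csum_bound (N0 := N0) (Dser_csum ad _)); first lra.
move=> N NN; rewrite /Psum (@Csum_split 1 N0.+1 N.+1) //.
apply: Rle_trans (Cmod_triangle _ _) _.
have e1 := ell_ge1 t.
have H1 : Cmod (\Csum_(1 <= i < N0.+1) wterm (zit t) s i) <= 4 * ell t.
  have := @head_bound (zit t) 0 s t N0.
  rewrite /= !Rmult_1_r => H.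
  rewrite (@eq_bigr _ _ _ _ _ _ _ (wterm (lnk 0 (zit t)) s)); last first.
    by move=> i _; rewrite /wterm lnk0.
  by apply: H => //; [move=> n; rewrite Cmod_zit; lra | lra].
have H2 := zeta_partial N0p NN.
have H3 : (2 + Rabs t) / INR N0 <= 1.
  have := Rabs_pos t => tt; have n1 := INR_ge1 N0p.
  apply: (Rmult_le_reg_r (INR N0)); first lra.
  rewrite /Rdiv Rmult_assoc Rinv_l; nra.
lra.
Qed.
End Zeta.

(** * The von Mangoldt function and the 3-4-1 inequality *)

(** A test for prime powers that also delivers the base: it is [pdiv d], whose logarithm [vonM]
    takes. *)
Definition ppow (d : nat) : bool := (1 < d)%N && (d == pdiv d ^ logn (pdiv d) d)%N.
Definition vonM (d : nat) : R := if ppow d then lnN (pdiv d) else 0.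

Lemma ppow_pfactor p j : prime p -> (0 < j)%N -> ppow (p ^ j).
Proof.
move=> pp j0; case: j j0 => // j _.
rewrite /ppow pdiv_pfactor // pfactorK // eqxx andbT.
by rewrite -{1}(exp1n j.+1) ltn_exp2r // prime_gt1.
Qed.

Lemma vonM_pfactor p j : prime p -> (0 < j)%N -> vonM (p ^ j) = lnN p.
Proof. by case: j => // j pp j0; rewrite /vonM ppow_pfactor // pdiv_pfactor. Qed.

Lemma ppowP d : ppow d -> exists p j, [/\ prime p, (0 < j)%N & d = (p ^ j)%N].
Proof.
move=> /andP[d1 /eqP E]; have pp := pdiv_prime d1.
exists (pdiv d), (logn (pdiv d) d); split => //.
by rewrite logn_gt0 mem_primes pp pdiv_dvd (ltnW d1).
Qed.

Lemma vonM_ge0 n : 0 <= vonM n.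
Proof. by rewrite /vonM; case: ifP => _; [exact: lnN_ge0 | lra]. Qed.

Lemma vonM_le n : vonM n <= lnN n.
Proof.
rewrite /vonM; case: ifP => [/andP[n1 _]|_]; last exact: lnN_ge0.
by apply: lnN_le; [exact: pdiv_gt0 | apply: pdiv_leq; lia].
Qed.

(** Reduces sums over divisors weighted by [vonM] to double sums over primes and exponents. The pair
    (p, j) can be read off from p^j, so no divisor is listed twice. *)
Lemma ppow_divisors n : (0 < n)%N ->
  perm_eq [seq d <- index_iota 1 n.+1 | (d %| n)%N && ppow d]
    [seq (p ^ j)%N | p <- primes n, j <- index_iota 1 (logn p n).+1].
Proof.
move=> n0; apply: uniq_perm.
- by apply: filter_uniq; exact: iota_uniq.
- apply: allpairs_uniq_dep.
  + exact: primes_uniq.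
  + by move=> p _; exact: iota_uniq.
  + move=> _ _ /allpairsPdep [p [i [Hp Hi ->]]] /allpairsPdep [p' [j [Hp' Hj ->]]] /= E.
    move: Hp Hp' Hi Hj; rewrite !mem_primes !mem_index_iota => /and3P[pp _ _] /and3P[pp' _ _] /andP[i0 _] /andP[j0 _].
    have pE : p = p'.
      by have := pdiv_pfactor i.-1 pp; have := pdiv_pfactor j.-1 pp'; rewrite !prednK // E => -> ->.
    move: E; rewrite -pE => E.
    by have := pfactorK i pp; rewrite E pfactorK // => ->.
move=> d; rewrite mem_filter mem_index_iota; apply/idP/idP.
  move=> /andP[/andP[dn /ppowP [p [j [pp j0 E]]]] _].
  apply/allpairsPdep; exists p, j; split => //.
    rewrite mem_primes pp n0 /=; apply: dvdn_trans dn; rewrite E.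
    by case: j j0 E => // j _ _; rewrite expnS dvdn_mulr.
  by rewrite mem_index_iota j0 ltnS -pfactor_dvdn // -E.
move=> /allpairsPdep [p [j [Hp Hj ->]]].
move: Hp Hj; rewrite mem_primes mem_index_iota => /and3P[pp _ pn] /andP[j0 jl].
have dv : (p ^ j %| n)%N by rewrite pfactor_dvdn.
by rewrite dv ppow_pfactor //= expn_gt0 prime_gt0 //= ltnS dvdn_leq.
Qed.

Lemma sum_vonM (F : nat -> R) n : (0 < n)%N ->
  \Rsum_(1 <= d < n.+1 | (d %| n)%N) (vonM d * F d) =
  \Rsum_(p <- primes n) \Rsum_(1 <= j < (logn p n).+1) (lnN p * F (p ^ j)%N).
Proof.
move=> n0.
transitivity (\Rsum_(d <- [seq d <- index_iota 1 n.+1 | (d %| n)%N && ppow d]) (vonM d * F d)).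
  rewrite big_filter big_mkcondr /=; apply: eq_bigr => d _.
  by rewrite /vonM; case: ifP => // _; ring.
rewrite (perm_big _ (ppow_divisors n0)) /= big_allpairs_dep /=.
rewrite big_seq [RHS]big_seq; apply: eq_bigr => p; rewrite mem_primes => /and3P[pp _ _].
by apply: eq_big_nat => j /andP[j0 _]; rewrite vonM_pfactor.
Qed.

Lemma lnN_exp p j : (0 < p)%N -> lnN (p ^ j) = INR j * lnN p.
Proof.
move=> p0; elim: j => [|j IH]; first by rewrite expn0 lnN1 INR_0; ring.
by rewrite expnS lnN_mul ?expn_gt0 ?p0 // IH S_INR; ring.
Qed.

Lemma lnN_primes n : (0 < n)%N ->
  lnN n = \Rsum_(p <- primes n) (INR (logn p n) * lnN p).
Proof.
move=> n0; rewrite {1}(prod_prime_decomp n0) prime_decompE big_map /=.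
have : all (fun p => 0 < p)%N (primes n).
  by apply/allP => p; rewrite mem_primes => /and3P[/prime_gt0].
move: (logn^~ n) => e; elim: (primes n) => [|p r IH]; first by rewrite !big_nil lnN1.
move=> /= /andP[p0 r0]; rewrite !big_cons -IH // lnN_mul ?lnN_exp ?expn_gt0 ?p0 //.
elim: r r0 {IH} => [|x r IH]; first by rewrite big_nil.
by move=> /= /andP[x0 r0]; rewrite big_cons muln_gt0 expn_gt0 x0 IH.
Qed.

Lemma lnN_vonM n : (0 < n)%N -> \Rsum_(1 <= d < n.+1 | (d %| n)%N) vonM d = lnN n.
Proof.
move=> n0; rewrite lnN_primes //.
transitivity (\Rsum_(1 <= d < n.+1 | (d %| n)%N) (vonM d * 1)).
  by apply: eq_bigr => d _; ring.
rewrite (@sum_vonM (fun _ => 1)) //; apply: eq_bigr => p _.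
by rewrite Rsum_const_nat // subn1 /=; ring.
Qed.

(** Multiplicativity is required at positive arguments only: [zit t] is 1 at 0 and would violate it
    there. *)
Record cmult (a : nat -> C) : Prop := CMult {
  cmult_1 : a 1%N = RtoC 1;
  cmult_M : forall m n, (0 < m)%N -> (0 < n)%N -> a (m * n)%N = (a m * a n)%C;
  cmult_le1 : forall n, Cmod (a n) <= 1 }.

Definition Lam (a : nat -> C) (n : nat) : C := (a n * RtoC (vonM n))%C.

Lemma adm_cmult a : cmult a -> adm 0 a.
Proof. by move=> [_ _ H] n _; apply: H. Qed.

Lemma adm_Lam a : cmult a -> adm 1 (Lam a).
Proof.
move=> [_ _ H] n _; rewrite /Lam Cmod_mult Cmod_R Rabs_pos_eq; last exact: vonM_ge0.
rewrite pow_1; apply: Rle_trans (_ : _ <= 1 * lnN n) _; last lra.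
apply: Rmult_le_compat; [exact: Cmod_ge_0 | exact: vonM_ge0 | exact: H | exact: vonM_le].
Qed.

Lemma RtoC_sum (I : Type) (r : seq I) (P : pred I) (F : I -> R) :
  RtoC (\Rsum_(i <- r | P i) F i) = \Csum_(i <- r | P i) RtoC (F i).
Proof. by apply: (big_morph RtoC) => // x y; rewrite RtoC_plus. Qed.

Lemma cmult_conv_Lam a n : cmult a -> (0 < n)%N -> lnk 1 a n = conv (Lam a) a n.
Proof.
move=> [_ aM _] n0; rewrite /lnk pow_1 -lnN_vonM // RtoC_sum big_distrr /= /conv.
rewrite big_seq_cond [RHS]big_seq_cond; apply: eq_bigr => d /andP[].
rewrite mem_index_iota => /andP[d0 _] /dvdnP [e E].
rewrite {}E mulnK // in n0 *.
have e0 : (0 < e)%N by move: n0; rewrite muln_gt0 => /andP[].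
by rewrite aM // /Lam; ring.
Qed.

Lemma Dser_lnk1 a s : cmult a -> 1 < s ->
  Dser (lnk 1 a) s = (Dser (Lam a) s * Dser a s)%C.
Proof.
move=> ca s1; apply: (Dser_conv (adm_Lam ca) (adm_cmult ca) s1) => n n0.
exact: cmult_conv_Lam.
Qed.

(** Normalisation at infinity: the values tend to 1 as s grows, which anchors the monotonicity
    argument of [three_four_one]. *)
Lemma Dser_close1 a s : cmult a -> 1 < s -> Cmod (Dser a s - RtoC 1) <= 1 / (s - 1).
Proof.
move=> ca s1.
have H : is_csum (wterm a s) (Dser a s) := Dser_csum (adm_cmult ca) s1.
apply: le_epsilon => e e0; have [N0 HN] := H e e0.
have {HN} := HN (maxn N0 1) (leq_maxl _ _); set N := maxn N0 1 => HN.
have N1 : (1 <= N)%N by exact: leq_maxr.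
have T : Cmod (Psum (wterm a s) N - RtoC 1) <= 1 / (s - 1).
  rewrite /Psum (@Csum_split 1 2 N.+1) // big_nat1.
  rewrite {1}/wterm (cmult_1 ca) wt_1 (_ : (_ - _)%C = \Csum_(2 <= i < N.+1) wterm a s i); last by ring.
  apply: Rle_trans (Cmod_sum_le _ _ _) _.
  apply: Rle_trans (_ : _ <= \Rsum_(2 <= n < N.+1) wt s n) _.
    apply: Rsum_le => n _; rewrite Cmod_wterm.
    by have := cmult_le1 ca n; have := wt_pos s n; nra.
  by have := @wt_tail_sum s 1 N s1 isT; rewrite wt_1.
have -> : (Dser a s - RtoC 1 = (Psum (wterm a s) N - RtoC 1) - (Psum (wterm a s) N - Dser a s))%C by ring.
apply: Rle_trans (Cmod_triangle _ _) _; rewrite Cmod_opp; lra.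
Qed.

Definition nsq (z : C) : R := Re z * Re z + Im z * Im z.

Lemma nsq_ge0 z : 0 <= nsq z.
Proof. rewrite /nsq; nra. Qed.

(** The logarithmic derivative of |L|^2 without a division by L, so that possible zeros need no
    discussion. *)
Lemma nsq_derive a s : cmult a -> 1 < s ->
  is_derive (fun s => nsq (Dser a s)) s (- (2 * nsq (Dser a s) * Re (Dser (Lam a) s))).
Proof.
move=> ca s1; have [H1 H2] := Dser_derive (adm_cmult ca) s1.
rewrite /nsq; evar_last.
  apply: is_derive_plus; apply: is_derive_mult => //; try exact: H1; try exact: H2;
  by move=> x y; rewrite /mult /= Rmult_comm.
rewrite Dser_lnk1 // /plus /mult /=.
by case: (Dser a s) => x y; case: (Dser (Lam a) s) => u v /=; ring.
Qed.

Lemma nsq_near1 a s e : cmult a -> 0 < e <= 1 -> 1 + 1 / e <= s -> (1 - e) ^ 2 <= nsq (Dser a s).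
Proof.
move=> ca e0 se.
have e1 : 0 < 1 / e by apply: Rdiv_lt_0_compat; lra.
have H := @Dser_close1 a s ca ltac:(lra).
have He : 1 / (s - 1) <= e.
  apply: (Rmult_le_reg_r (s - 1)); first lra.
  rewrite /Rdiv Rmult_assoc Rinv_l; last lra.
  have : e * (1 / e) = 1 by field; lra.
  nra.
have H1 : 1 - e <= Cmod (Dser a s).
  have := Cmod_triangle (Dser a s) (- (Dser a s - RtoC 1)); rewrite Cmod_opp.
  rewrite (_ : (Dser a s + - (Dser a s - RtoC 1))%C = RtoC 1); last by ring.
  rewrite Cmod_1; lra.
by rewrite /nsq -Cmod_sqr /=; nra.
Qed.

Lemma cmult_one : cmult (fun _ => RtoC 1).
Proof. by split=> // [m n _ _|n]; [ring | rewrite Cmod_1; lra]. Qed.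

(** [q] is the square of the product |zeta|^3 |A|^4 |B|, and its derivative is -2 q l, where l is a
    series of nonnegative terms. So [q] decreases to its limit 1 at infinity and is at least 1
    everywhere; neither logarithms of L-functions nor Euler products are involved. *)
Lemma three_four_one a b s : cmult a -> cmult b ->
  (forall n, (0 < n)%N -> 0 <= 3 + 4 * Re (a n) + Re (b n)) -> 1 < s ->
  1 <= (1 + 1 / (s - 1)) ^ 3 * Cmod (Dser a s) ^ 4 * Cmod (Dser b s).
Proof.
move=> ca cb H s1; pose one (n : nat) := RtoC 1.
have c1 : cmult one := cmult_one.
pose q s := (nsq (Dser one s)) ^ 3 * (nsq (Dser a s)) ^ 4 * nsq (Dser b s).
pose l s := 3 * Re (Dser (Lam one) s) + 4 * Re (Dser (Lam a) s) + Re (Dser (Lam b) s).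
have l0 r : 1 < r -> 0 <= l r.
  move=> r1; pose f n := (RtoC 3 * Lam one n + (RtoC 4 * Lam a n + Lam b n))%C.
  have Hf : is_csum (wterm f r) (RtoC 3 * Dser (Lam one) r + (RtoC 4 * Dser (Lam a) r + Dser (Lam b) r))%C.
    have h1 := csum_scal (RtoC 3) (Dser_csum (adm_Lam c1) r1).
    have h2 := csum_scal (RtoC 4) (Dser_csum (adm_Lam ca) r1).
    apply: csum_ext (csum_plus h1 (csum_plus h2 (Dser_csum (adm_Lam cb) r1))) => n _.
    by rewrite /wterm /f; ring.
  have [HR _] := csum_lim Hf.
  have E : l r = Re (RtoC 3 * Dser (Lam one) r + (RtoC 4 * Dser (Lam a) r + Dser (Lam b) r))%C.
    by rewrite /l /=; ring.
  rewrite E.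
  have := is_lim_seq_le (fun _ => 0) _ (Finite 0) _ _ (is_lim_seq_const 0) HR.
  apply => N; rewrite /Psum Re_sum; apply: Rsum_ge0_nat => n /andP[n0 _].
  have -> : Re (wterm f r n) = (3 + 4 * Re (a n) + Re (b n)) * (vonM n * wt r n).
    by rewrite /wterm /f /Lam /one; case: (a n) => x y; case: (b n) => u v /=; ring.
  apply: Rmult_le_pos; first exact: H.
  by apply: Rmult_le_pos; [exact: vonM_ge0 | left; exact: wt_pos].
have qd r : 1 < r -> is_derive q r (- (2 * q r * l r)).
  move=> r1; rewrite /q.
  have d1 := nsq_derive c1 r1; have da := nsq_derive ca r1; have db := nsq_derive cb r1.
  evar_last.
    apply: is_derive_mult; last by move=> x y; rewrite /mult /= Rmult_comm.
      apply: is_derive_mult; last by move=> x y; rewrite /mult /= Rmult_comm.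
        apply: is_derive_pow d1.
      apply: is_derive_pow da.
    exact: db.
  rewrite /plus /mult /= /l !INR_IZR_INZ /=; ring.
have q_ge0 r : 0 <= q r.
  rewrite /q; apply: Rmult_le_pos; last exact: nsq_ge0.
  by apply: Rmult_le_pos; apply: pow_le; exact: nsq_ge0.
have q1 : 1 <= q s.
  apply: Rnot_lt_le => qs.
  have qs0 := q_ge0 s.
  (* Far to the right each of the 3 + 4 + 1 factors is at least (1-e)^2, so q r >= (1-e)^16 >= 1 -
     16 e = (1 + q s)/2, which exceeds q s and contradicts monotonicity. *)
  pose e := (1 - q s) / 32.
  have e0 : 0 < e <= 1 by rewrite /e; lra.
  have ei : 0 < 1 / e by apply: Rdiv_lt_0_compat; lra.
  pose r := s + (1 + 1 / e).
  have qr : q r <= q s.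
    apply: (@nonincr_of_derive q (fun r => - (2 * q r * l r))); first by rewrite /r; lra.
      by move=> x Hx; apply: qd; lra.
    move=> x Hx; have := l0 x ltac:(lra); have := q_ge0 x; nra.
  have n1 := @nsq_near1 one r e c1 e0 ltac:(rewrite /r; lra).
  have na := @nsq_near1 a r e ca e0 ltac:(rewrite /r; lra).
  have nb := @nsq_near1 b r e cb e0 ltac:(rewrite /r; lra).
  have e2 : 0 <= (1 - e) ^ 2 by nra.
  have : ((1 - e) ^ 2) ^ 3 * ((1 - e) ^ 2) ^ 4 * (1 - e) ^ 2 <= q r.
    rewrite /q; apply: Rmult_le_compat => //.
      by apply: Rmult_le_pos; apply: pow_le.
    by apply: Rmult_le_compat; try (by apply: pow_le); apply: pow_incr.
  rewrite -!pow_mult -!pow_add.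
  have bern n : 1 - INR n * e <= (1 - e) ^ n.
    elim: n => [|n IH]; first by rewrite INR_0 /=; lra.
    rewrite S_INR /=; have := pos_INR n.
    have : (1 - e) * (1 - INR n * e) <= (1 - e) * (1 - e) ^ n by apply: Rmult_le_compat_l; lra.
    nra.
  have B := bern 16%N; rewrite (_ : INR 16 = 16) in B; last by rewrite INR_IZR_INZ.
  move=> C; have {B C} : 1 - 16 * e <= q r by apply: (Rle_trans _ _ _ B).
  by rewrite /e; lra.
have E : q s = (Cmod (Dser one s) ^ 3 * Cmod (Dser a s) ^ 4 * Cmod (Dser b s)) ^ 2.
  by rewrite /q /nsq -!Cmod_sqr; ring.
have Z : Cmod (Dser one s) <= 1 + 1 / (s - 1).
  apply: asum_bound => N; apply: Rle_trans (wt_sum N s1).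
  by apply: Rsum_le => n _; rewrite Cmod_wterm Cmod_1; lra.
have P0 : 0 <= Cmod (Dser a s) ^ 4 * Cmod (Dser b s).
  by apply: Rmult_le_pos; [apply: pow_le|]; exact: Cmod_ge_0.
have P1 : 1 <= Cmod (Dser one s) ^ 3 * Cmod (Dser a s) ^ 4 * Cmod (Dser b s).
  have X0 : 0 <= Cmod (Dser one s) ^ 3 * Cmod (Dser a s) ^ 4 * Cmod (Dser b s).
    by rewrite Rmult_assoc; apply: Rmult_le_pos => //; apply: pow_le; exact: Cmod_ge_0.
  rewrite E in q1; nra.
apply: (Rle_trans _ _ _ P1); rewrite Rmult_assoc [X in _ <= X]Rmult_assoc.
apply: Rmult_le_compat_r => //.
by apply: pow_incr; split; [exact: Cmod_ge_0 | exact: Z].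
Qed.

(** * Non-vanishing at 1 of real L-functions *)

Lemma divisors_pfactor (p v m : nat) : prime p -> (0 < m)%N -> ~~ (p %| m)%N ->
  perm_eq (divisors (p ^ v * m)) [seq (p ^ i * d)%N | i <- index_iota 0 v.+1, d <- divisors m].
Proof.
move=> pp m0 pm.
have n0 : (0 < p ^ v * m)%N by rewrite muln_gt0 expn_gt0 prime_gt0.
have lp i d : (d %| m)%N -> logn p (p ^ i * d) = i.
  move=> dm; have d0 := dvdn_gt0 m0 dm.
  rewrite lognM ?pfactorK ?expn_gt0 ?(prime_gt0 pp) //.
  rewrite [logn p d]lognE; case: ifP => [/and3P[_ _ pd]|]; last by rewrite addn0.
  by case/negP: pm; exact: dvdn_trans pd dm.
apply: uniq_perm; first exact: divisors_uniq.
  apply: allpairs_uniq; [exact: iota_uniq | exact: divisors_uniq |].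
  move=> _ _ /allpairsPdep [i [d [_ Hd ->]]] /allpairsPdep [j [e [_ He ->]]] /= E.
  move: Hd He; rewrite -!dvdn_divisors // => dm em.
  have ij : i = j by rewrite -(lp i d dm) E lp.
  move: E => /eqP; rewrite ij eqn_mul2l expn_eq0; case/orP=> [|/eqP -> //].
  by have := prime_gt0 pp; case: (p).
move=> d; rewrite -dvdn_divisors //; apply/idP/allpairsP.
  move=> dn; have d0 := dvdn_gt0 n0 dn.
  have [e pe E] := pfactor_coprime pp d0.
  exists (logn p d, e); split=> /=.
  - rewrite mem_index_iota /= ltnS; have := dvdn_leq_log p n0 dn.
    by rewrite -{2}(mul1n m) in dn *; rewrite mul1n lp.
  - rewrite -dvdn_divisors //; have : (e %| p ^ v * m)%N by apply: dvdn_trans dn; rewrite E dvdn_mulr.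
    by rewrite Gauss_dvdr // coprime_sym coprimeXl.
  - by rewrite mulnC.
move=> [[i e] [/= Hi He ->]]; move: Hi He; rewrite mem_index_iota /= ltnS -dvdn_divisors // => iv em.
by apply: dvdn_mul => //; exact: dvdn_exp2l.
Qed.

Lemma sum_divisors (F : nat -> R) n : (0 < n)%N ->
  \Rsum_(1 <= d < n.+1 | (d %| n)%N) F d = \Rsum_(d <- divisors n) F d.
Proof.
move=> n0; rewrite -big_filter; apply: perm_big; apply: uniq_perm.
- by apply: filter_uniq; exact: iota_uniq.
- exact: divisors_uniq.
move=> d; rewrite mem_filter mem_index_iota -dvdn_divisors //.
case: (boolP (d %| n)%N) => //= dn.
by rewrite (dvdn_gt0 n0 dn) ltnS dvdn_leq.
Qed.

Section RealCharacter.
Variables (chi : nat -> R) (M : nat).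
Hypothesis chi_val : forall n, chi n = 1 \/ chi n = 0 \/ chi n = -1.
Hypothesis chi1 : chi 1%N = 1.
Hypothesis chiM : forall m n, (0 < m)%N -> (0 < n)%N -> chi (m * n)%N = chi m * chi n.
Hypothesis chi_zm : zero_mean M (fun n => RtoC (chi n)).

Let r (n : nat) : R := \Rsum_(1 <= d < n.+1 | (d %| n)%N) chi d.

Lemma chi_pow_sum p v : (0 < p)%N ->
  0 <= \Rsum_(i <- index_iota 0 v.+1) chi (p ^ i)%N /\
  (~~ odd v -> 1 <= \Rsum_(i <- index_iota 0 v.+1) chi (p ^ i)%N).
Proof.
move=> p0; have chiX i : chi (p ^ i)%N = chi p ^ i.
  by elim: i => [|i IH] //; rewrite expnS chiM ?expn_gt0 ?p0 // IH.
have -> : \Rsum_(i <- index_iota 0 v.+1) chi (p ^ i)%N = \Rsum_(0 <= i < v.+1) (chi p ^ i).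
  by apply: eq_bigr => i _.
case: (chi_val p) => [->|[->|->]].
- rewrite (eq_bigr (fun _ => 1)) => [|i _]; last by rewrite pow1.
  rewrite Rsum_const_nat // subn0; have := @INR_ge1 v.+1 isT; lra.
- rewrite big_nat_recl // big1 => [|i _]; last by rewrite /=; ring.
  rewrite /=; lra.
- have -> : \Rsum_(0 <= i < v.+1) (-1) ^ i = if odd v then 0 else 1.
    elim: v => [|v IH]; first by rewrite big_nat1.
    rewrite big_nat_recr //= IH.
    have -> : -1 * (-1) ^ v = if odd v then 1 else -1.
      elim: v {IH} => [|v IH] /=; first by ring.
      by rewrite IH; case: (odd v) => /=; ring.
    by case: (odd v) => /=; ring.
  by case: (odd v); split => //; lra.
Qed.

(** [r] is the convolution of 1 and chi. Splitting off the full power of the smallest prime reduces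
    both claims to [chi_pow_sum]. The condition on exponents says that n is a square. *)
Lemma chi_div_sum n : (0 < n)%N ->
  0 <= r n /\ ((forall p, ~~ odd (logn p n)) -> 1 <= r n).
Proof.
have [k] := ubnP n; elim: k n => // k IH n nk n0.
have [n1|n1] := leqP n 1.
  have -> : n = 1%N by lia.
  have -> : r 1 = 1 by rewrite /r big_mkcond /= big_nat1 dvdn1 eqxx.
  by lra.
pose p := pdiv n; have pp : prime p := pdiv_prime n1.
have [m pm E] := pfactor_coprime pp n0; set v := logn p n in E.
have v0 : (0 < v)%N by rewrite logn_gt0 mem_primes pp n0 pdiv_dvd.
have m0 : (0 < m)%N by move: n0; rewrite E muln_gt0 => /andP[].
have pNm : ~~ (p %| m)%N by rewrite -prime_coprime.
have mn : (m < n)%N.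
  rewrite E -{1}(muln1 m) ltn_pmul2l // -{1}(exp1n v) ltn_exp2r //; exact: prime_gt1.
have rE : r n = (\Rsum_(i <- index_iota 0 v.+1) chi (p ^ i)%N) * r m.
  rewrite {1}/r sum_divisors // {1}E mulnC (perm_big _ (divisors_pfactor v pp m0 pNm)).
  rewrite big_allpairs_dep big_distrl /=; apply: eq_bigr => i _.
  rewrite /r sum_divisors // big_distrr /= big_seq [RHS]big_seq; apply: eq_bigr => d.
  rewrite -dvdn_divisors // => dm.
  by rewrite chiM ?expn_gt0 ?(prime_gt0 pp) ?(dvdn_gt0 m0 dm).
have [H1 H2] := chi_pow_sum v (prime_gt0 pp).
have [H3 H4] := IH m ltac:(lia) m0.
split; first by rewrite rE; apply: Rmult_le_pos.
move=> Hsq; rewrite rE.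
have A := H2 (Hsq p).
have B : 1 <= r m.
  apply: H4 => q.
  have := Hsq q; rewrite {1}E lognM ?expn_gt0 ?(prime_gt0 pp) ?oddD //.
  have [->|qp] := eqVneq q p.
    by rewrite [logn p m]lognE (negbTE pNm) !andbF.
  rewrite lognX (_ : logn q p = 0%N) ?muln0 ?addbF // logn_prime //.
  by rewrite (negbTE qp).
nra.
Qed.

(* Monsky: if the L-value vanished, [sum r(m) x^m] would stay bounded as x -> 1. *)
Section Lambert.
Variable c : R.
Hypothesis c0 : 0 < c.
Let x := exp (- c).
Let z := exp (- (c / 2)).
Let sg (n : nat) : R := \Rsum_(0 <= i < n) x ^ i.
Let b (n : nat) : R := / (INR n * (1 - x)) - x ^ n / (1 - x ^ n).

Lemma lambert_x01 : 0 < x < 1.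
Proof. by split; [exact: exp_pos | rewrite -exp_0; apply: exp_increasing; lra]. Qed.

Lemma lambert_z01 : 0 < z < 1.
Proof. by split; [exact: exp_pos | rewrite -exp_0; apply: exp_increasing; lra]. Qed.

Lemma lambert_xz : x = z * z.
Proof. by rewrite /x /z -exp_plus; congr exp; field. Qed.

Lemma lambert_sgS n : sg n.+1 = 1 + x * sg n.
Proof. by rewrite /sg big_nat_recl // big_distrr. Qed.

Lemma lambert_geo n : (1 - x) * sg n = 1 - x ^ n.
Proof.
elim: n => [|n IH]; first by rewrite /sg big_geq //=; ring.
rewrite lambert_sgS (_ : (1 - x) * (1 + x * sg n) = (1 - x) + x * ((1 - x) * sg n)); last by ring.
by rewrite IH -[x ^ n.+1]/(x * x ^ n); ring.
Qed.

(** AM-GM applied to the pairs x^i and x^{n-1-i}; multiplying by z avoids the exponent n - 1. The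
    induction removes the two outermost terms at once. *)
Lemma lambert_sg_ge n : INR n * z ^ n <= z * sg n.
Proof.
have [z0 z1] := lambert_z01.
have [k] := ubnP n; elim: k n => // k IH [|[|n]] nk.
- by rewrite INR_0 /sg big_geq //=; lra.
- by rewrite INR_1 /sg big_nat1 /=; lra.
have sgSS : sg n.+2 = 1 + x * sg n + x ^ n.+1.
  by rewrite /sg big_nat_recl // big_nat_recr //= -big_distrr /=; ring.
have H := IH n ltac:(lia).
have H2 : z * (x * sg n) >= z ^ 2 * (INR n * z ^ n) by rewrite lambert_xz; nra.
have X : x ^ n.+1 = z ^ n.+1 * z ^ n.+1 by rewrite lambert_xz Rpow_mult_distr.
rewrite sgSS !S_INR.
have : 2 * z ^ n.+1 <= 1 + x ^ n.+1.
  rewrite X; have := Rle_0_sqr (1 - z ^ n.+1); rewrite /Rsqr; lra.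
move=> H3; have : z * (2 * z ^ n.+1) <= z * (1 + x ^ n.+1) by apply: Rmult_le_compat_l; lra.
rewrite /= in H2 *; lra.
Qed.

Lemma lambert_xn n : (0 < n)%N -> 0 < x ^ n < 1.
Proof.
have [x0 x1] := lambert_x01; case: n => // n _; split; first exact: pow_lt.
by have [] : 0 <= x ^ n.+1 < 1 by apply: pow_lt_1_compat; [lra | lia].
Qed.

Lemma lambert_sg_pos n : (0 < n)%N -> 0 < sg n.
Proof. by move=> n0; have := lambert_geo n; have := lambert_xn n0; have := lambert_x01; nra. Qed.

Lemma lambert_bE n : (0 < n)%N -> b n = (/ INR n - x ^ n / sg n) / (1 - x).
Proof.
move=> n0; rewrite /b -lambert_geo; have := lambert_sg_pos n0; have := INR_ge1 n0; have := lambert_x01.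
by move=> [? ?] ? ?; field; lra.
Qed.

Lemma lambert_b_ge0 n : (0 < n)%N -> 0 <= b n.
Proof.
move=> n0; rewrite lambert_bE //; have [x0 x1] := lambert_x01; have s0 := lambert_sg_pos n0.
have n1 := INR_ge1 n0.
apply: Rdiv_le_0_compat; last lra.
suff : x ^ n / sg n <= / INR n by lra.
apply: (Rmult_le_reg_r (sg n * INR n)); first by apply: Rmult_lt_0_compat; lra.
have -> : x ^ n / sg n * (sg n * INR n) = INR n * x ^ n by field; lra.
have -> : / INR n * (sg n * INR n) = sg n by field; lra.
rewrite /sg -[X in X * _]/(INR n) (_ : INR n * x ^ n = \Rsum_(0 <= i < n) x ^ n); last first.
  by rewrite Rsum_const_nat // subn0.
apply: Rsum_le_nat => i /andP[_ /ltP iN].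
have -> : n = Nat.add i (n - i)%coq_nat by lia.
rewrite pow_add -[X in _ <= X]Rmult_1_r; apply: Rmult_le_compat_l.
  by apply: pow_le; lra.
by rewrite -(pow1 (n - i)%coq_nat); apply: pow_incr; lra.
Qed.

(** After clearing denominators the claim is n (n+1) x^n <= sg n * sg (n+1), which the product of
    two consecutive instances of [lambert_sg_ge] gives with a factor z to spare. *)
Lemma lambert_b_decr n : (0 < n)%N -> b n.+1 <= b n.
Proof.
move=> n0; rewrite !lambert_bE //; have [x0 x1] := lambert_x01.
have s0 := lambert_sg_pos n0; have s1 : 0 < sg n.+1 by apply: lambert_sg_pos.
have n1 := INR_ge1 n0; have [z0 z1] := lambert_z01.
apply: Rmult_le_compat_r; first by left; apply: Rinv_0_lt_compat; lra.
suff : 0 <= (/ INR n - x ^ n / sg n) - (/ INR n.+1 - x ^ n.+1 / sg n.+1) by lra.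
have -> : (/ INR n - x ^ n / sg n) - (/ INR n.+1 - x ^ n.+1 / sg n.+1) =
  (sg n * sg n.+1 - INR n * INR n.+1 * x ^ n) / (INR n * INR n.+1 * (sg n * sg n.+1)).
  rewrite lambert_sgS in s1 *; rewrite S_INR -[x ^ n.+1]/(x * x ^ n); field; lra.
apply: Rdiv_le_0_compat; last first.
  by rewrite S_INR; apply: Rmult_lt_0_compat; apply: Rmult_lt_0_compat; lra.
have A := lambert_sg_ge n; have B := lambert_sg_ge n.+1.
have zn : 0 < z ^ n by apply: pow_lt.
have A0 : 0 <= INR n * z ^ n by apply: Rmult_le_pos; lra.
have B0 : 0 <= INR n.+1 * z ^ n.+1 by apply: Rmult_le_pos; [exact: pos_INR | apply: pow_le; lra].
have P := Rmult_le_compat _ _ _ _ A0 B0 A B.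
have X : x ^ n = z ^ n * z ^ n by rewrite lambert_xz Rpow_mult_distr.
have : z * (INR n * INR n.+1 * x ^ n) <= z * (z * (sg n * sg n.+1)).
  by rewrite X; rewrite /= in P; lra.
move/(Rmult_le_reg_l _ _ _ z0) => P2.
have : z * (sg n * sg n.+1) <= 1 * (sg n * sg n.+1).
  apply: Rmult_le_compat_r; last lra.
  by apply: Rmult_le_pos; lra.
lra.
Qed.

(** Exchanging the sums gives a truncated Lambert series in x^d/(1-x^d), which is 1/(d(1-x)) - b d.
    The part with [b] is at most M by partial summation, since [b] decreases from b 1 = 1; the
    second term comes from the partial sum of L(1), the last one from truncation. *)
Lemma lambert_sum N : (0 < N)%N ->
  \Rsum_(1 <= m < N.+1) (r m * x ^ m) <=
  INR M + Rabs (\Rsum_(1 <= n < N.+1) (chi n * / INR n)) / (1 - x) + INR N * x ^ N / (1 - x).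
Proof.
move=> N0; have [x0 x1] := lambert_x01.
have E1 : \Rsum_(1 <= m < N.+1) (r m * x ^ m) =
  \Rsum_(1 <= d < N.+1) (chi d * \Rsum_(1 <= e < (N %/ d).+1) x ^ (d * e)).
  transitivity (\Rsum_(1 <= m < N.+1) \Rsum_(1 <= d < N.+1 | (d %| m)%N) (chi d * x ^ m)).
    apply: eq_big_nat => n /andP[n0 nN]; rewrite -big_distrl /=; congr Rmult.
    rewrite /r [in RHS](@big_cat_nat _ _ _ n.+1) //=.
    rewrite [X in _ + X]big1_seq ?Rplus_0_r // => i /andP[/dvdn_leq]; move/(_ n0).
    rewrite mem_index_iota; lia.
  rewrite (exchange_big_dep_nat xpredT) //=.
  apply: eq_big_nat => d /andP[d0 dN]; rewrite -big_distrr /=; congr Rmult.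
  by rewrite (@big_multiples _ _ _ (fun m => x ^ m)).
have E2 d : (0 < d)%N -> (d <= N)%N ->
  Rabs (\Rsum_(1 <= e < (N %/ d).+1) x ^ (d * e) - x ^ d / (1 - x ^ d)) <= x ^ N / (1 - x).
  move=> d0 dN; have [y0 y1] := lambert_xn d0.
  have geo K : \Rsum_(1 <= e < K.+1) x ^ (d * e) = (x ^ d - x ^ (d * K.+1)) / (1 - x ^ d).
    elim: K => [|K IH]; first by rewrite big_geq // muln1; field; lra.
    rewrite big_nat_recr //= IH.
    have -> : x ^ (d * K.+2) = x ^ d * x ^ (d * K.+1).
      by rewrite -pow_add; congr pow; lia.
    by field; lra.
  rewrite geo (_ : _ - _ = - (x ^ (d * (N %/ d).+1) / (1 - x ^ d))); last by field; lra.
  rewrite Rabs_Ropp Rabs_pos_eq; last by apply: Rdiv_le_0_compat; [apply: pow_le; lra | lra].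
  have L1 : x ^ (d * (N %/ d).+1) <= x ^ N.
    have : (N <= d * (N %/ d).+1)%N by rewrite mulnC; apply: ltnW; rewrite ltn_ceil.
    move=> /subnKC <-; rewrite -[(_ + _)%N]/(Nat.add _ _) pow_add.
    rewrite -[X in _ <= X]Rmult_1_r; apply: Rmult_le_compat_l; first by apply: pow_le; lra.
    by rewrite -(pow1 (d * (N %/ d).+1 - N)); apply: pow_incr; lra.
  have L2 : x ^ d <= x.
    case: d d0 {dN y0 y1 geo L1} => // d _; rewrite /= -[X in _ <= X]Rmult_1_r.
    apply: Rmult_le_compat_l; first lra.
    by rewrite -(pow1 d); apply: pow_incr; lra.
  apply: Rmult_le_compat; [by apply: pow_le; lra | | exact: L1 |].
    by left; apply: Rinv_0_lt_compat; lra.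
  by apply: Rinv_le_contravar; lra.
have c1 d : Rabs (chi d) <= 1.
  by case: (chi_val d) => [->|[->|->]]; rewrite /Rabs; case: Rcase_abs; lra.
have E3 : Rabs (\Rsum_(1 <= d < N.+1) (chi d * b d)) <= INR M.
  have := @abel_bound (fun n => RtoC (chi n)) (fun n => RtoC (b n)) b (INR M) 1 N.+1 isT.
  have -> : b 1 = 1 by rewrite /b INR_1 pow_1; field; lra.
  rewrite Rmult_1_r (_ : \Csum_(1 <= n < N.+1) (RtoC (chi n) * RtoC (b n)) = RtoC (\Rsum_(1 <= d < N.+1) (chi d * b d))); last first.
    by rewrite RtoC_sum; apply: eq_bigr => n _; rewrite RtoC_mult.
  rewrite Cmod_R; apply.
  - by move=> n _; apply: zm_partial.
  - by move=> n n0; rewrite Cmod_R Rabs_pos_eq; [lra | apply: lambert_b_ge0].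
  - move=> n n0; rewrite -RtoC_minus Cmod_R Rabs_pos_eq; first lra.
    by have := lambert_b_decr n0; lra.
rewrite E1.
have -> : \Rsum_(1 <= d < N.+1) (chi d * \Rsum_(1 <= e < (N %/ d).+1) x ^ (d * e)) =
  - (\Rsum_(1 <= d < N.+1) (chi d * b d)) +
  (\Rsum_(1 <= d < N.+1) (chi d * / INR d)) * / (1 - x) +
  \Rsum_(1 <= d < N.+1) (chi d * (\Rsum_(1 <= e < (N %/ d).+1) x ^ (d * e) - x ^ d / (1 - x ^ d))).
  rewrite -Rsum_opp big_distrl /= -!big_split /=; apply: eq_big_nat => d /andP[d0 _].
  have := lambert_xn d0; have := INR_ge1 d0; rewrite /b => h1 h2; field; lra.
apply: Rplus_le_compat; first apply: Rplus_le_compat.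
- by have := Rle_abs (- (\Rsum_(1 <= d < N.+1) (chi d * b d))); rewrite Rabs_Ropp; lra.
- apply: Rmult_le_compat_r; last exact: Rle_abs.
  by left; apply: Rinv_0_lt_compat; lra.
apply: Rle_trans (_ : _ <= \Rsum_(1 <= d < N.+1) (x ^ N / (1 - x))) _.
  apply: Rsum_le_nat => d /andP[d0 dN].
  have := E2 d d0 dN; set w := _ - _ => Hw.
  apply: Rle_trans (Rle_abs _) _; rewrite Rabs_mult.
  by have := c1 d; have := Rabs_pos w; have := Rabs_pos (chi d); nra.
by rewrite Rsum_const_nat // subn1 /= /Rdiv; lra.
Qed.

(** By nonnegativity of [r], only the K squares k^2 with k <= K are kept; there r >= 1. *)
Lemma lambert_lower K N : (0 < K)%N -> (K ^ 2 <= N)%N ->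
  INR K * x ^ (K ^ 2) <= \Rsum_(1 <= m < N.+1) (r m * x ^ m).
Proof.
move=> K0 KN; have [x0 x1] := lambert_x01.
have sq_sub : \Rsum_(1 <= k < K.+1) (r (k ^ 2) * x ^ (k ^ 2)) <= \Rsum_(1 <= m < N.+1) (r m * x ^ m).
  have -> : \Rsum_(1 <= k < K.+1) (r (k ^ 2) * x ^ (k ^ 2)) =
     \Rsum_(m <- [seq (k ^ 2)%N | k <- index_iota 1 K.+1]) (r m * x ^ m) by rewrite big_map.
  have -> : \Rsum_(m <- [seq (k ^ 2)%N | k <- index_iota 1 K.+1]) (r m * x ^ m) =
     \Rsum_(1 <= m < N.+1 | m \in [seq (k ^ 2)%N | k <- index_iota 1 K.+1]) (r m * x ^ m).
    rewrite -[RHS]big_filter; apply: perm_big; apply: uniq_perm.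
    - rewrite map_inj_uniq ?iota_uniq // => i j /eqP; rewrite eqn_exp2r //; exact/eqP.
    - by apply: filter_uniq; exact: iota_uniq.
    move=> m; rewrite mem_filter; case: (boolP (m \in _)) => //= /mapP [k]; rewrite !mem_index_iota => /andP[k0 kK] ->.
    rewrite expn_gt0 k0 /= ltnS; apply/esym; apply: leq_trans KN; rewrite leq_exp2r //; lia.
  rewrite big_mkcond; apply: Rsum_le_nat => m /andP[m0 _].
  have : 0 <= r m * x ^ m.
    by apply: Rmult_le_pos; [exact: (chi_div_sum m0).1 | apply: pow_le; lra].
  by case: ifP => _; lra.
apply: Rle_trans sq_sub.
have -> : INR K * x ^ (K ^ 2) = \Rsum_(1 <= k < K.+1) x ^ (K ^ 2).
  by rewrite Rsum_const_nat // subn1.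
apply: Rsum_le_nat => k /andP[k0 kK].
have k20 : (0 < k ^ 2)%N by rewrite expn_gt0 k0.
have R1 : 1 <= r (k ^ 2).
  by apply: (chi_div_sum k20).2 => p; rewrite lognX oddM.
have X1 : x ^ (K ^ 2) <= x ^ (k ^ 2).
  have : (k ^ 2 <= K ^ 2)%N by rewrite leq_exp2r //; lia.
  move=> /subnKC <-; rewrite -[(k ^ 2 + _)%N]/(Nat.add _ _) pow_add.
  rewrite -[X in _ <= X]Rmult_1_r; apply: Rmult_le_compat_l; first by apply: pow_le; lra.
  by rewrite -(pow1 (K ^ 2 - k ^ 2)); apply: pow_incr; lra.
have : 0 <= x ^ (k ^ 2) by apply: pow_le; lra.
nra.
Qed.
End Lambert.

(** Were the partial sums small for arbitrarily large N, then for a fixed x the upper bound of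
    [lambert_sum] would fall below the lower bound of [lambert_lower]. *)
Lemma L1_nonzero : exists e, 0 < e /\ exists N0, forall N, (N0 <= N)%N ->
  e <= Rabs (\Rsum_(1 <= n < N.+1) (chi n * / INR n)).
Proof.
apply: NNPP => nex.
pose P N := \Rsum_(1 <= n < N.+1) (chi n * / INR n).
have small e N0 : 0 < e -> exists N, (N0 <= N)%N /\ Rabs (P N) < e.
  move=> e0; apply: NNPP => H; apply: nex; exists e; split=> //; exists N0 => N NN.
  by apply: Rnot_lt_le => HN; apply: H; exists N.
(* This c makes x^(K^2) at least 1/2, so the lower bound is K/2 = M + 5/2, while the upper bound
   will be at most M + 1/2 + 1/2. *)
pose K := (2 * M + 5)%N; pose c := / (2 * INR (K ^ 2)).
have K0 : (0 < K)%N by rewrite /K; lia.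
have K20 : (0 < K ^ 2)%N by rewrite expn_gt0 K0.
have K2 := INR_ge1 K20.
have c0 : 0 < c by apply: Rinv_0_lt_compat; lra.
have [x0 x1] := lambert_x01 c0; set x := exp (- c) in x0 x1.
have xp n : x ^ n = exp (- (c * INR n)).
  elim: n => [|n IH]; first by rewrite INR_0 Rmult_0_r Ropp_0 exp_0.
  by rewrite /= IH /x -exp_plus S_INR; congr exp; ring.
have xK : 1 / 2 <= x ^ (K ^ 2).
  rewrite xp; have := exp_ineq1_le (- (c * INR (K ^ 2))).
  have -> : c * INR (K ^ 2) = 1 / 2 by rewrite /c; field; lra.
  lra.
(* Since N^2 x^N <= (3/c)^2, any N >= A makes the truncation term N x^N/(1-x) at most 1/2. *)
pose A := 18 / (c ^ 2 * (1 - x)).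
have A0 : 0 < A.
  by apply: Rdiv_lt_0_compat; [lra | apply: Rmult_lt_0_compat; [apply: pow_lt | lra]].
have [N1 HN1] : exists N1, A <= INR N1.
  have [N1 HN1] := INR_unbounded A; by exists N1; lra.
have [N [NN HN]] := @small ((1 - x) / 2) (maxn N1.+1 (K ^ 2)) ltac:(lra).
move: NN; rewrite geq_max => /andP[NN1 NK].
have N0 : (0 < N)%N by lia.
have Nge : A <= INR N by apply: (Rle_trans _ _ _ HN1); apply: le_INR; lia.
have L := @lambert_lower c c0 K N K0 NK; have U := @lambert_sum c c0 N N0.
rewrite -/x -/(P N) in L U.
have T1 : Rabs (P N) / (1 - x) <= 1 / 2.
  apply: (Rmult_le_reg_r (1 - x)); first lra.
  by rewrite /Rdiv Rmult_assoc Rinv_l; lra.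
have T2 : INR N * x ^ N / (1 - x) <= 1 / 2.
  have n1 := INR_ge1 N0.
  have := @pow_le_exp 2 c (INR N) c0 ltac:(lra).
  rewrite (_ : INR 3 = 3); last by rewrite INR_IZR_INZ.
  move=> Q.
  have Q2 : INR N ^ 2 * x ^ N <= (3 / c) ^ 2.
    rewrite xp; apply: Rle_trans (_ : _ <= (3 / c) ^ 2 * exp (c * INR N) * exp (- (c * INR N))) _.
      by apply: Rmult_le_compat_r => //; left; exact: exp_pos.
    by rewrite Rmult_assoc -exp_plus Rplus_opp_r exp_0; lra.
  apply: (Rmult_le_reg_r (INR N)); first lra.
  rewrite (_ : INR N * x ^ N / (1 - x) * INR N = (INR N ^ 2 * x ^ N) / (1 - x)); last by field; lra.
  apply: Rle_trans (_ : _ <= (3 / c) ^ 2 / (1 - x)) _.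
    by apply: Rmult_le_compat_r => //; left; apply: Rinv_0_lt_compat; lra.
  apply: (Rle_trans _ (1 / 2 * A)); last by apply: Rmult_le_compat_l; lra.
  by right; rewrite /A; field; lra.
have : INR K * (1 / 2) <= INR K * x ^ (K ^ 2) by apply: Rmult_le_compat_l => //; exact: pos_INR.
have EK : INR K = 2 * INR M + 5.
  by rewrite /K plus_INR mult_INR !INR_IZR_INZ.
lra.
Qed.

End RealCharacter.

(** * Lower bounds for L-functions *)

Lemma pow4_le_inv a b : 0 <= a -> 0 <= b -> a ^ 4 <= b ^ 4 -> a <= b.
Proof.
move=> a0 b0 H; apply: Rnot_lt_le => ba.
have : b ^ 4 < a ^ 4.
  have h2 : b * b < a * a by nra.
  have : (b * b) * (b * b) < (a * a) * (a * a) by nra.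
  by rewrite /=; lra.
lra.
Qed.

Lemma lower_of_341 a b C0 e s : 1 <= C0 -> 1 <= e -> cmult a -> cmult b ->
  (forall n, (0 < n)%N -> 0 <= 3 + 4 * Re (a n) + Re (b n)) ->
  (forall r, 1 < r <= 2 -> Cmod (Dser b r) <= C0 * e) ->
  (forall r, 1 < r <= 2 -> Cmod (Dser (lnk 1 a) r) <= C0 * e ^ 2) ->
  1 < s <= 2 ->
  (/ (16 * C0 ^ 2)) ^ 3 / (16 * C0) * (/ e) ^ 7 <= Cmod (Dser a s).
Proof.
move=> C1 e1 ca cb pos Hb Ha s12.
set c0 := / (16 * C0 ^ 2); set i := / e.
have i0 : 0 < i by apply: Rinv_0_lt_compat; lra.
have ie : i * e = 1 by rewrite /i; field; lra.
have i1 : i <= 1 by nra.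
have C2 : 1 <= C0 ^ 2 by nra.
have c00 : 0 < c0 by apply: Rinv_0_lt_compat; lra.
have cC : c0 * (16 * C0 ^ 2) = 1 by rewrite /c0; field; lra.
have c01 : c0 <= 1 by nra.
(* With d of order e^{-9}, 3-4-1 gives (d^3/e)^{1/4} = e^{-7} and the Lipschitz loss e^2 d is again
   e^{-7}: 9 is the exponent that balances the two. The constant [c0] makes the loss half of the
   gain [m]. *)
pose d := c0 ^ 4 * i ^ 9.
have d0 : 0 < d by apply: Rmult_lt_0_compat; apply: pow_lt.
have d1 : d <= 1.
  have H1 : c0 ^ 4 <= 1 by rewrite -(pow1 4); apply: pow_incr; lra.
  have H2 : i ^ 9 <= 1 by rewrite -(pow1 9); apply: pow_incr; lra.
  have : 0 <= c0 ^ 4 by apply: pow_le; lra.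
  have : 0 <= i ^ 9 by apply: pow_le; lra.
  rewrite /d; nra.
have i7 : 0 < i ^ 7 by apply: pow_lt.
have c3 : 0 < c0 ^ 3 by apply: pow_lt.
pose m := c0 ^ 3 * i ^ 7 / (8 * C0).
have m0 : 0 < m by apply: Rdiv_lt_0_compat; nra.
have big r : 1 + d <= r <= 2 -> m <= Cmod (Dser a r).
  move=> rd; apply: pow4_le_inv; [lra | exact: Cmod_ge_0 |].
  have T := @three_four_one a b r ca cb pos ltac:(lra).
  have B := Hb r ltac:(lra).
  have Z : 1 + 1 / (r - 1) <= 2 / d.
    have h1 : 1 / (r - 1) <= 1 / d by apply: Rmult_le_compat_l; [lra | apply: Rinv_le_contravar; lra].
    have h2 : 1 <= 1 / d by apply: (Rmult_le_reg_r d) => //; rewrite /Rdiv Rmult_assoc Rinv_l; lra.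
    by rewrite /Rdiv in h1 h2 *; lra.
  have A0 : 0 <= Cmod (Dser a r) ^ 4 by apply: pow_le; exact: Cmod_ge_0.
  have Zp : 0 <= 1 + 1 / (r - 1).
    by have : 0 < 1 / (r - 1); [apply: Rdiv_lt_0_compat; lra | lra].
  have Z3 : (1 + 1 / (r - 1)) ^ 3 <= (2 / d) ^ 3 by apply: pow_incr.
  have T2 : 1 <= (2 / d) ^ 3 * Cmod (Dser a r) ^ 4 * (C0 * e).
    apply: (Rle_trans _ _ _ T); apply: Rmult_le_compat => //; try exact: Cmod_ge_0.
      by apply: Rmult_le_pos => //; apply: pow_le.
    by apply: Rmult_le_compat_r.
  have F0 : 0 < (d / 2) ^ 3 * / (C0 * e).
    by apply: Rmult_lt_0_compat; [apply: pow_lt; lra | apply: Rinv_0_lt_compat; nra].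
  have T3 : (d / 2) ^ 3 * / (C0 * e) <= Cmod (Dser a r) ^ 4.
    have := Rmult_le_compat_l _ _ _ (Rlt_le _ _ F0) T2.
    have -> : (d / 2) ^ 3 * / (C0 * e) * ((2 / d) ^ 3 * Cmod (Dser a r) ^ 4 * (C0 * e)) = Cmod (Dser a r) ^ 4.
      by field; lra.
    lra.
  apply: (Rle_trans _ _ _ _ T3).
  have -> : (d / 2) ^ 3 * / (C0 * e) = c0 ^ 12 * i ^ 28 / (8 * C0).
    by rewrite /d /i; field; lra.
  have -> : m ^ 4 = c0 ^ 12 * i ^ 28 / (8 * C0) / (8 * C0) ^ 3 by rewrite /m; field; lra.
  have P : 0 <= c0 ^ 12 * i ^ 28 / (8 * C0).
    by apply: Rdiv_le_0_compat; [apply: Rmult_le_pos; apply: pow_le; lra | lra].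
  have Q : 1 <= (8 * C0) ^ 3 by apply: pow_R1_Rle; lra.
  apply: (Rmult_le_reg_r ((8 * C0) ^ 3)); first lra.
  rewrite /Rdiv Rmult_assoc Rinv_l; last lra.
  by rewrite /Rdiv in P; nra.
have fin : c0 ^ 3 / (16 * C0) * i ^ 7 = m / 2 by rewrite /m; field; lra.
rewrite fin.
have [sd|sd] := Rle_dec (1 + d) s; first by have := big s ltac:(lra); lra.
have B1 := big (1 + d) ltac:(lra).
have L := @Dser_lipschitz 0 a s (1 + d) (C0 * e ^ 2) (adm_cmult ca) ltac:(lra) ltac:(lra).
have {}L := L ltac:(move=> r Hr; apply: Ha; lra).
have L2 : C0 * e ^ 2 * (1 + d - s) <= m / 2.
  apply: (Rle_trans _ (C0 * e ^ 2 * d)).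
    by apply: Rmult_le_compat_l; [nra | lra].
  have -> : C0 * e ^ 2 * d = c0 ^ 3 * i ^ 7 * (c0 * C0).
    rewrite /d (_ : i ^ 9 = i ^ 7 * (i * i)); last by ring.
    rewrite (_ : C0 * e ^ 2 * (c0 ^ 4 * (i ^ 7 * (i * i))) = c0 ^ 3 * i ^ 7 * (c0 * C0) * (i * e) ^ 2); last by ring.
    by rewrite ie; ring.
  right; rewrite /m; have -> : c0 * C0 = / (16 * C0) by rewrite /c0; field; lra.
  by field; lra.
have := Cmod_triangle (Dser a s) (Dser a (1 + d) - Dser a s).
rewrite (_ : (Dser a s + (Dser a (1 + d) - Dser a s))%C = Dser a (1 + d)); last by ring.
lra.
Qed.

(** With x = Re z the sum is at least 2 (1+x)^2. Moduli below 1 have to be allowed because a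
    character vanishes on the multiples of the primes of its modulus. *)
Lemma nonneg_341 z : Cmod z <= 1 -> 0 <= 3 + 4 * Re z + Re (z * z)%C.
Proof.
move=> z1; have S := Cmod_sqr z; have z0 := Cmod_ge_0 z.
have : Cmod z * Cmod z <= 1 by nra.
rewrite S; case: z {z1 S z0} => x y /=.
have := Rle_0_sqr (1 + x); rewrite /Rsqr; lra.
Qed.

Lemma cmult_tw psi t : cmult psi -> cmult (tw psi t).
Proof.
move=> [H1 HM Hl]; split.
- by rewrite /tw H1 zit_1; ring.
- by move=> m n m0 n0; rewrite /tw HM // zit_mul //; ring.
- by move=> n; rewrite Cmod_tw.
Qed.

Lemma ell_double t : ell (2 * t) <= 2 * ell t.
Proof.
have t0 := Rabs_pos t; rewrite /ell Rabs_mult (Rabs_pos_eq 2); last lra.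
have -> : 2 * ln (Rabs t + 3) = ln ((Rabs t + 3) ^ 2).
  by rewrite ln_pow; [rewrite INR_IZR_INZ | lra].
by apply: ln_le; nra.
Qed.

Lemma zit_double t n : (zit t n * zit t n)%C = zit (2 * t) n.
Proof.
rewrite /zit (_ : 2 * t * lnN n = t * lnN n + t * lnN n); last by ring.
by rewrite cos_plus sin_plus /Cmult /=; congr (_, _); ring.
Qed.

Lemma cmult_sqr psi : cmult psi -> cmult (fun n => psi n * psi n)%C.
Proof.
move=> [H1 HM Hl]; split.
- by rewrite H1; ring.
- by move=> m n m0 n0; rewrite HM //; ring.
- by move=> n; rewrite Cmod_mult; have := Hl n; have := Cmod_ge_0 (psi n); nra.
Qed.

(** The square of psi is nonprincipal too, so its series at 2t has no pole and [L_bound] applies for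
    every t. *)
Lemma L_lower_complex M psi M' : cmult psi -> zero_mean M psi ->
  zero_mean M' (fun n => psi n * psi n)%C ->
  exists c, 0 < c /\ forall s t, 1 < s <= 2 -> c * (/ ell t) ^ 7 <= Cmod (Dser (tw psi t) s).
Proof.
move=> cp zp zp2.
have [C1 [C1p H1]] := L_bound 1 zp; have [C2 [C2p H2]] := L_bound 0 zp2.
pose C0 := 1 + C1 + 2 * C2.
exists ((/ (16 * C0 ^ 2)) ^ 3 / (16 * C0)); split.
  have ? : 1 <= C0 by rewrite /C0; lra.
  apply: Rdiv_lt_0_compat; last lra.
  by apply: pow_lt; apply: Rinv_0_lt_compat; nra.
move=> s t s12; have e1 := ell_ge1 t.
apply: (@lower_of_341 (tw psi t) (tw (fun n => psi n * psi n)%C (2 * t)) C0) => //.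
- by rewrite /C0; lra.
- exact: cmult_tw.
- by apply: cmult_tw; apply: cmult_sqr.
- move=> n n0.
  have -> : tw (fun n => psi n * psi n)%C (2 * t) n = (tw psi t n * tw psi t n)%C.
    by rewrite /tw -zit_double; ring.
  by apply: nonneg_341; rewrite Cmod_tw; apply: zm_le1 zp n.
- move=> r r12; have := H2 r (2 * t) r12.
  rewrite (Dser_ext _ (fun n _ => lnk0 _ n)) pow_1 => H.
  apply: (Rle_trans _ _ _ H).
  have := ell_double t => ed.
  apply: (Rle_trans _ (C2 * (2 * ell t))); first by apply: Rmult_le_compat_l.
  rewrite /C0; nra.
- move=> r r12; apply: (Rle_trans _ _ _ (H1 r t r12)).
  by apply: Rmult_le_compat_r; [apply: pow_le; lra | rewrite /C0; lra].
Qed.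

Lemma Cmod_zit_sub1 t n : Cmod (zit t n - RtoC 1) <= Rabs t * lnN n.
Proof.
pose F (u : R) : C := (cos (t * u), - sin (t * u)).
have := @Cmod_mean_value F (fun u => RtoC (- t) * (sin (t * u), cos (t * u)))%C
  (fun u => Rabs t * u) (fun _ => Rabs t) 0 (lnN n) (lnN_ge0 n).
have -> : F 0 = RtoC 1 by rewrite /F Rmult_0_r cos_0 sin_0 Ropp_0.
rewrite Rmult_0_r Rminus_0_r; apply => u _.
- by rewrite /F /=; auto_derive => //; ring.
- by rewrite /F /=; auto_derive => //; ring.
- by auto_derive => //; ring.
- by rewrite Cmod_mult Cmod_unit_sc Cmod_R Rabs_Ropp; lra.
Qed.

Lemma wt_sub1 s n : 1 <= s -> Rabs (wt s n - wt 1 n) <= (s - 1) * lnN n.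
Proof.
move=> s1; have l0 := lnN_ge0 n.
have W := @wt_le 1 s n s1; rewrite Rabs_minus_sym Rabs_pos_eq; last lra.
have -> : wt s n = wt 1 n * exp (- ((s - 1) * lnN n)).
  by rewrite /wt -exp_plus; congr exp; ring.
have := exp_ineq1_le (- ((s - 1) * lnN n)).
have w0 := wt_pos 1 n.
have : wt 1 n <= 1.
  by rewrite /wt -[X in _ <= X]exp_0; case: l0 => [l0|<-]; [left; apply: exp_increasing; lra | rewrite Rmult_0_r; lra].
have : 0 <= (s - 1) * lnN n by apply: Rmult_le_pos; lra.
nra.
Qed.

Section RealLower.
Variables (chi : nat -> R) (M : nat).
Hypothesis chi_val : forall n, chi n = 1 \/ chi n = 0 \/ chi n = -1.
Hypothesis chi1 : chi 1%N = 1.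
Hypothesis chiM : forall m n, (0 < m)%N -> (0 < n)%N -> chi (m * n)%N = chi m * chi n.
Hypothesis chi_zm : zero_mean M (fun n => RtoC (chi n)).
Let psi (n : nat) : C := RtoC (chi n).

Lemma cmult_real : cmult psi.
Proof.
split; first by rewrite /psi chi1.
- by move=> m n m0 n0; rewrite /psi chiM // RtoC_mult.
- exact: zm_le1 chi_zm.
Qed.

(** At a fixed N, the partial sum at (s, t) is within e/4 of the one at (1, 0) by continuity, and
    the tail is below e/4 by [Ltail], which is uniform up to s = 1. So at least e/2 is left of the e
    from [L1_nonzero]. *)
Lemma real_lower_near : exists c d, 0 < c /\ 0 < d <= 1 /\ forall s t,
  1 < s <= 1 + d -> Rabs t <= d -> c <= Cmod (Dser (tw psi t) s).
Proof.
have [e [e0 [N0 HN0]]] := L1_nonzero chi_val chi1 chiM chi_zm.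
have [C0 [C0p HC]] := Ltail 0 chi_zm.
have [N [NN Ntail]] : exists N, (maxn N0 1 <= N)%N /\ C0 * 2 * wt (1/2) N <= e / 4.
  (* N >= B^2 gives N^{-1/2} <= 1/B, which is below e / (8 C0) when C0 is positive. *)
  pose B := 8 * C0 / e + 1.
  have B0 : 0 < B by have : 0 <= 8 * C0 / e; [apply: Rdiv_le_0_compat; lra | rewrite /B; lra].
  have [N1 HN1] := INR_unbounded (B ^ 2).
  exists (maxn (maxn N0 1) N1); split; first exact: leq_maxl.
  set N := maxn _ N1.
  have Np : (0 < N)%N by rewrite /N; lia.
  have NB : B ^ 2 <= INR N by apply: (Rle_trans _ (INR N1)); [lra | apply: le_INR; rewrite /N; lia].
  have W : wt (1/2) N <= / B.
    rewrite /wt -(exp_ln B) // -exp_Ropp.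
    have : 2 * ln B <= lnN N.
      rewrite -[2]/(INR 2) /lnN -ln_pow //; apply: ln_le => //; exact: pow_lt.
    move=> L; have : - (1 / 2) * lnN N <= - ln B by lra.
    exact: exp_le_mono.
  apply: (Rle_trans _ (C0 * 2 * / B)); first by apply: Rmult_le_compat_l => //; lra.
  apply: (Rmult_le_reg_r B) => //; rewrite Rmult_assoc Rinv_l; last lra.
  rewrite (_ : e / 4 * B = 2 * C0 + e / 4); last by rewrite /B; field; lra.
  lra.
have N1 : (0 < N)%N by lia.
have n1 := INR_ge1 N1; have l0 := lnN_ge0 N.
pose D := INR N * lnN N * 2 + 1.
have D1 : 1 <= D by rewrite /D; have : 0 <= INR N * lnN N; [apply: Rmult_le_pos; lra | lra].
pose d := Rmin 1 (e / (4 * D)).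
have d0 : 0 < d by apply: Rmin_pos; [lra | apply: Rdiv_lt_0_compat; lra].
have dl : d <= 1 by exact: Rmin_l.
have dD : d * D <= e / 4.
  apply: (Rle_trans _ (e / (4 * D) * D)).
    by apply: Rmult_le_compat_r; [lra | exact: Rmin_r].
  by right; field; lra.
exists (e / 4), d; split; first lra.
split=> // s t sd td.
have t0 := Rabs_pos t.
have head : Cmod (Psum (wterm (tw psi t) s) N - RtoC (\Rsum_(1 <= n < N.+1) (chi n * / INR n))) <= e / 4.
  rewrite RtoC_sum /Psum /Cminus -Csum_opp -big_split /=.
  apply: Rle_trans (Cmod_sum_le _ _ _) _.
  apply: (Rle_trans _ (\Rsum_(1 <= n < N.+1) (d * lnN N * 2))).
    apply: Rsum_le_nat => n /andP[n0 nN].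
    have -> : (wterm (tw psi t) s n + - RtoC (chi n * / INR n) =
       psi n * (zit t n * RtoC (wt s n - wt 1 n) + (zit t n - RtoC 1) * RtoC (wt 1 n)))%C.
      by rewrite /wterm /tw /psi -(wt1E n0) RtoC_minus RtoC_mult; ring.
    rewrite Cmod_mult.
    have P1 : Cmod (psi n) <= 1 := zm_le1 chi_zm n.
    have ln_le : lnN n <= lnN N by apply: lnN_le => //; lia.
    have P2 : Cmod (zit t n * RtoC (wt s n - wt 1 n) + (zit t n - RtoC 1) * RtoC (wt 1 n)) <= d * lnN N * 2.
      apply: Rle_trans (Cmod_triangle _ _) _.
      rewrite !Cmod_mult Cmod_zit Rmult_1_l !Cmod_R.
      have Q1 := @wt_sub1 s n ltac:(lra).
      have Q2 := Cmod_zit_sub1 t n.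
      have Q3 : Rabs (wt 1 n) <= 1.
        rewrite wt1E // Rabs_pos_eq; last by left; apply: Rinv_0_lt_compat; have := INR_ge1 n0; lra.
        by rewrite -Rinv_1; apply: Rinv_le_contravar; [lra | exact: INR_ge1].
      have l1 := lnN_ge0 n.
      have R1 : (s - 1) * lnN n <= d * lnN N by apply: Rmult_le_compat; lra.
      have R2 : Cmod (zit t n - RtoC 1) * Rabs (wt 1 n) <= d * lnN N * 1.
        apply: Rmult_le_compat => //; [exact: Cmod_ge_0 | exact: Rabs_pos |].
        by apply: (Rle_trans _ _ _ Q2); apply: Rmult_le_compat.
      lra.
    apply: (Rle_trans _ (1 * (d * lnN N * 2))); last lra.
    by apply: Rmult_le_compat; try exact: Cmod_ge_0.
  rewrite Rsum_const_nat // subn1 /=.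
  apply: (Rle_trans _ (d * D)) => //.
  by rewrite /D; lra.
have HH := HN0 N ltac:(lia).
have tail : Cmod (Dser (tw psi t) s - Psum (wterm (tw psi t) s) N) <= e / 4.
  have H := Dser_csum (adm_cmult (cmult_tw t cmult_real)) (proj1 sd).
  (* Replacing the first N terms by 0 makes the tail a series in its own right, to which
     [csum_bound] applies. *)
  have H2 : is_csum (fun n => if (n <= N)%N then RtoC 0 else wterm (tw psi t) s n)
      (Dser (tw psi t) s - Psum (wterm (tw psi t) s) N)%C.
    move=> x /H [N2 HN2]; exists (maxn N N2) => K KN.
    have := HN2 K ltac:(lia).
    have -> : (Psum (wterm (tw psi t) s) K - Dser (tw psi t) s =
      Psum (fun n => if (n <= N)%N then RtoC 0 else wterm (tw psi t) s n) K -
      (Dser (tw psi t) s - Psum (wterm (tw psi t) s) N))%C => //.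
    have -> : Psum (fun n => if (n <= N)%N then RtoC 0 else wterm (tw psi t) s n) K =
       (Psum (wterm (tw psi t) s) K - Psum (wterm (tw psi t) s) N)%C.
      rewrite Psum_diff; last lia.
      rewrite /Psum (@Csum_split 1 N.+1 K.+1) //; last lia.
      rewrite [X in (X + _)%C]big1_seq ?Cplus_0_l.
        by apply: eq_big_nat => n Hn; case: ifP => //; lia.
      by move=> n; rewrite mem_index_iota => Hn; case: ifP => //; lia.
    by ring.
  apply: (csum_bound (N0 := N) H2) => K NK.
  rewrite /Psum (@Csum_split 1 N.+1 K.+1) //.
  rewrite [X in (X + _)%C]big1_seq ?Cplus_0_l; last first.
    by move=> n; rewrite mem_index_iota => Hn; case: ifP => //; lia.
  have := HC s t N.+1 K.+1 ltac:(lra) isT.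
  have -> : \Csum_(N.+1 <= n < K.+1) wterm (lnk 0 (tw (fun n0 : nat => RtoC (chi n0)) t)) s n =
     \Csum_(N.+1 <= n < K.+1) (if (n <= N)%N then RtoC 0 else wterm (tw psi t) s n).
    apply: eq_big_nat => n Hn; rewrite ifF; last by lia.
    by rewrite /wterm lnk0.
  move=> T; apply: (Rle_trans _ _ _ T); apply: (Rle_trans _ _ _ _ Ntail).
  apply: Rmult_le_compat; [by apply: Rmult_le_pos; lra | by left; exact: wt_pos | |].
    by apply: Rmult_le_compat_l; lra.
  rewrite /wt.
  have : - (1 / 2) * lnN N.+1 <= - (1 / 2) * lnN N by have := @lnN_le N N.+1 N1 (leqnSn N); lra.
  exact: exp_le_mono.
move: HH head tail; rewrite -Cmod_R.
set P := RtoC _; set P' := Psum _ N; set L := Dser _ _ => h1 h2 h3.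
have := Cmod_triangle L (- (L - P') + - (P' - P)).
have := Cmod_triangle (- (L - P')) (- (P' - P)).
rewrite !Cmod_opp (_ : (L + (- (L - P') + - (P' - P)))%C = P); last by ring.
lra.
Qed.

(** The third function is that of zeta, not that of psi^2: where psi vanishes, 3 + Re n^{-2it} is
    still positive, so no Euler factors have to be compared. *)
Lemma real_nonneg t n : 0 <= 3 + 4 * Re (tw psi t n) + Re (zit (2 * t) n).
Proof.
rewrite -zit_double; have z1 := Cmod_zit t n.
have := @nonneg_341 (tw psi t n); rewrite Cmod_tw => /(_ (zm_le1 chi_zm n)).
rewrite /tw /psi; move: z1 (Cmod_sqr (zit t n)) => ->.
case: (zit t n) => x y; case: (chi_val n) => [->|[->|->]] /=; try lra.
nra.
Qed.

Lemma cmult_zit t : cmult (zit t).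
Proof. by split; [exact: zit_1 | exact: zit_mul | move=> n; rewrite Cmod_zit; lra]. Qed.

(** Three regions: near (1, 0) the value L(1) decides; for small t with s > 1 + d, zeta is bounded
    and 3-4-1 applies directly; for |t| > d the pole of zeta is out of reach of 2t and
    [lower_of_341] applies. *)
Lemma L_lower_real :
  exists c, 0 < c /\ forall s t, 1 < s <= 2 -> c * (/ ell t) ^ 7 <= Cmod (Dser (tw psi t) s).
Proof.
have [c [d [c0 [d01 Hnear]]]] := real_lower_near.
have [C1 [C1p H1]] := L_bound 1 chi_zm.
(* [zeta_bound] at 2t is at most 5 (2 [ell t]) + 4/(2d). *)
pose C0 := 10 + 2 / d + C1.
have d2 : 0 < 2 / d by apply: Rdiv_lt_0_compat; lra.
have C01 : 1 <= C0 by rewrite /C0; lra.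
pose c1 := (/ (16 * C0 ^ 2)) ^ 3 / (16 * C0).
have c10 : 0 < c1.
  apply: Rdiv_lt_0_compat; last lra.
  by apply: pow_lt; apply: Rinv_0_lt_compat; nra.
(* The inverse of 1 + 1/d, the bound of zeta for s > 1 + d. It enters three times as zeta^3 and once
   through the series at 2t, so that |L|^4 >= c2^4. *)
pose c2 := d / (1 + d).
have c20 : 0 < c2 by apply: Rdiv_lt_0_compat; lra.
exists (Rmin c (Rmin c1 c2)); split; first by do 2! apply: Rmin_pos => //.
move=> s t s12; have e1 := ell_ge1 t.
have i7 : 0 <= (/ ell t) ^ 7 <= 1.
  have : 0 < / ell t by apply: Rinv_0_lt_compat; lra.
  have : / ell t <= 1 by rewrite -Rinv_1; apply: Rinv_le_contravar; lra.
  move=> h1 h2; split; first by apply: pow_le; lra.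
  by rewrite -(pow1 7); apply: pow_incr; lra.
have small x : 0 < x -> Rmin c (Rmin c1 c2) <= x -> Rmin c (Rmin c1 c2) * (/ ell t) ^ 7 <= x.
  move=> x0 Hx; apply: (Rle_trans _ (x * (/ ell t) ^ 7)).
    by apply: Rmult_le_compat_r; lra.
  nra.
have m1 := Rmin_l c (Rmin c1 c2); have m2 := Rmin_r c (Rmin c1 c2).
have m3 := Rmin_l c1 c2; have m4 := Rmin_r c1 c2.
have [td|td] := Rle_dec (Rabs t) d.
  have [sd|sd] := Rle_dec s (1 + d).
    by apply: (Rle_trans _ c); [apply: small | apply: Hnear; lra].
  apply: (Rle_trans _ c2); first by apply: small => //; lra.
  have s1 : 1 < s by lra.
  have T := @three_four_one (tw psi t) (zit (2 * t)) s (cmult_tw t cmult_real) (cmult_zit _) (fun n _ => real_nonneg t n) s1.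
  have Bz : Cmod (Dser (zit (2 * t)) s) <= 1 + 1 / (s - 1).
    apply: asum_bound => N; apply: Rle_trans (wt_sum N s1).
    by apply: Rsum_le => n _; rewrite Cmod_wterm Cmod_zit; lra.
  have Z : 1 + 1 / (s - 1) <= / c2.
    have -> : / c2 = 1 + 1 / d by rewrite /c2; field; lra.
    suff : 1 / (s - 1) <= 1 / d by lra.
    by apply: Rmult_le_compat_l; [lra | apply: Rinv_le_contravar; lra].
  have Zp : 0 <= 1 + 1 / (s - 1).
    by have : 0 < 1 / (s - 1); [apply: Rdiv_lt_0_compat; lra | lra].
  have A0 : 0 <= Cmod (Dser (tw psi t) s) ^ 4 by apply: pow_le; exact: Cmod_ge_0.
  apply: pow4_le_inv; [lra | exact: Cmod_ge_0 |].
  have T2 : 1 <= (/ c2) ^ 3 * Cmod (Dser (tw psi t) s) ^ 4 * / c2.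
    apply: (Rle_trans _ _ _ T); apply: Rmult_le_compat => //; try exact: Cmod_ge_0.
    - by apply: Rmult_le_pos => //; apply: pow_le.
    - by apply: Rmult_le_compat_r => //; apply: pow_incr.
    - lra.
  have c4 : 0 < c2 ^ 4 by apply: pow_lt.
  have := Rmult_le_compat_l _ _ _ (Rlt_le _ _ c4) T2.
  rewrite (_ : c2 ^ 4 * ((/ c2) ^ 3 * Cmod (Dser (tw psi t) s) ^ 4 * / c2) = Cmod (Dser (tw psi t) s) ^ 4); last by field; lra.
  lra.
apply: (Rle_trans _ (c1 * (/ ell t) ^ 7)).
  by apply: Rmult_le_compat_r; lra.
have tnz : 2 * t <> 0 by move=> E; apply: td; rewrite (_ : t = 0) ?Rabs_R0; lra.
have t0 : d < Rabs t by lra.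
apply: (@lower_of_341 (tw psi t) (zit (2 * t)) C0) => //.
- exact: cmult_tw cmult_real.
- exact: cmult_zit.
- by move=> n _; exact: real_nonneg.
- move=> r r12; apply: (Rle_trans _ _ _ (@zeta_bound r (2 * t) r12 tnz)).
  have E := ell_double t.
  have : 4 / Rabs (2 * t) <= 2 / d.
    rewrite Rabs_mult (Rabs_pos_eq 2); last lra.
    have -> : 4 / (2 * Rabs t) = 2 / Rabs t by field; lra.
    by apply: Rmult_le_compat_l; [lra | apply: Rinv_le_contravar; lra].
  rewrite /C0; nra.
- move=> r r12; apply: (Rle_trans _ _ _ (H1 r t r12)).
  by apply: Rmult_le_compat_r; [apply: pow_le; lra | rewrite /C0; lra].
Qed.
End RealLower.

(** * Derivatives of logarithmic derivatives *)

(** The bound is uniform as s tends to 1, which is what takes the place of values on the line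
    itself. Such functions form an algebra, so bounds pass through the Leibniz rule mechanically. *)
Definition polylog_bounded (f : R -> R -> C) : Prop := exists C0 m, 0 <= C0 /\
  forall s t, 1 < s <= 2 -> Cmod (f s t) <= C0 * ell t ^ m.

Lemma polylog_ext f g : (forall s t, 1 < s <= 2 -> f s t = g s t) -> polylog_bounded f -> polylog_bounded g.
Proof.
by move=> fg [C0 [m [Cp H]]]; exists C0, m; split=> // s t st; rewrite -fg //; apply: H.
Qed.

Lemma polylog_plus f g : polylog_bounded f -> polylog_bounded g -> polylog_bounded (fun s t => f s t + g s t)%C.
Proof.
move=> [C1 [m1 [C1p H1]]] [C2 [m2 [C2p H2]]]; exists (C1 + C2), (maxn m1 m2); split; first lra.
move=> s t st; apply: Rle_trans (Cmod_triangle _ _) _.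
have e1 := @ell_pow_le m1 (maxn m1 m2) t (leq_maxl _ _).
have e2 := @ell_pow_le m2 (maxn m1 m2) t (leq_maxr _ _).
have := Rmult_le_compat_l _ _ _ C1p e1; have := Rmult_le_compat_l _ _ _ C2p e2.
have := H1 s t st; have := H2 s t st; lra.
Qed.

Lemma polylog_mult f g : polylog_bounded f -> polylog_bounded g -> polylog_bounded (fun s t => f s t * g s t)%C.
Proof.
move=> [C1 [m1 [C1p H1]]] [C2 [m2 [C2p H2]]]; exists (C1 * C2), (m1 + m2)%N; split; first nra.
move=> s t st; rewrite Cmod_mult -[(m1 + m2)%N]/(Nat.add m1 m2) pow_add.
rewrite (_ : C1 * C2 * (ell t ^ m1 * ell t ^ m2) = (C1 * ell t ^ m1) * (C2 * ell t ^ m2)); last by ring.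
by apply: Rmult_le_compat; try exact: Cmod_ge_0; [apply: H1 | apply: H2].
Qed.

Lemma polylog_const (c : C) : polylog_bounded (fun _ _ => c).
Proof. by exists (Cmod c), 0%N; split; [exact: Cmod_ge_0 | move=> s t _ /=; lra]. Qed.

Lemma polylog_opp f : polylog_bounded f -> polylog_bounded (fun s t => - f s t)%C.
Proof.
by move=> [C0 [m [Cp H]]]; exists C0, m; split=> // s t st; rewrite Cmod_opp; apply: H.
Qed.

(* The value of the m-th derivative of a product, given all derivatives of both factors. *)
Fixpoint leib (A B : nat -> C) (m i j : nat) : C :=
  match m with
  | 0%N => (A i * B j)%C
  | m.+1 => (leib A B m i.+1 j + leib A B m i j.+1)%C
  end.

(** Since log n = log d + log (n/d), multiplication by log n is a derivation for the convolution. *)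
Lemma conv_lnk a b i j n : (0 < n)%N ->
  (conv (lnk i a) (lnk j b) n * RtoC (lnN n))%C =
  (conv (lnk i.+1 a) (lnk j b) n + conv (lnk i a) (lnk j.+1 b) n)%C.
Proof.
move=> n0; rewrite /conv big_distrl /= -big_split /=.
rewrite big_seq_cond [RHS]big_seq_cond; apply: eq_bigr => d /andP[].
rewrite mem_index_iota => /andP[d0 _] /dvdnP [e E].
rewrite {}E mulnK // in n0 *.
have e0 : (0 < e)%N by move: n0; rewrite muln_gt0 => /andP[].
rewrite lnN_mul // /lnk -[lnN d ^ i.+1]/(lnN d * lnN d ^ i) -[lnN e ^ j.+1]/(lnN e * lnN e ^ j).
by rewrite !RtoC_plus !RtoC_mult; ring.
Qed.

Lemma lnkS m c n : lnk m.+1 c n = (c n * RtoC (lnN n) * RtoC (lnN n ^ m))%C.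
Proof. by rewrite /lnk -[lnN n ^ m.+1]/(lnN n * lnN n ^ m) RtoC_mult; ring. Qed.

Lemma csum_leib ka kb a b s m i j : adm ka a -> adm kb b -> 1 < s ->
  is_csum (wterm (lnk m (conv (lnk i a) (lnk j b))) s)
    (leib (fun k => Dser (lnk k a) s) (fun k => Dser (lnk k b) s) m i j).
Proof.
move=> aa ab s1; elim: m i j => [|m IH] i j /=.
  apply: csum_ext (csum_conv (adm_asum (adm_lnk i aa) s1) (adm_asum (adm_lnk j ab) s1)) => n n0.
  rewrite [RHS]/wterm lnk0 /conv big_distrl /=.
  rewrite big_seq_cond [RHS]big_seq_cond; apply: eq_bigr => d /andP[].
  rewrite mem_index_iota => /andP[d0 _] /dvdnP [e E].
  rewrite {}E mulnK // in n0 *.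
  have e0 : (0 < e)%N by move: n0; rewrite muln_gt0 => /andP[].
  by rewrite /wterm wt_mul // RtoC_mult; ring.
apply: csum_ext (csum_plus (IH i.+1 j) (IH i j.+1)) => n n0.
rewrite [RHS]/wterm lnkS conv_lnk // /wterm.
by rewrite -![lnk m _ n]/(_ * _)%C; ring.
Qed.

Lemma Dser_leib ka kb a b c s m : adm ka a -> adm kb b -> 1 < s ->
  (forall n, (0 < n)%N -> c n = conv a b n) ->
  Dser (lnk m c) s = leib (fun k => Dser (lnk k a) s) (fun k => Dser (lnk k b) s) m 0 0.
Proof.
move=> aa ab s1 H; apply: csum_unique.
apply: csum_ext (csum_leib m 0 0 aa ab s1) => n n0.
have E : conv (lnk 0 a) (lnk 0 b) n = conv a b n.
  by rewrite /conv; apply: eq_bigr => d _; rewrite !lnk0.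
by rewrite /wterm -![lnk m _ n]/(_ * _)%C E H.
Qed.

(** Only one term of the Leibniz sum contains A at the top order i + m. With the other terms
    bounded, an identity for the sum can be solved for that term. *)
Lemma polylog_leib_top (A B : nat -> R -> R -> C) m i j :
  (forall k, (k < i + m)%N -> polylog_bounded (A k)) -> (forall k, polylog_bounded (B k)) ->
  polylog_bounded (fun s t => leib (fun k => A k s t) (fun k => B k s t) m i j - A (i + m)%N s t * B j s t)%C.
Proof.
elim: m i j => [|m IH] i j HA HB /=.
  apply: polylog_ext (polylog_const (RtoC 0)) => s t _; rewrite addn0; ring.
have H1 := IH i.+1 j ltac:(move=> k Hk; apply: HA; lia) HB.
have H2 := IH i j.+1 ltac:(move=> k Hk; apply: HA; lia) HB.
have H3 := polylog_mult (HA (i + m)%N ltac:(lia)) (HB j.+1).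
apply: polylog_ext (polylog_plus (polylog_plus H1 H2) H3) => s t _.
by rewrite addSnnS; ring.
Qed.

Record good_char (psi : nat -> C) : Prop := GoodChar {
  gc_mult : cmult psi;
  gc_zm : exists M, zero_mean M psi;
  gc_lower : exists c, 0 < c /\
    forall s t, 1 < s <= 2 -> c * (/ ell t) ^ 7 <= Cmod (Dser (tw psi t) s) }.

Lemma polylog_L psi k : good_char psi -> polylog_bounded (fun s t => Dser (lnk k (tw psi t)) s).
Proof.
move=> [_ [M zm] _]; have [C0 [Cp H]] := L_bound k zm.
by exists C0, k.+1.
Qed.

Lemma polylog_Linv psi : good_char psi -> polylog_bounded (fun s t => / Dser (tw psi t) s)%C /\
  forall s t, 1 < s <= 2 -> Dser (tw psi t) s <> RtoC 0.
Proof.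
move=> [_ _ [c [c0 H]]].
have pos s t : 1 < s <= 2 -> 0 < c * (/ ell t) ^ 7.
  move=> _; have e1 := ell_ge1 t; apply: Rmult_lt_0_compat => //.
  by apply: pow_lt; apply: Rinv_0_lt_compat; lra.
have nz s t : 1 < s <= 2 -> Dser (tw psi t) s <> RtoC 0.
  move=> st E; have := H s t st; have := pos s t st; rewrite E Cmod_0; lra.
split=> //; exists (/ c), 7%N; split; first by left; apply: Rinv_0_lt_compat.
move=> s t st; rewrite Cmod_inv; last exact: nz.
have e1 := ell_ge1 t.
have -> : / c * ell t ^ 7 = / (c * (/ ell t) ^ 7) by field; lra.
by apply: Rinv_le_contravar; [exact: pos s t st | exact: H].
Qed.

(* The Leibniz rule for L' = Lambda L expresses L^(k+1) through L Lambda^(k) and lower derivatives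
   of Lambda; divide by L. *)
Lemma polylog_Lam psi k : good_char psi -> polylog_bounded (fun s t => Dser (lnk k (Lam (tw psi t))) s).
Proof.
move=> gc; have [k'] := ubnP k; elim: k' k => // k' IH k kk.
have [PI nz] := polylog_Linv gc.
pose A k s t := Dser (lnk k (Lam (tw psi t))) s.
pose B k s t := Dser (lnk k (tw psi t)) s.
have H := @polylog_leib_top A B k 0 0 ltac:(move=> j Hj; apply: IH; lia) (fun j => polylog_L j gc).
have H2 := polylog_mult (polylog_plus (polylog_L k.+1 gc) (polylog_opp H)) PI.
apply: polylog_ext H2 => s t st; rewrite /A /B.
have ct := cmult_tw t (gc_mult gc).
have E := @Dser_leib 1 0 (Lam (tw psi t)) (tw psi t) (lnk 1 (tw psi t)) s k
  (adm_Lam ct) (adm_cmult ct) ltac:(lra) (fun n n0 => cmult_conv_Lam ct n0).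
have -> : Dser (lnk k.+1 (tw psi t)) s = Dser (lnk k (lnk 1 (tw psi t))) s.
  by apply: Dser_ext => n _; rewrite lnk_lnk addn1.
rewrite E add0n (@Dser_ext (lnk 0 (tw psi t)) (tw psi t)); last by move=> n _; rewrite lnk0.
by field; exact: nz.
Qed.

(* The trivial bound O(1/(s-1)) for the series itself propagates to all its derivatives. *)
Lemma polylog_conv_growth (a b : R -> nat -> C) :
  (forall t, adm 1 (a t)) -> (forall t, adm 0 (b t)) ->
  (forall t n, (0 < n)%N -> lnk 1 (b t) n = conv (a t) (b t) n) ->
  (forall k, polylog_bounded (fun s t => Dser (lnk k (a t)) s)) ->
  forall k, polylog_bounded (fun s t => RtoC (s - 1) * Dser (lnk k (b t)) s)%C.
Proof.
move=> aa ab Hc HA k; have [k'] := ubnP k; elim: k' k => // k' IH [|k] kk.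
  exists 2, 0%N; split; first lra.
  move=> s t st; rewrite pow_O Rmult_1_r Cmod_mult Cmod_R Rabs_pos_eq; last lra.
  have Bd : Cmod (Dser (lnk 0 (b t)) s) <= 1 + 1 / (s - 1).
    apply: asum_bound => N; apply: Rle_trans (@wt_sum s N _); last lra.
    apply: Rsum_le_nat => n /andP[n0 _]; rewrite Cmod_wterm lnk0.
    by have := ab t n n0; have := wt_pos s n; rewrite /=; nra.
  apply: (Rle_trans _ ((s - 1) * (1 + 1 / (s - 1)))).
    by apply: Rmult_le_compat_l => //; lra.
  have -> : (s - 1) * (1 + 1 / (s - 1)) = s by field; lra.
  lra.
pose A k s t := Dser (lnk k (a t)) s; pose B k s t := Dser (lnk k (b t)) s.
(* One derivative is spent on F' = A F, so order k + 1 of F involves F up to order k only, where the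
   induction hypothesis is available. *)
have key m i j : (j + m < k.+1)%N ->
   polylog_bounded (fun s t => RtoC (s - 1) * leib (fun k => A k s t) (fun k => B k s t) m i j)%C.
  elim: m i j => [|m IHm] i j Hj /=.
    have H := polylog_mult (HA i) (IH j ltac:(lia)).
    by apply: polylog_ext H => s t _; rewrite /A /B; ring.
  apply: polylog_ext (polylog_plus (IHm i.+1 j ltac:(lia)) (IHm i j.+1 ltac:(lia))) => s t _.
  ring.
apply: polylog_ext (key k 0%N 0%N ltac:(lia)) => s t st; congr Cmult.
rewrite /A /B -(@Dser_leib 1 0 (a t) (b t) (lnk 1 (b t)) s k (aa t) (ab t) ltac:(lra) (Hc t)).
by apply: Dser_ext => n _; rewrite lnk_lnk addn1.
Qed.

(** * Sums of two squares *)

Lemma prime_natZ (p : nat) : prime p <-> Znumtheory.prime (Z.of_nat p).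
Proof.
rewrite -prime_alt; split.
  move=> pp; have p1 := prime_gt1 pp; split; first lia.
  move=> n n1 [k Hk].
  have k0 : (0 < k)%Z by nia.
  have : (Z.to_nat n %| p)%N.
    apply/dvdnP; exists (Z.to_nat k); apply: Nat2Z.inj.
    rewrite -[(_ * _)%N]/(Nat.mul _ _) Nat2Z.inj_mul !Z2Nat.id; lia.
  case/primeP: pp => _ H /H /orP[/eqP|/eqP]; lia.
move=> [p1 H]; apply/primeP; split; first lia.
move=> d /dvdnP [k Hk]; apply/orP.
have [E|dn] := eqVneq d 1%N; first by left; apply/eqP.
have [E|dp] := eqVneq d p; first by right; apply/eqP.
exfalso; apply: (H (Z.of_nat d)).
  have : (0 < d)%N by case: (d) Hk p1 => // ; rewrite muln0 => ->; lia.
  have : (0 < k)%N by case: (k) Hk p1 => // ; rewrite mul0n => ->; lia.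
  nia.
exists (Z.of_nat k); rewrite Hk -[(_ * _)%N]/(Nat.mul _ _) Nat2Z.inj_mul; lia.
Qed.

Lemma inE_mul m n : inE m -> inE n -> inE (m * n).
Proof.
move=> [a [b H1]] [c [d H2]]; exists (a * c + b * d)%Z, (a * d - b * c)%Z.
by rewrite -[(_ * _)%N]/(Nat.mul _ _) Nat2Z.inj_mul H1 H2; ring.
Qed.

Lemma inE_sqr k : inE (k * k).
Proof. exists (Z.of_nat k), 0%Z; rewrite -[(_ * _)%N]/(Nat.mul _ _) Nat2Z.inj_mul; ring. Qed.

(** Descent: p divides one of ac + bd and ac - bd. By the product identity for sums of two squares
    it then divides the companion term as well, and p^2 can be cancelled. *)
Lemma inE_div_prime p m : prime p -> inE p -> inE (p * m) -> inE m.
Proof.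
move=> pp [a [b Hp]] [c [d Hpm]].
have Zp := proj1 (prime_natZ p) pp.
have p1 := prime_gt1 pp.
move: Hpm; rewrite -[(_ * _)%N]/(Nat.mul _ _) Nat2Z.inj_mul => Hpm.
set P := Z.of_nat p in Hp Hpm Zp; have P0 : (0 < P)%Z by rewrite /P; lia.
have key x y : (x * x + y * y = P * (P * Z.of_nat m))%Z -> (P | x)%Z -> inE m.
  move=> E [u Hu].
  have [v Hv] : (P | y)%Z.
    have : (P | y * y)%Z.
      exists (P * Z.of_nat m * 1 - u * u * P)%Z; rewrite Hu in E; lia.
    by move=> /(prime_mult _ Zp) [].
  exists u, v; rewrite Hu Hv in E; nia.
have : (P | (a * c + b * d) * (a * c - b * d))%Z.
  exists (a * a * Z.of_nat m - d * d)%Z.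
  rewrite Z.mul_sub_distr_r.
  have -> : (a * a * Z.of_nat m * P = a * a * (c * c + d * d))%Z by rewrite -Hpm; ring.
  by rewrite Hp; ring.
move=> /(prime_mult _ Zp) [H|H].
  by apply: (key _ (a * d - b * c)%Z _ H); rewrite Hpm Hp; ring.
by apply: (key _ (a * d + b * c)%Z _ H); rewrite Hpm Hp; ring.
Qed.

(** z = g^((p-1)/4): its square g^((p-1)/2) has square 1 without being 1, hence is -1. *)
Lemma sqr_neg1 p : prime p -> (p %% 4 = 1)%N -> exists z, (p %| z ^ 2 + 1)%N.
Proof.
move=> pp p4; have p1 := prime_gt1 pp.
have [g [_ Hord]] := primitive_root pp.
pose k := (p %/ 4)%N.
have pE : p.-1 = (4 * k)%N by rewrite /k; lia.
have k0 : (0 < k)%N by rewrite /k; lia.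
exists (g ^ k)%N; rewrite -expnM mulnC; set x := (g ^ (2 * k))%N.
have x2 : (x ^ 2 = 1 %[mod p])%N.
  by rewrite /x -expnM; apply/Hord; rewrite pE (_ : (2 * k * 2 = 4 * k)%N) //; lia.
have x1 : ~ (x = 1 %[mod p])%N.
  by move/Hord; rewrite pE => /dvdn_leq; lia.
have x0 : (0 < x)%N.
  by rewrite lt0n; apply/eqP => E; move: x2; rewrite E /= mod0n modn_small.
have : (p %| (x - 1) * (x + 1))%N.
  rewrite -subn_sqr; move/eqP: x2; rewrite eqn_mod_dvd //; lia.
rewrite Euclid_dvdM // => /orP[|//] H; exfalso; apply: x1; apply/eqP.
by rewrite eqn_mod_dvd.
Qed.

Lemma Zsqr_le_of_abs (x y : Z) : (- y <= x <= y)%Z -> (x * x <= y * y)%Z.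
Proof. nia. Qed.

Lemma Zsumsq_pos (x y : Z) : x <> 0%Z \/ y <> 0%Z -> (0 < x * x + y * y)%Z.
Proof. by case=> H; nia. Qed.

Lemma Zmul_lt_2_eq1 (k x : Z) : (0 < x)%Z -> (0 < k * x < 2 * x)%Z -> k = 1%Z.
Proof. nia. Qed.

(** Thue's pigeonhole: there are more than p pairs (u, v) with entries at most r, the integer part
    of sqrt p. So two of them agree in u + z v mod p, and their differences satisfy p | X^2 + Y^2
    with 0 < X^2 + Y^2 < 2p. *)
Lemma inE_prime_1mod4 p : prime p -> (p %% 4 = 1)%N -> inE p.
Proof.
move=> pp p4; have p1 := prime_gt1 pp.
have [z Hz] := sqr_neg1 pp p4.
have [rl ru] := Nat.sqrt_spec p (Nat.le_0_l _); set r := Nat.sqrt p in rl ru.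
pose f (uv : 'I_r.+1 * 'I_r.+1) : 'I_p :=
  Ordinal (ltn_pmod (uv.1 + z * uv.2) (prime_gt0 pp)).
have nf : ~ injective f.
  move=> /leq_card; rewrite card_prod !card_ord; move: ru; lia.
have [[u v] [[u' v'] [ne E]]] : exists a b, a <> b /\ f a = f b.
  apply: NNPP => H; apply: nf => a b E; apply: NNPP => ne; apply: H.
  by exists a, b.
have {}E : (u + z * v = u' + z * v' %[mod p])%N by move/(congr1 val): E.
pose X := (Z.of_nat u - Z.of_nat u')%Z; pose Y := (Z.of_nat v - Z.of_nat v')%Z.
pose P := Z.of_nat p; pose zz := Z.of_nat z.
have H1 : (P | X + zz * Y)%Z.
  exists (Z.of_nat ((u + z * v) %/ p) - Z.of_nat ((u' + z * v') %/ p))%Z.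
  have := divn_eq (u + z * v) p; have := divn_eq (u' + z * v') p; rewrite E.
  rewrite /X /Y /P /zz; lia.
have H2 : (P | zz * zz + 1)%Z.
  move/dvdnP: Hz => [k Hk]; exists (Z.of_nat k); rewrite /P /zz.
  by move: Hk; rewrite -mulnn; lia.
have H3 : (P | X * X + Y * Y)%Z.
  have -> : (X * X + Y * Y = (X + zz * Y) * (X - zz * Y) + (zz * zz + 1) * (Y * Y))%Z by ring.
  by apply: Z.divide_add_r; apply: Z.divide_mul_l.
have ul := ltn_ord u; have ul' := ltn_ord u'; have vl := ltn_ord v; have vl' := ltn_ord v'.
(* A prime is not a square, whence the strict inequality X^2 + Y^2 < 2p. *)
have r2p : (r * r < p)%coq_nat.
  suff : (r * r)%coq_nat <> p by lia.
  move=> Er; have : (r %| p)%N by apply/dvdnP; exists r; rewrite -{1}Er.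
  have /primeP [_ Hd] := pp; move=> /Hd /orP[/eqP|/eqP] Er2; move: Er p1; rewrite Er2; clear; nia.
have XY0 : (0 < X * X + Y * Y)%Z.
  suff : X <> 0%Z \/ Y <> 0%Z by exact: Zsumsq_pos.
  apply: NNPP => H; apply: ne.
  have eu : u = u' by apply: val_inj => /=; rewrite /X in H; lia.
  have ev : v = v' by apply: val_inj => /=; rewrite /Y in H; lia.
  by rewrite eu ev.
have XYp : (X * X + Y * Y < 2 * P)%Z.
  have hX : (X * X <= Z.of_nat r * Z.of_nat r)%Z by apply: Zsqr_le_of_abs; rewrite /X; lia.
  have hY : (Y * Y <= Z.of_nat r * Z.of_nat r)%Z by apply: Zsqr_le_of_abs; rewrite /Y; lia.
  rewrite /P; lia.
exists X, Y; case: H3 => k Hk; rewrite -/P.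
have : k = 1%Z by apply: (@Zmul_lt_2_eq1 k P); rewrite -?Hk //; rewrite /P; lia.
by move=> E1; rewrite Hk E1; ring.
Qed.

Lemma inE_2 : inE 2.
Proof. by exists 1%Z, 1%Z. Qed.

Lemma dvdn_odd_pow_sum p x y k : (p %| x + y)%N -> odd k -> (p %| x ^ k + y ^ k)%N.
Proof.
move=> H ok; have -> : k = k./2.*2.+1 by rewrite -{1}(odd_double_half k) ok.
elim: k./2 => [|j IH]; first by rewrite !expn1.
rewrite doubleS; set m := j.*2.+1 in IH *.
have E : ((x ^ m.+2 + y ^ m.+2) + x * y * (x ^ m + y ^ m) = (x + y) * (x ^ m.+1 + y ^ m.+1))%N.
  by rewrite !expnS; move: (x ^ j.*2)%N (y ^ j.*2)%N => u v; lia.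
have : (p %| (x ^ m.+2 + y ^ m.+2) + x * y * (x ^ m + y ^ m))%N by rewrite E dvdn_mulr.
by rewrite dvdn_addl // dvdn_mull.
Qed.

Lemma fermat_unit p c : prime p -> ~~ (p %| c)%N -> (c ^ p.-1 = 1 %[mod p])%N.
Proof.
move=> pp pc; have c0 : (0 < c)%N by case: (c) pc; rewrite ?dvdn0.
have := fermat_little c pp; rewrite -{1}(prednK (prime_gt0 pp)) expnS => /eqP.
rewrite eqn_mod_dvd; last by rewrite -{1}(muln1 c) leq_mul2l expn_gt0 c0 orbT.
rewrite -[X in (_ - X)%N](muln1 c) -mulnBr Euclid_dvdM // (negbTE pc) /= => Hd.
by apply/eqP; rewrite eqn_mod_dvd // expn_gt0 c0.
Qed.

(** Raising a^2 = -b^2 to the odd power (p-1)/2 gives a^(p-1) + b^(p-1) = 0 mod p. If p did not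
    divide a, Fermat would turn this into p | 2. *)
Lemma dvdn_sumsq p a b : prime p -> (p %% 4 = 3)%N -> (p %| a ^ 2 + b ^ 2)%N -> (p %| a)%N.
Proof.
move=> pp p4 H; apply/negPn/negP => pa; have p1 := prime_gt1 pp.
have pb : ~~ (p %| b)%N.
  apply/negP => pb; move: H; rewrite dvdn_addl; last by rewrite dvdn_exp.
  by rewrite Euclid_dvdX // => /andP[/(negP pa)].
have oh : odd (p.-1)./2 by rewrite (divn_eq p 4) p4; lia.
have := dvdn_odd_pow_sum H oh; rewrite -!expnM.
have -> : (2 * (p.-1)./2 = p.-1)%N by lia.
move=> Hd; have : (p %| 1 + 1)%N.
  by move: Hd; rewrite /dvdn -modnDm !fermat_unit // modnDm.
move/dvdn_leq => /(_ isT) p2; have E : p = 2%N by move: p1 p2; clear; lia.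
by rewrite E in p4.
Qed.

Lemma inE_3mod4 p n : prime p -> (p %% 4 = 3)%N -> (p %| n)%N -> inE n ->
  exists m, n = (p * p * m)%N /\ inE m.
Proof.
move=> pp p4 pn [a [b H]].
have E : n = ((Z.abs_nat a) ^ 2 + (Z.abs_nat b) ^ 2)%N.
  by rewrite -!mulnn; apply: Nat2Z.inj; rewrite H; lia.
have pa : (p %| Z.abs_nat a)%N by apply: (@dvdn_sumsq _ _ (Z.abs_nat b)) => //; rewrite -E.
have pb : (p %| Z.abs_nat b)%N.
  by apply: (@dvdn_sumsq _ _ (Z.abs_nat a)) => //; rewrite addnC -E.
move/dvdnP: pa => [u Hu]; move/dvdnP: pb => [v Hv].
exists (u ^ 2 + v ^ 2)%N; split.
  by rewrite E Hu Hv !expnMn -!mulnn; lia.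
exists (Z.of_nat u), (Z.of_nat v); rewrite -!mulnn; lia.
Qed.

Lemma inE_sq_3mod4 p m : prime p -> (p %% 4 = 3)%N -> inE (p * p * m) -> inE m.
Proof.
move=> pp p4 H; have [|m' [E Hm]] := inE_3mod4 pp p4 _ H.
  by rewrite -mulnA dvdn_mulr.
have p0 := prime_gt0 pp; suff -> : m = m' by [].
by apply/eqP; rewrite -(@eqn_pmul2l (p * p)) ?muln_gt0 ?p0 // E.
Qed.

Lemma inE_even_logn p n : prime p -> (p %% 4 = 3)%N -> (0 < n)%N -> inE n -> ~~ odd (logn p n).
Proof.
move=> pp p4; have [k] := ubnP n; elim: k n => // k IH n nk n0 Hn.
have p1 := prime_gt1 pp.
case: (boolP (p %| n)%N) => [pn|pn]; last by rewrite lognE (negbTE pn) !andbF.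
have [m [E Hm]] := inE_3mod4 pp p4 pn Hn.
have m0 : (0 < m)%N by move: n0; rewrite E muln_gt0 => /andP[].
have pp0 : (0 < p * p)%N by rewrite muln_gt0 (prime_gt0 pp).
rewrite E lognM // oddD (negbTE (IH m _ m0 Hm)) ?addbF; last by rewrite E in nk; nia.
by rewrite mulnn pfactorK.
Qed.

Definition indE (n : nat) : R := if excluded_middle_informative (inE n) then 1 else 0.

Lemma indE_eq m n : (inE m <-> inE n) -> indE m = indE n.
Proof.
by move=> H; rewrite /indE; case: excluded_middle_informative => Hm;
  case: excluded_middle_informative => Hn //; exfalso; tauto.
Qed.

Lemma indE_01 n : 0 <= indE n <= 1.
Proof. by rewrite /indE; case: excluded_middle_informative => H /=; lra. Qed.

(* [vonM d * ewt d] are the coefficients of -F'/F for F(s) the Dirichlet series of [indE]. *)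
Definition ewt (d : nat) : R :=
  if (pdiv d %% 4 == 3)%N then if odd (logn (pdiv d) d) then 0 else 2 else 1.

Lemma ewt_pfactor p j : prime p -> (0 < j)%N ->
  ewt (p ^ j) = if (p %% 4 == 3)%N then if odd j then 0 else 2 else 1.
Proof. by case: j => // j pp _; rewrite /ewt pdiv_pfactor // pfactorK. Qed.

Lemma inE_good_prime p : prime p -> (p %% 4 != 3)%N -> inE p.
Proof.
move=> pp p4; have [E|p2] := eqVneq p 2%N; first by rewrite E; exact: inE_2.
apply: inE_prime_1mod4 => //; have [E|op] := even_prime pp; first by rewrite E in p2.
have : (p %% 4 < 4)%N by rewrite ltn_mod.
move/eqP: p4; have := divn_eq p 4; lia.
Qed.

Lemma inE_pow_good p j m : prime p -> (p %% 4 != 3)%N -> inE (p ^ j * m) <-> inE m.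
Proof.
move=> pp p4; have Ep := inE_good_prime pp p4.
elim: j => [|j IH]; first by rewrite mul1n.
rewrite -IH expnS -mulnA; split; first exact: inE_div_prime.
exact: inE_mul.
Qed.

Lemma inE_pow_bad p j m : prime p -> (p %% 4 = 3)%N -> ~~ odd j -> inE (p ^ j * m) <-> inE m.
Proof.
move=> pp p4 oj; have -> : j = (j./2).*2 by rewrite -{1}(odd_double_half j) (negbTE oj).
elim: (j./2) => [|i IH]; first by rewrite mul1n.
rewrite -IH doubleS !expnS -!mulnA [X in inE X](_ : _ = (p * p * (p ^ i.*2 * m))%N); last by rewrite !mulnA.
by split; [exact: inE_sq_3mod4 | move=> H; apply: inE_mul H; exact: inE_sqr].
Qed.

(** Coefficient form of -F' = (-F'/F) F. Whenever d has a nonzero weight, n/d is a sum of two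
    squares exactly when n is, so [indE n] factors out. The weights then sum to log n: for p = 3 mod
    4 the exponent of p in n is even and each even j counts twice. *)
Lemma indE_conv n : (0 < n)%N ->
  \Rsum_(1 <= d < n.+1 | (d %| n)%N) (vonM d * ewt d * indE (n %/ d)%N) = indE n * lnN n.
Proof.
move=> n0.
transitivity (indE n * \Rsum_(1 <= d < n.+1 | (d %| n)%N) (vonM d * ewt d)).
  rewrite big_distrr /=; apply: eq_bigr => d dn.
  rewrite {1 2}/vonM; case: ifP => [/ppowP [p [j [pp j0 E]]]|_]; last by ring.
  rewrite E ewt_pfactor //; move/dvdnP: dn => [e En].
  rewrite En E mulnK ?expn_gt0 ?(prime_gt0 pp) //.
  case: ifP => p4; last first.
    rewrite (@indE_eq (e * p ^ j) e); first by ring.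
    by rewrite mulnC; apply: inE_pow_good => //; rewrite p4.
  case: (boolP (odd j)) => oj; first by ring.
  rewrite (@indE_eq (e * p ^ j) e); first by ring.
  by rewrite mulnC; apply: inE_pow_bad => //; apply/eqP.
rewrite /indE; case: excluded_middle_informative => Hn /=; last by ring.
rewrite !Rmult_1_l sum_vonM // lnN_primes // big_seq [RHS]big_seq.
apply: eq_bigr => p; rewrite mem_primes => /and3P[pp _ pn].
rewrite -big_distrr /= Rmult_comm; congr Rmult.
rewrite (@eq_big_nat _ _ _ _ _ _ (fun j => if (p %% 4 == 3)%N then if odd j then 0 else 2 else 1)); last first.
  by move=> j /andP[j0 _]; rewrite ewt_pfactor.
case: (boolP (p %% 4 == 3)%N) => [/eqP p4|_]; last by rewrite Rsum_const_nat // subn1 /=; ring.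
have ev := inE_even_logn pp p4 n0 Hn.
have -> : logn p n = ((logn p n)./2).*2 by rewrite -{1}(odd_double_half (logn p n)) (negbTE ev).
elim: ((logn p n)./2) => [|i IH]; first by rewrite big_geq // INR_0.
rewrite doubleS big_nat_recr // big_nat_recr //= IH odd_double /= !S_INR; ring.
Qed.

(** * The Dirichlet series of a twisted indicator *)

Definition chi4 (n : nat) : R :=
  if (n %% 4 == 1)%N then 1 else if (n %% 4 == 3)%N then -1 else 0.

Lemma chi4_mod n : chi4 (n %% 4) = chi4 n.
Proof. by rewrite /chi4 modn_mod. Qed.

Lemma chi4_val n : chi4 n = 1 \/ chi4 n = 0 \/ chi4 n = -1.
Proof. by rewrite /chi4; case: ifP => _; [left | case: ifP => _; auto]. Qed.

Lemma chi4M m n : chi4 (m * n) = chi4 m * chi4 n.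
Proof.
rewrite -chi4_mod -(chi4_mod m) -(chi4_mod n) -modnMm.
move: (m %% 4) (n %% 4) (ltn_pmod m (isT : 0 < 4)%N) (ltn_pmod n (isT : 0 < 4)%N).
by move=> [|[|[|[|?]]]] [|[|[|[|?]]]] // _ _; rewrite /chi4 /=; ring.
Qed.

(** What remains of -F'/F after removing half of -L'/L for the principal character and for chi_4. It
    lives on powers of 2 and on even powers of primes 3 mod 4, hence on squares and doubled
    squares. *)
Definition rE (n : nat) : R := vonM n * (ewt n - (1 + chi4 n) / 2).

Definition sq_or_2sq (n : nat) : Prop := exists m, n = (m * m)%N \/ n = (2 * (m * m))%N.

Lemma rE_spec n : rE n = 0 \/ sq_or_2sq n /\ Rabs (rE n) <= lnN n.
Proof.
rewrite /rE; case: (boolP (ppow n)) => [Hp|/negbTE E]; last by left; rewrite /vonM E; ring.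
have [p [j [pp j0 E]]] := ppowP Hp.
have V0 := vonM_ge0 n; have V := vonM_le n.
have chi4X : chi4 n = chi4 p ^ j.
  rewrite E; elim: (j) => [|i IH]; first by rewrite expn0.
  by rewrite expnS chi4M IH.
have sq : ~~ odd j -> sq_or_2sq n.
  move=> oj; exists (p ^ j./2)%N; left; rewrite E -expnD; congr expn.
  by rewrite addnn -{1}(odd_double_half j) (negbTE oj).
have bd c : -1 <= c <= 1 -> Rabs (vonM n * c) <= lnN n.
  move=> Hc; rewrite Rabs_mult (Rabs_pos_eq _ V0).
  have : Rabs c <= 1 by apply: Rabs_le; lra.
  by have := Rabs_pos c; nra.
have EW : ewt n = if (p %% 4 == 3)%N then if odd j then 0 else 2 else 1.
  by rewrite E ewt_pfactor.
rewrite EW chi4X {1 2}/chi4.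
case: ifP => p3.
  rewrite (_ : (p %% 4 == 1)%N = false); last by move/eqP: p3 => ->.
  have pw : (-1) ^ j = if odd j then -1 else 1.
    elim: (j) => [|i IH] //=; rewrite IH; by case: (odd i) => /=; ring.
  rewrite pw; case: (boolP (odd j)) => oj; first by left; field.
  right; split; first exact: sq.
  by apply: bd; lra.
case: ifP => p1; first by left; rewrite pow1; field.
have p2 : p = 2%N.
  case: (even_prime pp) => // op; exfalso.
  have : (p %% 4 < 4)%N by rewrite ltn_mod.
  move: p1 p3 => /eqP p1 /eqP p3; have := divn_eq p 4; lia.
right; split; last first.
  by apply: bd; rewrite pow_i; [lra | lia].
case: (boolP (odd j)) => oj; last exact: sq.
exists (2 ^ j./2)%N; right; rewrite E p2 -expnD -expnS; congr expn.
by rewrite addnn -{1}(odd_double_half j) oj.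
Qed.

Lemma sum_sq_le (F : nat -> R) (r : nat -> R) N : (forall n, 0 <= F n) ->
  (forall n, (0 < n)%N -> r n = 0 \/ sq_or_2sq n /\ r n <= F n) ->
  \Rsum_(1 <= n < N.+1) r n <= \Rsum_(1 <= m < N.+1) (F (m * m)%N + F (2 * (m * m))%N).
Proof.
move=> F0 H.
have step (c : nat) : \Rsum_(1 <= n < N.+1) (if (n == c)%N then F n else 0) <= F c.
  rewrite -big_mkcond /= big_nat1_eq; case: ifP => _; [lra | exact: F0].
pose D n m := (if (n == m * m)%N then F n else 0) + (if (n == 2 * (m * m))%N then F n else 0).
have D0 n m : 0 <= D n m.
  by rewrite /D; do 2!case: ifP => _; have := F0 n; lra.
apply: (Rle_trans _ (\Rsum_(1 <= n < N.+1) \Rsum_(1 <= m < N.+1) D n m)).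
  apply: Rsum_le_nat => n /andP[n0 nN].
  case: (H n n0) => [->|[[m Hm] Hle]]; first by apply: Rsum_ge0.
  apply: (Rle_trans _ _ _ Hle).
  have m0 : (0 < m)%N by case: (m) Hm n0 => //; case=> ->.
  have mN : (m < N.+1)%N by case: Hm => E; nia.
  have FD : F n <= D n m.
    by rewrite /D; case: Hm => ->; rewrite eqxx; case: ifP => _; have := F0 (m * m)%N; have := F0 (2 * (m * m))%N; lra.
  apply: (Rle_trans _ _ _ FD).
  rewrite (bigD1_seq m) /=; first last.
  - exact: iota_uniq.
  - by rewrite mem_index_iota m0.
  have : 0 <= \Rsum_(i <- index_iota 1 N.+1 | i != m) D n i by apply: Rsum_ge0 => i _.
  lra.
rewrite exchange_big /=; apply: Rsum_le_nat => m _.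
by rewrite big_split /=; apply: Rplus_le_compat; apply: step.
Qed.

(** (log n)^(k+1) <= K n^{1/4} leaves n^{-3/4}, which is m^{-3/2} at n = m^2. The sum over m is at
    most 3, and squares and doubled squares together give 6 K. *)
Lemma polylog_rE (b : nat -> C) k : (forall n, Cmod (b n) <= 1) ->
  polylog_bounded (fun s t => Dser (lnk k (fun n => tw b t n * RtoC (rE n)))%C s).
Proof.
move=> b1; pose K := (INR k.+2 / (1/4)) ^ k.+1.
have K0 : 0 <= K.
  by apply: pow_le; apply: Rdiv_le_0_compat; [exact: (pos_INR k.+2) | lra].
exists (6 * K), 0%N; split; first lra.
move=> s t s12; rewrite pow_O Rmult_1_r.
apply: asum_bound => N.
pose F n := K * wt (3/4) n.
have F0 n : 0 <= F n by apply: Rmult_le_pos => //; left; exact: wt_pos.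
apply: Rle_trans (sum_sq_le (F := F) N F0 _) _.
  move=> n n0; case: (rE_spec n) => [E|[Hs Hr]].
    by left; rewrite Cmod_wterm /lnk E !Cmod_mult Cmod_0; ring.
  right; split=> //.
  rewrite Cmod_wterm !Cmod_mult !Cmod_R Cmod_zit Rmult_1_r.
  have l0 := lnN_ge0 n.
  rewrite (Rabs_pos_eq (lnN n ^ k)); last exact: pow_le.
  have w0 := wt_pos s n.
  apply: (Rle_trans _ (lnN n ^ k.+1 * wt 1 n)).
    apply: Rmult_le_compat; [| by lra | | by apply: wt_le; lra].
      apply: Rmult_le_pos; last exact: pow_le.
      by apply: Rmult_le_pos; [exact: Cmod_ge_0 | exact: Rabs_pos].
    rewrite -[lnN n ^ k.+1]/(lnN n * lnN n ^ k); apply: Rmult_le_compat_r; first exact: pow_le.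
    have := b1 n; have := Cmod_ge_0 (b n); have := Rabs_pos (rE n); nra.
  have P := @pow_le_exp k.+1 (1/4) (lnN n) ltac:(lra) l0.
  apply: (Rle_trans _ (K * exp (1 / 4 * lnN n) * wt 1 n)).
    by apply: Rmult_le_compat_r => //; left; exact: wt_pos.
  rewrite /F Rmult_assoc; right; congr Rmult; rewrite /wt -exp_plus; congr exp; field.
apply: (Rle_trans _ (\Rsum_(1 <= m < N.+1) (2 * K * wt (3/2) m))).
  apply: Rsum_le_nat => m /andP[m0 _]; rewrite /F.
  have E1 : wt (3/4) (m * m) = wt (3/2) m.
    by rewrite /wt lnN_mul //; congr exp; field.
  have E2 : wt (3/4) (2 * (m * m)) <= wt (3/2) m.
    rewrite wt_mul ?muln_gt0 ?m0 // E1.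
    have : wt (3/4) 2 <= 1.
      apply: Rle_trans (@wt_le 0 (3/4) 2 _) _; first lra.
      by rewrite /wt Ropp_0 Rmult_0_l exp_0; lra.
    by have := wt_pos (3/2) m; nra.
  rewrite E1; nra.
rewrite -big_distrr /=.
have := @wt_sum (3/2) N ltac:(lra).
rewrite (_ : 1 + 1 / (3 / 2 - 1) = 3); last by field.
nra.
Qed.

Lemma polylog_twisted_E psi : good_char psi -> good_char (fun n => psi n * RtoC (chi4 n))%C ->
  forall k, polylog_bounded (fun s t => RtoC (s - 1) * Dser (lnk k (tw (fun n => psi n * RtoC (indE n))%C t)) s)%C.
Proof.
move=> g1 g2.
have [_ pM p1] := gc_mult g1.
pose a t n := (tw psi t n * RtoC (vonM n * ewt n))%C.
apply: (@polylog_conv_growth a).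
- move=> t n n0; rewrite Cmod_mult Cmod_tw Cmod_R pow_1.
  (* The weight 2 occurs only at p^j with j even, where 2 log p <= j log p = log n. *)
  have H : 0 <= vonM n * ewt n <= lnN n.
    rewrite /vonM; case: ifP => [Hp|_]; last by rewrite Rmult_0_l; have := lnN_ge0 n; lra.
    have [p [j [pp j0 E]]] := ppowP Hp.
    case: j j0 E => // j _ E; have lp := lnN_ge0 p.
    rewrite E pdiv_pfactor // ewt_pfactor // lnN_exp ?prime_gt0 //.
    have := @INR_ge1 j.+1 isT.
    case: ifP => _; last by nra.
    case: (boolP (odd j.+1)) => oj h; first by nra.
    have : 2 <= INR j.+1 by rewrite -[2]/(INR 2); apply: le_INR; case: j oj {E h} => //; lia.
    nra.
  rewrite Rabs_pos_eq; last lra.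
  by have := p1 n; have := Cmod_ge_0 (psi n); nra.
- move=> t n n0; rewrite Cmod_tw Cmod_mult Cmod_R pow_O.
  have := indE_01 n => h; rewrite Rabs_pos_eq; last lra.
  by have := p1 n; have := Cmod_ge_0 (psi n); nra.
- move=> t n n0.
  rewrite /lnk pow_1.
  have -> : (tw (fun n => psi n * RtoC (indE n))%C t n * RtoC (lnN n) =
     tw psi t n * RtoC (indE n * lnN n))%C by rewrite /tw RtoC_mult; ring.
  rewrite -indE_conv // RtoC_sum big_distrr /= /conv.
  rewrite big_seq_cond [RHS]big_seq_cond; apply: eq_bigr => d /andP[].
  rewrite mem_index_iota => /andP[d0 _] /dvdnP [e E].
  rewrite {}E mulnK // in n0 *.
  have e0 : (0 < e)%N by move: n0; rewrite muln_gt0 => /andP[].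
  have := cmult_M (cmult_tw t (gc_mult g1)) e0 d0; rewrite /tw => ->.
  by rewrite /a /tw !RtoC_mult; ring.
move=> k.
have H1 := polylog_mult (polylog_const (RtoC (1/2))) (polylog_Lam k g1).
have H2 := polylog_mult (polylog_const (RtoC (1/2))) (polylog_Lam k g2).
have H3 := polylog_rE k p1.
apply: polylog_ext (polylog_plus H1 (polylog_plus H2 H3)) => s t s12 /=.
have s1 : 1 < s by lra.
have c1 := cmult_tw t (gc_mult g1); have c2 := cmult_tw t (gc_mult g2).
have a1 := adm_lnk k (adm_Lam c1); have a2 := adm_lnk k (adm_Lam c2).
have a3 : adm (1 + k) (lnk k (fun n => tw psi t n * RtoC (rE n))%C).
  apply: adm_lnk => n n0; rewrite Cmod_mult Cmod_tw Cmod_R pow_1.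
  have : Rabs (rE n) <= lnN n.
    by case: (rE_spec n) => [->|[]] //; rewrite Rabs_R0; exact: lnN_ge0.
  by have := p1 n; have := Cmod_ge_0 (psi n); have := Rabs_pos (rE n); nra.
symmetry; apply: csum_unique.
have S1 := csum_scal (RtoC (1/2)) (Dser_csum a1 s1).
have S2 := csum_scal (RtoC (1/2)) (Dser_csum a2 s1).
apply: csum_ext (csum_plus S1 (csum_plus S2 (Dser_csum a3 s1))) => n n0.
rewrite /wterm /lnk /a /Lam /tw /rE.
have -> : vonM n * ewt n = 1 / 2 * vonM n + 1 / 2 * (chi4 n * vonM n) + vonM n * (ewt n - (1 + chi4 n) / 2) by field.
by rewrite !RtoC_plus !RtoC_mult; ring.
Qed.

(** * Smoothing with the Poisson kernel *)

Lemma is_derive_Rsum (I : Type) (r : seq I) (f : I -> R -> R) (f' : I -> R) t :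
  (forall i, is_derive (f i) t (f' i)) ->
  is_derive (fun t => \Rsum_(i <- r) f i t) t (\Rsum_(i <- r) f' i).
Proof.
move=> H; elim: r => [|i r IH].
  rewrite big_nil; apply: (is_derive_ext (fun _ => 0)); first by move=> x; rewrite big_nil.
  exact: is_derive_const.
rewrite big_cons; apply: (is_derive_ext (fun t => f i t + \Rsum_(i <- r) f i t)).
  by move=> x; rewrite big_cons.
exact: is_derive_plus.
Qed.

Lemma Rabs_mean_value (F f phi phi' : R -> R) a b : a <= b ->
  (forall t, a <= t <= b -> is_derive F t (f t)) ->
  (forall t, a <= t <= b -> is_derive phi t (phi' t)) ->
  (forall t, a <= t <= b -> Rabs (f t) <= phi' t) ->
  Rabs (F b - F a) <= phi b - phi a.
Proof.
move=> ab HF Hp Hle.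
have := @Cmod_mean_value (fun t => RtoC (F t)) (fun t => RtoC (f t)) phi phi' a b ab.
rewrite -RtoC_minus Cmod_R; apply => // t Ht; last by rewrite Cmod_R; apply: Hle.
exact: is_derive_const.
Qed.

Lemma Rabs_sum_le (I : Type) (r : seq I) (P : pred I) (F : I -> R) :
  Rabs (\Rsum_(i <- r | P i) F i) <= \Rsum_(i <- r | P i) Rabs (F i).
Proof.
elim/big_ind2: _ => [|x1 x2 y1 y2 H1 H2|i _]; last lra.
- rewrite Rabs_R0; lra.
- apply: Rle_trans (Rabs_triang _ _) _; lra.
Qed.

Lemma atan_le x : 0 <= x -> atan x <= x.
Proof.
move=> x0.
have := @nonincr_of_derive (fun x => atan x - x) (fun x => / (1 + x²) - 1) 0 x x0.
rewrite atan_0 => H; suff : atan x - x <= 0 - 0 by lra.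
apply: H => t Ht.
  by apply: is_derive_minus; [exact: is_derive_atan | exact: is_derive_id].
have t0 := Rle_0_sqr t; suff : / (1 + t²) <= 1 by lra.
by rewrite -[X in _ <= X]Rinv_1; apply: Rinv_le_contravar; lra.
Qed.

Lemma atan_near z : 0 < z -> PI / 2 - / z <= atan z <= PI / 2.
Proof.
move=> z0; have iz : 0 < / z by apply: Rinv_0_lt_compat.
have := atan_inv _ z0; have := @atan_le (/ z) ltac:(lra); have := atan_bound z; lra.
Qed.

Section Smoothing.
Variables (al u : nat -> R) (N : nat) (T U S W : R).
Hypothesis T0 : 0 < T.
Hypothesis U0 : 0 <= U.
Hypothesis HS : forall t v, 0 <= t <= U ->
  Rabs (\Rsum_(1 <= n < N.+1) (al n * cos (t * (u n - v)))) <= S.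
Hypothesis HW : \Rsum_(1 <= n < N.+1) Rabs (al n) <= W.

(* An antiderivative in [t] of [exp (- t / T) * cos (t * w)]: it replaces the Fourier integral of
   the Poisson kernel, so that only the mean value theorem is needed. *)
Let kap (t w : R) : R := exp (- (t / T)) * (w * sin (t * w) - cos (t * w) / T) / (/ T ^ 2 + w ^ 2).

Lemma kap_den w : 0 < / T ^ 2 + w ^ 2.
Proof.
have : 0 < / T ^ 2 by apply: Rinv_0_lt_compat; apply: pow_lt.
by have := pow2_ge_0 w; lra.
Qed.

Lemma kap_derive t w : is_derive (fun t => kap t w) t (exp (- (t / T)) * cos (t * w)).
Proof.
have D := kap_den w; rewrite /kap; auto_derive; first lra.
have T2 : T * T <> 0 by nra.
have D2 : 1 + T * T * (w * w) <> 0 by nra.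
by rewrite /Rdiv; field; split; nra.
Qed.

Lemma kap_le w : Rabs (kap U w) <= 2 * T * exp (- (U / T)).
Proof.
have D := kap_den w; have e0 := exp_pos (- (U / T)).
rewrite /kap /Rdiv !Rabs_mult (Rabs_pos_eq (exp _)); last lra.
rewrite (Rabs_pos_eq (/ (/ T ^ 2 + w ^ 2))); last by left; apply: Rinv_0_lt_compat.
have H : Rabs (w * sin (U * w) - cos (U * w) * / T) <= Rabs w + / T.
  apply: Rle_trans (Rabs_triang _ _) _; rewrite Rabs_Ropp !Rabs_mult.
  have s1 : Rabs (sin (U * w)) <= 1 by apply: Rabs_le; exact: SIN_bound.
  have c1 : Rabs (cos (U * w)) <= 1 by apply: Rabs_le; exact: COS_bound.
  have iT : 0 < / T by apply: Rinv_0_lt_compat.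
  rewrite (Rabs_pos_eq (/ T)); last lra.
  by have := Rabs_pos w; nra.
have H2 : Rabs w + / T <= 2 * T * (/ T ^ 2 + w ^ 2).
  have -> : 2 * T * (/ T ^ 2 + w ^ 2) = 2 * / T + 2 * T * (Rabs w * Rabs w).
    have -> : Rabs w * Rabs w = w ^ 2 by rewrite -Rabs_mult Rabs_pos_eq; [ring | nra].
    by field; lra.
  have w0 := Rabs_pos w.
  have iT : T * / T = 1 by field; lra.
  have : 0 < / T by apply: Rinv_0_lt_compat.
  move: (/ T) iT (Rabs w) w0 => i iT x x0 i0.
  have := Rle_0_sqr (T * x - 1/2); rewrite /Rsqr => Q.
  apply: (Rmult_le_reg_l T) => //; nra.
apply: (Rmult_le_reg_r (/ T ^ 2 + w ^ 2)) => //.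
rewrite Rmult_assoc Rinv_l; last lra.
rewrite Rmult_1_r; nra.
Qed.

(** The kernel T/(1 + T^2 w^2) is the integral of e^{-t/T} cos(t w) over t >= 0. F U - F 0 is the
    part up to U, bounded by S T through [HS]; F 0 is minus the sum to be estimated; F U is the
    truncation error, of size e^{-U/T}. *)
Lemma poisson_bound v :
  Rabs (\Rsum_(1 <= n < N.+1) (al n * (T / (1 + (T * (u n - v)) ^ 2)))) <=
  T * S + 2 * T * W * exp (- (U / T)).
Proof.
pose F t := \Rsum_(1 <= n < N.+1) (al n * kap t (u n - v)).
have S0 : 0 <= S.
  by apply: Rle_trans (HS (t := 0) 0 _); [exact: Rabs_pos | lra].
have D t : is_derive F t (exp (- (t / T)) * \Rsum_(1 <= n < N.+1) (al n * cos (t * (u n - v)))).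
  rewrite big_distrr /=.
  apply: (@is_derive_ext _ _ (fun t => \Rsum_(1 <= n < N.+1) (al n * kap t (u n - v)))) => //.
  apply: is_derive_Rsum => n.
  rewrite (_ : exp (- (t / T)) * (al n * cos (t * (u n - v))) = al n * (exp (- (t / T)) * cos (t * (u n - v)))); last by ring.
  by apply: is_derive_scal; exact: kap_derive.
have M := @Rabs_mean_value F _ (fun t => - (S * T * exp (- (t / T)))) (fun t => S * exp (- (t / T))) 0 U U0.
have {}M := M _ (fun t _ => D t).
have {M} M : Rabs (F U - F 0) <= S * T.
  apply: Rle_trans (M _ _) _.
  - move=> t Ht; auto_derive => //; rewrite /Rdiv; field; lra.
  - move=> t Ht; rewrite Rabs_mult Rabs_pos_eq; last by left; exact: exp_pos.
    by rewrite Rmult_comm; apply: Rmult_le_compat_r; [left; exact: exp_pos | apply: HS].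
  rewrite (_ : - (0 / T) = 0); last by field; lra.
  have ST : 0 <= S * T by nra.
  by rewrite exp_0; have := exp_pos (- (U / T)); nra.
have FU : Rabs (F U) <= 2 * T * W * exp (- (U / T)).
  apply: Rle_trans (Rabs_sum_le _ _ _) _.
  apply: (Rle_trans _ (\Rsum_(1 <= n < N.+1) (Rabs (al n) * (2 * T * exp (- (U / T)))))).
    apply: Rsum_le => n _; rewrite Rabs_mult; apply: Rmult_le_compat_l; first exact: Rabs_pos.
    exact: kap_le.
  rewrite -big_distrl /=.
  have : 0 <= 2 * T * exp (- (U / T)) by apply: Rmult_le_pos; [lra | left; exact: exp_pos].
  nra.
have F0 : F 0 = - \Rsum_(1 <= n < N.+1) (al n * (T / (1 + (T * (u n - v)) ^ 2))).
  rewrite -Rsum_opp; apply: eq_bigr => n _.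
  rewrite /kap (_ : - (0 / T) = 0); last by field; lra.
  rewrite exp_0 Rmult_0_l sin_0 cos_0.
  have D1 := kap_den (u n - v); have D2 : 0 < 1 + (T * (u n - v)) ^ 2.
    by have := pow2_ge_0 (T * (u n - v)); lra.
  have E : / T ^ 2 + (u n - v) ^ 2 = (1 + (T * (u n - v)) ^ 2) / T ^ 2 by field; lra.
  rewrite E; field; lra.
set X := \Rsum_(1 <= n < N.+1) _ in F0 *.
have -> : X = (F U - F 0) - F U by rewrite F0; ring.
apply: Rle_trans (Rabs_triang _ _) _; rewrite Rabs_Ropp; lra.
Qed.

(** Integrating the kernel over the window gives a difference of arctangents that is within 2/(T
    eta) of PI inside and of 0 outside, as long as u n keeps the distance eta from both ends. The
    remaining n satisfy [Q] and are estimated trivially. *)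
Lemma window_smooth v h eta (P Q : pred nat) : 0 <= h -> 0 < eta ->
  (forall n, (0 < n)%N -> P n <-> v < u n <= v + h) ->
  (forall n, (0 < n)%N -> ~~ Q n -> eta <= Rabs (u n - v) /\ eta <= Rabs (u n - (v + h))) ->
  Rabs (\Rsum_(1 <= n < N.+1 | P n) al n) <=
  (T * S + 2 * T * W * exp (- (U / T))) * h + W / (T * eta) +
  \Rsum_(1 <= n < N.+1 | Q n) Rabs (al n).
Proof.
move=> h0 e0 HP HQ.
pose H v := \Rsum_(1 <= n < N.+1) (al n * atan (T * (u n - v))).
set E := T * S + _.
have E0 : 0 <= E by apply: Rle_trans (poisson_bound v); exact: Rabs_pos.
have DH x : is_derive H x (- \Rsum_(1 <= n < N.+1) (al n * (T / (1 + (T * (u n - x)) ^ 2)))).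
  rewrite -Rsum_opp.
  apply: (@is_derive_ext _ _ (fun t => \Rsum_(1 <= n < N.+1) (al n * atan (T * (u n - t))))) => //.
  apply: is_derive_Rsum => n.
  rewrite (_ : - (al n * _) = al n * (- T * / (1 + (T * (u n - x))²))); last first.
    by rewrite /Rsqr /Rdiv (_ : T * (u n - x) * (T * (u n - x)) = (T * (u n - x)) ^ 2); ring.
  apply: is_derive_scal.
  apply: (is_derive_comp atan (fun t => T * (u n - t))); first exact: is_derive_atan.
  by auto_derive => //; ring.
have M : Rabs (H (v + h) - H v) <= E * h.
  rewrite (_ : E * h = E * (v + h) - E * v); last by ring.
  apply: (@Rabs_mean_value H (fun x => - \Rsum_(1 <= n < N.+1) (al n * (T / (1 + (T * (u n - x)) ^ 2))))
    (fun x => E * x) (fun _ => E)).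
  - lra.
  - by move=> t _; exact: DH.
  - by move=> t _; auto_derive => //; ring.
  - by move=> t _; rewrite Rabs_Ropp; exact: poisson_bound.
have pi2 : 2 < PI by have := PI2_1; lra.
have Te : 0 < T * eta by apply: Rmult_lt_0_compat.
have iTe : 0 < / (T * eta) by apply: Rinv_0_lt_compat.
have far x : eta <= Rabs x -> (0 < x -> PI / 2 - / (T * eta) <= atan (T * x) <= PI / 2) /\
     (x <= 0 -> - (PI / 2) <= atan (T * x) <= - (PI / 2) + / (T * eta)).
  move=> ex; split=> x0.
    rewrite Rabs_pos_eq in ex; last lra.
    have Tx : 0 < T * x by nra.
    have := atan_near Tx; have : / (T * x) <= / (T * eta) by apply: Rinv_le_contravar; nra.
    lra.
  have {x0} x0 : x < 0.
    by move: ex; rewrite Rabs_left1 //; lra.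
  rewrite Rabs_left in ex => //.
  have Tx : 0 < T * - x by nra.
  have := atan_near Tx; rewrite Ropp_mult_distr_r_reverse atan_opp.
  have : / (T * - x) <= / (T * eta) by apply: Rinv_le_contravar; nra.
  rewrite Ropp_mult_distr_r_reverse; lra.
have pt n : (0 < n)%N ->
   Rabs ((if P n then PI else 0) - (atan (T * (u n - v)) - atan (T * (u n - (v + h))))) <=
   2 * / (T * eta) + (if Q n then PI else 0).
  move=> n0; case: (boolP (Q n)) => Qn.
    have mon : atan (T * (u n - (v + h))) <= atan (T * (u n - v)).
      have : T * (u n - (v + h)) <= T * (u n - v) by nra.
      by case=> [L|->]; [left; exact: atan_increasing | lra].
    have b1 := atan_bound (T * (u n - v)); have b2 := atan_bound (T * (u n - (v + h))).
    by case: (P n); apply: Rabs_le; lra.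
  have [q1 q2] := HQ n n0 Qn.
  have [f1 f2] := far _ q1; have [f3 f4] := far _ q2.
  case: (boolP (P n)) => Pn.
    have [p1 p2] := proj1 (HP n n0) Pn.
    have := f1 ltac:(lra); have := f4 ltac:(lra) => a1 a2.
    by apply: Rabs_le; lra.
  have [l|l] := Rle_dec (u n) v.
    have := f2 ltac:(lra); have := f4 ltac:(lra) => a1 a2.
    by apply: Rabs_le; lra.
  have [l2|l2] := Rle_dec (u n) (v + h).
    by case/negP: Pn; apply/HP => //; lra.
  have := f1 ltac:(lra); have := f3 ltac:(lra) => a1 a2.
  by apply: Rabs_le; lra.
have key : PI * Rabs (\Rsum_(1 <= n < N.+1 | P n) al n) <=
    E * h + 2 * / (T * eta) * W + PI * \Rsum_(1 <= n < N.+1 | Q n) Rabs (al n).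
  rewrite -{1}(Rabs_pos_eq PI); last lra.
  rewrite -Rabs_mult big_distrr /= big_mkcond /=.
  have -> : \Rsum_(1 <= n < N.+1) (if P n then PI * al n else 0) =
     - (H (v + h) - H v) + \Rsum_(1 <= n < N.+1) (al n * ((if P n then PI else 0) -
        (atan (T * (u n - v)) - atan (T * (u n - (v + h)))))).
    rewrite (_ : - (H (v + h) - H v) = H v + - H (v + h)); last by ring.
    rewrite /H -Rsum_opp -!big_split /=; apply: eq_bigr => n _.
    by case: (P n); ring.
  apply: Rle_trans (Rabs_triang _ _) _; rewrite Rabs_Ropp Rplus_assoc.
  apply: Rplus_le_compat => //.
  apply: Rle_trans (Rabs_sum_le _ _ _) _.
  apply: (Rle_trans _ (\Rsum_(1 <= n < N.+1) (2 * / (T * eta) * Rabs (al n) + (if Q n then PI * Rabs (al n) else 0)))).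
    apply: Rsum_le_nat => n /andP[n0 _]; rewrite Rabs_mult.
    have := pt n n0; have := Rabs_pos (al n).
    case: (Q n) => h1 h2; nra.
  rewrite big_split /= -big_distrr /= -big_mkcond /= -big_distrr /=.
  apply: Rplus_le_compat_r; apply: Rmult_le_compat_l => //; lra.
have W0 : 0 <= W by apply: Rle_trans HW; apply: Rsum_ge0 => n _; exact: Rabs_pos.
set X := Rabs _ in key *; set Y := \Rsum_(1 <= n < N.+1 | Q n) _ in key *.
rewrite /Rdiv.
apply: (Rmult_le_reg_l PI); first lra.
apply: (Rle_trans _ _ _ key).
have : 0 <= E * h by apply: Rmult_le_pos.
have : 0 <= W * / (T * eta) by apply: Rmult_le_pos; lra.
nra.
Qed.
End Smoothing.

(** * Sums over short intervals *)

Definition flo (x : R) : nat := Z.to_nat (Int_part x).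

Lemma flo_spec x : 0 <= x -> INR (flo x) <= x < INR (flo x) + 1.
Proof.
move=> x0; have [h1 h2] := base_Int_part x.
have z0 : (0 <= Int_part x)%Z.
  have : (-1 < Int_part x)%Z by apply: lt_IZR; lra.
  lia.
have E : INR (flo x) = IZR (Int_part x) by rewrite /flo INR_IZR_INZ Z2Nat.id.
lra.
Qed.

Lemma flo_le n x : 0 <= x -> (n <= flo x)%N <-> INR n <= x.
Proof.
move=> x0; have [h1 h2] := flo_spec x0; split=> H.
  by apply: Rle_trans h1; apply: le_INR; lia.
have : INR n < INR (flo x).+1 by rewrite S_INR; lra.
by move/INR_lt; lia.
Qed.

Lemma flo_exp n v : (0 < n)%N -> (n <= flo (exp v))%N <-> lnN n <= v.
Proof.
move=> n0; rewrite flo_le; last by left; exact: exp_pos.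
rewrite -(exp_lnN n0); split=> H; last by case: H => [H|->]; [left; apply: exp_increasing | lra].
case: (Rle_dec (lnN n) v) => // H2.
by have : exp v < exp (lnN n); [apply: exp_increasing; lra | lra].
Qed.

Lemma flo_mono x y : 0 <= x -> x <= y -> (flo x <= flo y)%N.
Proof. by move=> x0 xy; apply/flo_le; [lra | have := flo_spec x0; lra]. Qed.

Lemma exp_le_1_3 x : x <= 1 -> exp x <= 3.
Proof.
move=> x1; apply: Rle_trans exp_le_3.
by case: x1 => [H|->]; [left; apply: exp_increasing | lra].
Qed.

Lemma psum_close f l e N : is_csum f l ->
  (forall M, \Rsum_(N.+1 <= n < M.+1) Cmod (f n) <= e) -> Cmod (Psum f N - l) <= e.
Proof.
move=> H HM; apply: le_epsilon => d /H [N0 HN0].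
have := HN0 (maxn N0 N) (leq_maxl _ _); set K := maxn N0 N => HK.
have -> : (Psum f N - l = - (Psum f K - Psum f N) + (Psum f K - l))%C by ring.
apply: Rle_trans (Cmod_triangle _ _) _; rewrite Cmod_opp Psum_diff; last exact: leq_maxr.
have := Rle_trans _ _ _ (Cmod_sum_le (index_iota N.+1 K.+1) xpredT f) (HM K); lra.
Qed.

(** The smoothing estimates concern real coefficients; a rotation by c reduces complex sums to
    them. *)
Lemma Cmod_le_dual z B : 0 <= B -> (forall c, Cmod c = 1 -> Rabs (Re (c * z)%C) <= B) -> Cmod z <= B.
Proof.
move=> B0 H; have [z0|z0] := Req_dec (Cmod z) 0; first lra.
have zp : 0 < Cmod z by have := Cmod_ge_0 z; lra.
have S := Cmod_sqr z.
pose c : C := (Re z / Cmod z, - (Im z / Cmod z)).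
have E : Re (c * z)%C = Cmod z.
  have -> : Re (c * z)%C = (Re z * Re z + Im z * Im z) / Cmod z.
    have -> : Re (c * z)%C = Re z / Cmod z * Re z - - (Im z / Cmod z) * Im z by [].
    by field.
  by rewrite -S; field.
have c1 : Cmod c = 1.
  have : Cmod c * Cmod c = 1.
    rewrite (Cmod_sqr c) /c /=.
    rewrite (_ : _ + _ = (Re z * Re z + Im z * Im z) / (Cmod z * Cmod z)); last by field.
    by rewrite -S; field.
  by have := Cmod_ge_0 c; nra.
have := H c c1; rewrite E; have := Rle_abs (Cmod z); lra.
Qed.

Lemma ell_mono t U : Rabs t <= U -> ell t <= ell U.
Proof.
move=> tU; have := Rabs_pos t => t0; apply: ln_le; first lra.
by rewrite (Rabs_pos_eq U); lra.
Qed.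

Lemma Rsum_window (F : nat -> R) A B N : (B <= N)%N ->
  \Rsum_(A.+1 <= n < B.+1) F n = \Rsum_(1 <= n < N.+1 | (A < n <= B)%N) F n.
Proof.
by move=> BN; rewrite (big_nat_widenl A.+1 1) // (big_nat_widen 1 B.+1 N.+1).
Qed.

Section Application.
Variable g : nat -> C.
Hypothesis g1 : forall n, Cmod (g n) <= 1.
Hypothesis HG : forall k, polylog_bounded (fun s t => RtoC (s - 1) * Dser (lnk k (tw g t)) s)%C.

Lemma adm_g : adm 0 g.
Proof. by move=> n _; exact: g1. Qed.

(** [window_smooth] at u = log n and s = 1 + 1/y. The factor s - 1 in the hypothesis becomes the y
    in the bound C1 y [ell U]^m + 1 of the twisted sums, and the added 1 pays for truncating the
    series. *)
Lemma window_weighted k C1 m y v h eta T U : 0 <= C1 ->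
  (forall s t, 1 < s <= 2 -> Cmod (RtoC (s - 1) * Dser (lnk k (tw g t)) s) <= C1 * ell t ^ m) ->
  1 <= y -> 0 < T -> 0 <= U -> 0 <= h -> 0 < eta ->
  let s := 1 + / y in
  let nf n := Cmod (wterm (lnk k g) s n) in
  Cmod (\Csum_((flo (exp v)).+1 <= n < (flo (exp (v + h))).+1) wterm (lnk k g) s n) <=
  (T * (C1 * y * ell U ^ m + 1) + 2 * T * admB k s * exp (- (U / T))) * h +
  admB k s / (T * eta) +
  (\Rsum_((flo (exp (v - eta))).+1 <= n < (flo (exp (v + eta))).+1) nf n +
   \Rsum_((flo (exp (v + h - eta))).+1 <= n < (flo (exp (v + h + eta))).+1) nf n).
Proof.
move=> C10 HC y1 T0 U0 h0 e0 s nf.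
have iy : 0 < / y by apply: Rinv_0_lt_compat; lra.
have iy1 : / y <= 1 by rewrite -Rinv_1; apply: Rinv_le_contravar; lra.
have s12 : 1 < s <= 2 by rewrite /s; lra.
have s1 : 1 < s by lra.
have as0 := adm_asum (adm_lnk k adm_g) s1; rewrite add0n in as0.
set W := admB k s in as0 *.
have W0 := asum_ge0 as0.
have [N0 HN0] := asum_tail as0 Rlt_0_1.
pose N1 := flo (exp v); pose N2 := flo (exp (v + h)).
pose N3 := flo (exp (v - eta)); pose N4 := flo (exp (v + eta)).
pose N5 := flo (exp (v + h - eta)); pose N6 := flo (exp (v + h + eta)).
(* Beyond all the intervals involved, and so far that the tail of absolute values is below 1. The
   same N serves every t because twisting leaves absolute values unchanged. *)
pose N := (N0 + N2 + N4 + N6)%N.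
have e1 := ell_ge1 U.
have L1 : 1 <= ell U ^ m by apply: pow_R1_Rle.
set S := C1 * y * ell U ^ m + 1.
have S0 : 0 <= S.
  have : 0 <= C1 * y * ell U ^ m by apply: Rmult_le_pos; [apply: Rmult_le_pos; lra | lra].
  by rewrite /S; lra.
have fN t : Rabs t <= U -> Cmod (Psum (wterm (lnk k (tw g t)) s) N) <= S.
  move=> tU.
  have ad : adm k (lnk k (tw g t)) by have := adm_lnk k (adm_tw t g1).
  have cl : Cmod (Psum (wterm (lnk k (tw g t)) s) N - Dser (lnk k (tw g t)) s) <= 1.
    apply: psum_close; first exact: Dser_csum ad s1.
    move=> M; apply: Rle_trans (Rlt_le _ _ (HN0 N M _)); last by rewrite /N; lia.
    apply: Req_le; apply: eq_bigr => n _.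
    by rewrite !Cmod_wterm !Cmod_mult Cmod_zit Rmult_1_r.
  have D : Cmod (Dser (lnk k (tw g t)) s) <= C1 * y * ell U ^ m.
    have := HC s t s12; rewrite Cmod_mult Cmod_R Rabs_pos_eq; last lra.
    have -> : s - 1 = / y by rewrite /s; ring.
    move=> H; apply: (Rmult_le_reg_l (/ y)) => //; apply: (Rle_trans _ _ _ H).
    have -> : / y * (C1 * y * ell U ^ m) = C1 * ell U ^ m by field; lra.
    apply: Rmult_le_compat_l => //; apply: pow_incr; split.
      by have := ell_ge1 t; lra.
    exact: ell_mono.
  rewrite (_ : Psum _ N = Psum (wterm (lnk k (tw g t)) s) N - Dser (lnk k (tw g t)) s + Dser (lnk k (tw g t)) s)%C; last by ring.
  apply: Rle_trans (Cmod_triangle _ _) _; rewrite /S; lra.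
have RHS0 : 0 <= (T * S + 2 * T * W * exp (- (U / T))) * h + W / (T * eta) +
  (\Rsum_(N3.+1 <= n < N4.+1) nf n + \Rsum_(N5.+1 <= n < N6.+1) nf n).
  have a1 : 0 <= \Rsum_(N3.+1 <= n < N4.+1) nf n by apply: Rsum_ge0 => n _; exact: Cmod_ge_0.
  have a2 : 0 <= \Rsum_(N5.+1 <= n < N6.+1) nf n by apply: Rsum_ge0 => n _; exact: Cmod_ge_0.
  have a3 : 0 <= W / (T * eta) by apply: Rdiv_le_0_compat => //; apply: Rmult_lt_0_compat.
  have a4 := exp_pos (- (U / T)).
  have a5 : 0 <= T * S by nra.
  have a6 : 0 <= 2 * T * W * exp (- (U / T)) by apply: Rmult_le_pos; [apply: Rmult_le_pos|]; lra.
  have : 0 <= (T * S + 2 * T * W * exp (- (U / T))) * h by apply: Rmult_le_pos; lra.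
  lra.
apply: Cmod_le_dual => // c c1.
pose al n := Re (c * wterm (lnk k g) s n)%C.
have al_le n : Rabs (al n) <= nf n.
  by apply: Rle_trans (Re_le_Cmod _) _; rewrite Cmod_mult c1 Rmult_1_l; exact: Rle_refl.
have HS t v' : 0 <= t <= U -> Rabs (\Rsum_(1 <= n < N.+1) (al n * cos (t * (lnN n - v')))) <= S.
  move=> tU.
  (* cos(t (log n - v')) is the mean of e^{itv'} n^{-it} and its conjugate, so the cosine sum comes
     from the twists by t and -t. *)
  pose e' : C := (cos (t * v'), sin (t * v')); pose e'' : C := (cos (t * v'), - sin (t * v')).
  have E : \Rsum_(1 <= n < N.+1) (al n * cos (t * (lnN n - v'))) =
    Re (c * (RtoC (1/2) * (e' * Psum (wterm (lnk k (tw g t)) s) N +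
        e'' * Psum (wterm (lnk k (tw g (- t))) s) N)))%C.
    have -> : (c * (RtoC (1/2) * (e' * Psum (wterm (lnk k (tw g t)) s) N +
        e'' * Psum (wterm (lnk k (tw g (- t))) s) N)) = \Csum_(1 <= n < N.+1)
        (c * (RtoC (1/2) * (e' * wterm (lnk k (tw g t)) s n + e'' * wterm (lnk k (tw g (- t))) s n))))%C.
      by rewrite -!big_distrr /= big_split /= -!big_distrr.
    rewrite Re_sum.
    apply: eq_bigr => n _; rewrite /al /wterm /lnk /tw /zit /e' /e''.
    rewrite Rmult_minus_distr_l cos_minus !Ropp_mult_distr_l_reverse cos_neg sin_neg.
    case: (c) => x1 x2; case: (g n) => x3 x4 /=; field.
  rewrite E; apply: Rle_trans (Re_le_Cmod _) _.
  rewrite !Cmod_mult c1 Rmult_1_l Cmod_R Rabs_pos_eq; last lra.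
  have u1 : Cmod e' = 1.
    rewrite /e' /Cmod /= -[RHS]sqrt_1; congr sqrt; have := sin2_cos2 (t * v'); rewrite /Rsqr; lra.
  have u2 : Cmod e'' = 1 by exact: Cmod_unit_cs.
  have b1 := @fN t ltac:(rewrite Rabs_pos_eq; lra).
  have b2 := @fN (- t) ltac:(rewrite Rabs_Ropp Rabs_pos_eq; lra).
  have := Cmod_triangle (e' * Psum (wterm (lnk k (tw g t)) s) N) (e'' * Psum (wterm (lnk k (tw g (- t))) s) N).
  rewrite !Cmod_mult u1 u2; lra.
have HW : \Rsum_(1 <= n < N.+1) Rabs (al n) <= W.
  by apply: Rle_trans (as0 N); apply: Rsum_le => n _; exact: al_le.
pose P n := (N1 < n <= N2)%N.
pose Q n := (N3 < n <= N4)%N || (N5 < n <= N6)%N.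
have HP n : (0 < n)%N -> P n <-> v < lnN n <= v + h.
  move=> n0; rewrite /P; have E1 := @flo_exp n v n0; have E2 := @flo_exp n (v + h) n0.
  split.
    move=> /andP[p1 p2]; split; last by apply/E2.
    by apply: Rnot_le_lt => /E1; rewrite leqNgt p1.
  move=> [p1 p2]; apply/andP; split; last by apply/E2.
  by rewrite ltnNge; apply/negP => /E1; lra.
have HQ n : (0 < n)%N -> ~~ Q n -> eta <= Rabs (lnN n - v) /\ eta <= Rabs (lnN n - (v + h)).
  move=> n0; rewrite /Q negb_or => /andP[q1 q2].
  have far w : ~~ ((flo (exp (w - eta)) < n) && (n <= flo (exp (w + eta))))%N -> eta <= Rabs (lnN n - w).
    have E1 := @flo_exp n (w - eta) n0; have E2 := @flo_exp n (w + eta) n0.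
    rewrite negb_and -leqNgt => /orP[/E1 H|H].
      by rewrite Rabs_left1; lra.
    have : ~ lnN n <= w + eta by move/E2; apply/negP.
    move=> H2; rewrite Rabs_pos_eq; lra.
  by split; apply: far.
have WS := @window_smooth al lnN N T U S W T0 U0 HS HW v h eta P Q h0 e0 HP HQ.
have -> : Re (c * \Csum_(N1.+1 <= n < N2.+1) wterm (lnk k g) s n)%C = \Rsum_(1 <= n < N.+1 | P n) al n.
  rewrite big_distrr /= Re_sum /P.
  by apply: Rsum_window; rewrite /N; lia.
apply: (Rle_trans _ _ _ WS); apply: Rplus_le_compat_l.
rewrite !(@Rsum_window _ _ _ N); try by rewrite /N; lia.
rewrite big_mkcond [X in _ <= X + _]big_mkcond [X in _ <= _ + X]big_mkcond -big_split /=.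
apply: Rsum_le => n _; rewrite /Q.
have := al_le n; have : 0 <= nf n by exact: Cmod_ge_0.
by case: (N3 < n <= N4)%N; case: (N5 < n <= N6)%N => /= h1 h2; lra.
Qed.

(** The number of integers in the interval times the largest weight. The summand exp (- w) comes
    from the 1 by which the count may exceed the length. *)
Lemma near_bound k s w eta : 1 <= s -> 0 <= w -> 0 < eta <= 1 / 2 ->
  \Rsum_((flo (exp (w - eta))).+1 <= n < (flo (exp (w + eta))).+1) Cmod (wterm (lnk k g) s n) <=
  3 * (w + 1) ^ k * (4 * eta + exp (- w)).
Proof.
move=> s1 w0 e0.
pose A := flo (exp (w - eta)); pose B := flo (exp (w + eta)).
have AB : (A <= B)%N by apply: flo_mono; [left; exact: exp_pos | apply: exp_le_mono; lra].
apply: (Rle_trans _ (\Rsum_(A.+1 <= n < B.+1) ((w + 1) ^ k * exp (- (w - eta))))).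
  apply: Rsum_le_nat => n /andP[nA nB].
  have n0 : (0 < n)%N by lia.
  have l0 := lnN_ge0 n.
  have h1 : lnN n <= w + eta by apply/flo_exp.
  have h2 : w - eta < lnN n.
    by apply: Rnot_le_lt => /(flo_exp _ n0); rewrite -/A; lia.
  rewrite Cmod_wterm Cmod_mult Cmod_R (Rabs_pos_eq (lnN n ^ k)); last exact: pow_le.
  apply: Rmult_le_compat.
  - by apply: Rmult_le_pos; [exact: Cmod_ge_0 | exact: pow_le].
  - by left; exact: wt_pos.
  - have p1 : lnN n ^ k <= (w + 1) ^ k by apply: pow_incr; lra.
    have p0 : 0 <= lnN n ^ k by exact: pow_le.
    by have := g1 n; have := Cmod_ge_0 (g n); nra.
  - apply: Rle_trans (wt_le n s1) _; rewrite /wt; apply: exp_le_mono; lra.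
rewrite Rsum_const_nat // subSS.
have cnt : INR (B - A) <= exp (w + eta) - exp (w - eta) + 1.
  have [a1 a2] := @flo_spec (exp (w - eta)) ltac:(left; exact: exp_pos).
  have [b1 b2] := @flo_spec (exp (w + eta)) ltac:(left; exact: exp_pos).
  rewrite minus_INR; last by lia.
  by rewrite /A /B; lra.
have w1 : 0 <= (w + 1) ^ k by apply: pow_le; lra.
rewrite (_ : 3 * (w + 1) ^ k * _ = (w + 1) ^ k * (3 * (4 * eta + exp (- w)))); last by ring.
rewrite (_ : INR (B - A) * _ = (w + 1) ^ k * (INR (B - A) * exp (- (w - eta)))); last by ring.
apply: Rmult_le_compat_l => //.
apply: (Rle_trans _ ((exp (w + eta) - exp (w - eta) + 1) * exp (- (w - eta)))).
  by apply: Rmult_le_compat_r => //; left; exact: exp_pos.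
have -> : (exp (w + eta) - exp (w - eta) + 1) * exp (- (w - eta)) = (exp (2 * eta) - 1) + exp eta * exp (- w).
  rewrite -exp_plus Rmult_plus_distr_r Rmult_minus_distr_r -!exp_plus.
  rewrite (_ : w - eta + - (w - eta) = 0); last by ring.
  rewrite exp_0 (_ : w + eta + - (w - eta) = 2 * eta); last by ring.
  by rewrite (_ : - (w - eta) = eta + - w); ring.
have h1 := exp_sub1_le (2 * eta).
have h2 := @exp_le_1_3 (2 * eta) ltac:(lra).
have h3 := @exp_le_1_3 eta ltac:(lra).
have h4 := exp_pos (- w).
nra.
Qed.

Lemma pow_1_plus_le h k : 0 <= h <= 1 -> (1 + h) ^ k <= 1 + 3 ^ k * h.
Proof.
move=> h01; elim: k => [|k IH]; first by rewrite /=; lra.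
rewrite /=; have k1 : 1 <= 3 ^ k by apply: pow_R1_Rle; lra.
have : (1 + h) * (1 + h) ^ k <= (1 + h) * (1 + 3 ^ k * h) by apply: Rmult_le_compat_l; lra.
have qh : h <= 3 ^ k * h by nra.
have : 3 ^ k * h * h <= 3 ^ k * h * 1 by apply: Rmult_le_compat_l; lra.
lra.
Qed.

(** Across a window of logarithmic length h the weight (log n)^k n^{-s} changes by a relative O(h)
    only, so it is divided out at its value at v. The error is O(h) per integer of the window. *)
Lemma window_unweighted k s v h : 1 < s <= 2 -> 1 <= v -> 0 <= h <= 1 ->
  Cmod (\Csum_((flo (exp v)).+1 <= n < (flo (exp (v + h))).+1) g n) <=
  exp (s * v) / v ^ k *
    Cmod (\Csum_((flo (exp v)).+1 <= n < (flo (exp (v + h))).+1) wterm (lnk k g) s n) +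
  (3 ^ k + 2) * h * (3 * h * exp v + 1).
Proof.
move=> s12 v1 h01.
pose A := flo (exp v); pose B := flo (exp (v + h)); rewrite -/A -/B.
have AB : (A <= B)%N by apply: flo_mono; [left; exact: exp_pos | apply: exp_le_mono; lra].
have vk : 0 < v ^ k by apply: pow_lt; lra.
set f := exp (s * v) / v ^ k.
have f0 : 0 < f by apply: Rdiv_lt_0_compat => //; exact: exp_pos.
have -> : \Csum_(A.+1 <= n < B.+1) g n =
  (RtoC f * (\Csum_(A.+1 <= n < B.+1) wterm (lnk k g) s n) +
   \Csum_(A.+1 <= n < B.+1) (g n * RtoC (1 - f * (lnN n ^ k * wt s n))))%C.
  rewrite big_distrr /= -big_split /=; apply: eq_bigr => n _.
  by rewrite /wterm /lnk RtoC_minus !RtoC_mult; ring.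
apply: Rle_trans (Cmod_triangle _ _) _; rewrite Cmod_mult Cmod_R Rabs_pos_eq; last lra.
apply: Rplus_le_compat_l; apply: Rle_trans (Cmod_sum_le _ _ _) _.
have k1 : 1 <= 3 ^ k by apply: pow_R1_Rle; lra.
apply: (Rle_trans _ (\Rsum_(A.+1 <= n < B.+1) ((3 ^ k + 2) * h))).
  apply: Rsum_le_nat => n /andP[nA nB].
  have n0 : (0 < n)%N by lia.
  have h1 : lnN n <= v + h by apply/flo_exp.
  have h2 : v < lnN n.
    by apply: Rnot_le_lt => /(flo_exp _ n0); rewrite -/A; lia.
  rewrite Cmod_mult Cmod_R.
  pose rho := (lnN n / v) ^ k * exp (- (s * (lnN n - v))).
  have -> : f * (lnN n ^ k * wt s n) = rho.
    rewrite /f /rho /wt /Rdiv Rpow_mult_distr pow_inv.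
    rewrite (_ : - (s * (lnN n - v)) = s * v + - s * lnN n); last by ring.
    by rewrite exp_plus; ring.
  have r1 : rho <= 1 + 3 ^ k * h.
    apply: Rle_trans (pow_1_plus_le k h01).
    rewrite -[X in _ <= X]Rmult_1_r; apply: Rmult_le_compat.
    - by apply: pow_le; apply: Rdiv_le_0_compat; lra.
    - by left; exact: exp_pos.
    - apply: pow_incr; split; first by apply: Rdiv_le_0_compat; lra.
      apply: (Rmult_le_reg_r v); first lra.
      rewrite /Rdiv Rmult_assoc Rinv_l; nra.
    - by rewrite -exp_0; apply: exp_le_mono; nra.
  have r2 : 1 - 2 * h <= rho.
    have p1 : 1 <= (lnN n / v) ^ k.
      apply: pow_R1_Rle; apply: (Rmult_le_reg_r v); first lra.
      by rewrite /Rdiv Rmult_assoc Rinv_l; lra.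
    have p2 : 1 - 2 * h <= exp (- (s * (lnN n - v))).
      have := exp_ineq1_le (- (s * (lnN n - v))); nra.
    have := exp_pos (- (s * (lnN n - v))).
    rewrite /rho; nra.
  have : Rabs (1 - rho) <= (3 ^ k + 2) * h by apply: Rabs_le; nra.
  by have := g1 n; have := Cmod_ge_0 (g n); have := Rabs_pos (1 - rho); nra.
rewrite Rsum_const_nat // subSS.
have cnt : INR (B - A) <= exp (v + h) - exp v + 1.
  have [a1 a2] := @flo_spec (exp v) ltac:(left; exact: exp_pos).
  have [b1 b2] := @flo_spec (exp (v + h)) ltac:(left; exact: exp_pos).
  rewrite minus_INR; last by lia.
  by rewrite /A /B; lra.
rewrite Rmult_comm; apply: Rmult_le_compat_l; first by nra.
apply: (Rle_trans _ _ _ cnt).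
have e3 := @exp_le_1_3 h ltac:(lra); have e1 := exp_sub1_le h; have ev := exp_pos v.
have eh : exp h - 1 <= 3 * h by nra.
have := Rmult_le_compat_l _ _ _ (Rlt_le _ _ ev) eh; rewrite exp_plus; lra.
Qed.
End Application.

Lemma pow_exp_half y j : 0 <= y -> y ^ j <= (2 * INR j.+1) ^ j * exp (y / 2).
Proof.
move=> y0; have := @pow_le_exp j (1/2) y ltac:(lra) y0.
rewrite (_ : INR j.+1 / (1 / 2) = 2 * INR j.+1); last by field.
by rewrite (_ : 1 / 2 * y = y / 2); last by field.
Qed.

(** Over frequencies up to a power of y, the loss is a power of log y, which one factor y
    absorbs. *)
Lemma ell_pow_growth D m y : 2 <= y ->
  ell (y ^ (4 * D)) ^ m <= (INR (4 * D + 2) * INR m.+1) ^ m * y.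
Proof.
move=> y2; have p0 : 0 < y ^ (4 * D) by apply: pow_lt; lra.
have p1 : 1 <= y ^ (4 * D) by apply: pow_R1_Rle; lra.
have ly : 0 <= ln y by rewrite -ln_1; apply: ln_le; lra.
have E : ell (y ^ (4 * D)) <= INR (4 * D + 2) * ln y.
  rewrite -ln_pow; last lra.
  rewrite /ell Rabs_pos_eq; last lra.
  apply: ln_le; first lra.
  rewrite -[(_ + 2)%N]/(Nat.add _ 2) pow_add; have : 4 <= y ^ 2 by nra.
  nra.
have L := @pow_le_exp m 1 (ln y) ltac:(lra) ly.
rewrite Rmult_1_l exp_ln /Rdiv ?Rinv_1 ?Rmult_1_r in L; last lra.
apply: (Rle_trans _ ((INR (4 * D + 2) * ln y) ^ m)).
  by apply: pow_incr; split=> //; have := ell_ge1 (y ^ (4 * D)); lra.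
rewrite !Rpow_mult_distr Rmult_assoc; apply: Rmult_le_compat_l => //.
by apply: pow_le; exact: pos_INR.
Qed.

Lemma admB_le k y : 1 <= y -> admB k (1 + / y) <= (2 * INR k.+1) ^ k * 3 * (y ^ k * y).
Proof.
move=> y1; rewrite /admB.
have -> : INR k.+1 / ((1 + / y - 1) / 2) = 2 * INR k.+1 * y by field; lra.
have -> : 1 + 1 / ((1 + / y - 1) / 2) = 1 + 2 * y by field; lra.
rewrite Rpow_mult_distr.
have p : 0 <= (2 * INR k.+1) ^ k * y ^ k.
  by apply: Rmult_le_pos; apply: pow_le; [have := pos_INR k.+1; lra | lra].
have := Rmult_le_compat_l _ _ _ p (_ : 1 + 2 * y <= 3 * y); lra.
Qed.

Section Final.
Variable g : nat -> C.
Hypothesis g1 : forall n, Cmod (g n) <= 1.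
Hypothesis HG : forall k, polylog_bounded (fun s t => RtoC (s - 1) * Dser (lnk k (tw g t)) s)%C.

(* The order k of differentiation gains y^{-k} and costs only powers of ln y, so it can beat the
   length T = y^{2D} of the Fourier window, which in turn beats the short interval h = y^{-A}. *)
Lemma window_final (A : nat) : exists C0, 0 <= C0 /\ forall y v, 4 <= y -> y / 2 <= v <= y ->
  Cmod (\Csum_((flo (exp v)).+1 <= n < (flo (exp (v + / y ^ A))).+1) g n) <=
  C0 * exp v * (/ y ^ A * / y ^ A).
Proof.
(* With h = y^{-A}, the target is h^2 e^v, a saving of h over the trivial h e^v. The choice y^D =
   y/h^2 makes the end zones of width y^{-D} negligible and cancels the extra y in [admB]. Then y^k
   = T y^2/h^2 pays for the length T, a factor y from 1/(s-1), a factor y from the powers of [ell],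
   and the target. *)
pose D := (2 * A + 1)%N; pose k := (2 * D + 2 + 2 * A)%N.
have [C1 [m [C1p HC]]] := HG k.
pose C2 := (INR (4 * D + 2) * INR m.+1) ^ m.
have C2p : 0 <= C2 by apply: pow_le; apply: Rmult_le_pos; exact: pos_INR.
pose Kw := (2 * INR k.+1) ^ k * 3.
have Kw0 : 0 <= Kw.
  apply: Rmult_le_pos; last lra.
  by apply: pow_le; have := pos_INR k.+1; lra.
pose j := (2 * D + 1 + 2 * A)%N.
pose K2 := 2 * Kw * (2 * INR j.+1) ^ j.
have K20 : 0 <= K2.
  by apply: Rmult_le_pos; [lra | apply: pow_le; have := pos_INR j.+1; lra].
pose K4 := 6 * 2 ^ k * (4 + (2 * INR (2 * A).+1) ^ (2 * A)).
have P2k : 0 < 2 ^ k by apply: pow_lt; lra.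
have K40 : 0 <= K4.
  apply: Rmult_le_pos; first lra.
  by have : 0 <= (2 * INR (2 * A).+1) ^ (2 * A); [apply: pow_le; have := pos_INR (2 * A).+1; lra | lra].
pose K5 := (2 * INR A.+1) ^ A.
have K50 : 0 <= K5 by apply: pow_le; have := pos_INR A.+1; lra.
have K30 : 0 <= 3 ^ k by apply: pow_le; lra.
exists (3 * 2 ^ k * ((C1 * C2 + 1) + K2 + Kw + K4) + (3 ^ k + 2) * (3 + K5)); split.
  apply: Rplus_le_le_0_compat; apply: Rmult_le_pos; try lra.
  by have : 0 <= C1 * C2 by [apply: Rmult_le_pos]; lra.
move=> y v y4 vy.
have yp j' : 0 < y ^ j' by apply: pow_lt; lra.
have y1p j' : 1 <= y ^ j' by apply: pow_R1_Rle; lra.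
pose h := / y ^ A; rewrite -/h.
pose Y := y ^ (2 * A).
have Yp : 0 < Y := yp _.
have YE : Y = y ^ A * y ^ A by rewrite -pow_add /Y; congr pow; lia.
have qE : h * h = / Y by rewrite /h YE; have := yp A => ?; field; lra.
rewrite qE; set q := / Y.
have q0 : 0 < q by apply: Rinv_0_lt_compat.
have qY : q * Y = 1 by rewrite /q; field; lra.
have h0 : 0 < h by apply: Rinv_0_lt_compat.
have h1 : h <= 1 by rewrite -Rinv_1; apply: Rinv_le_contravar; [lra | exact: y1p].
have ev := exp_pos v.
pose YD := y ^ D.
have YDE : YD = Y * y by rewrite /YD /D -[(_ + 1)%N]/(Nat.add _ 1) pow_add /= Rmult_1_r.
have YDp : 0 < YD := yp _.
pose eta := / YD; pose T := y ^ (2 * D).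
have TE : T = YD * YD by rewrite /T /YD -pow_add; congr pow; lia.
have Tp : 0 < T := yp _.
have ykE : y ^ k = T * (y * y) * Y.
  rewrite /k -[(_ + 2 * A)%N]/(Nat.add _ _) pow_add -[(_ + 2)%N]/(Nat.add _ _) pow_add.
  by rewrite /T /Y /=; ring.
have yk := yp k.
have eta0 : 0 < eta by apply: Rinv_0_lt_compat.
have YD4 : 4 <= YD by rewrite YDE; have : 1 <= Y := y1p _; nra.
have eta1 : eta <= 1 / 2.
  by apply: (Rmult_le_reg_r YD) => //; rewrite /eta Rinv_l; lra.
have etaq : eta <= q.
  apply: (Rmult_le_reg_r (YD * Y)); first by apply: Rmult_lt_0_compat.
  rewrite (_ : eta * (YD * Y) = Y); last by rewrite /eta; field; lra.
  rewrite (_ : q * (YD * Y) = YD); last by rewrite /q; field; lra.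
  by rewrite YDE; nra.
pose s := 1 + / y.
have iy : 0 < / y by apply: Rinv_0_lt_compat; lra.
have iy1 : / y <= 1 by rewrite -Rinv_1; apply: Rinv_le_contravar; lra.
have s12 : 1 < s <= 2 by rewrite /s; lra.
have v1 : 1 <= v by lra.
have WU := @window_unweighted g g1 k s v h s12 v1 ltac:(lra).
(* Frequencies are cut at U = T^2, so that e^{-U/T} = e^{-T} beats every power of y while [ell U]
   stays logarithmic in y. *)
have WW := @window_weighted g g1 k C1 m y v h eta T (T * T) C1p HC ltac:(lra) Tp ltac:(nra) ltac:(lra) eta0.
rewrite -/s in WW.
set SG := Cmod (\Csum_(_ <= n < _) g n) in WU *.
set SA := Cmod (\Csum_(_ <= n < _) wterm _ _ n) in WU WW.
have NB1 := @near_bound g g1 k s v eta ltac:(lra) ltac:(lra) ltac:(lra).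
have NB2 := @near_bound g g1 k s (v + h) eta ltac:(lra) ltac:(lra) ltac:(lra).
set X1 := \Rsum_(_ <= n < _) _ in NB1 WW.
set X2 := \Rsum_(_ <= n < _) _ in NB2 WW.
set W := admB k s in WW.
have Wle : W <= Kw * (y ^ k * y) by apply: admB_le; lra.
have W0 : 0 <= W.
  by apply: asum_ge0 (adm_asum (adm_lnk k (adm_g g1)) _); lra.
have UT : T * T / T = T by field; lra.
have ellT : ell (T * T) ^ m <= C2 * y.
  have -> : T * T = y ^ (4 * D) by rewrite /T -pow_add; congr pow; lia.
  by apply: ell_pow_growth; lra.
have B1 : T * (C1 * y * ell (T * T) ^ m + 1) * h <= (C1 * C2 + 1) * q * y ^ k.
  have e0 : 0 <= ell (T * T) ^ m by apply: pow_le; have := ell_ge1 (T * T); lra.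
  have a1 : C1 * y * ell (T * T) ^ m + 1 <= (C1 * C2 + 1) * (y * y).
    have : C1 * y * ell (T * T) ^ m <= C1 * y * (C2 * y) by apply: Rmult_le_compat_l => //; nra.
    nra.
  have a0 : 0 <= C1 * y * ell (T * T) ^ m + 1.
    by have : 0 <= C1 * y * ell (T * T) ^ m; [apply: Rmult_le_pos => //; nra | lra].
  rewrite (_ : (C1 * C2 + 1) * q * y ^ k = T * ((C1 * C2 + 1) * (y * y)) * 1); last first.
    by rewrite ykE (_ : _ * q * (T * (y * y) * Y) = (C1 * C2 + 1) * T * (y * y) * (q * Y)); [rewrite qY; ring | ring].
  apply: Rmult_le_compat => //; [by apply: Rmult_le_pos; lra | lra |].
  by apply: Rmult_le_compat_l => //; lra.
have B2 : 2 * T * W * exp (- (T * T / T)) * h <= K2 * q * y ^ k.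
  rewrite UT.
  have Ty : y <= T by rewrite TE YDE; have : 1 <= Y := y1p _; nra.
  have eT : exp (- T) <= exp (- (y / 2)) by apply: exp_le_mono; lra.
  have eT0 := exp_pos (- T).
  have PH := @pow_exp_half y j ltac:(lra).
  have PE : y ^ j * exp (- (y / 2)) <= (2 * INR j.+1) ^ j.
    apply: (Rle_trans _ ((2 * INR j.+1) ^ j * exp (y / 2) * exp (- (y / 2)))).
      by apply: Rmult_le_compat_r => //; left; exact: exp_pos.
    by rewrite Rmult_assoc -exp_plus Rplus_opp_r exp_0; lra.
  have yj : y ^ j = T * y * Y.
    rewrite /j -[(_ + 2 * A)%N]/(Nat.add _ _) pow_add -[(_ + 1)%N]/(Nat.add _ _) pow_add.
    by rewrite /T /Y /=; ring.
  apply: (Rle_trans _ (2 * T * (Kw * (y ^ k * y)) * exp (- (y / 2)) * 1)).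
    apply: Rmult_le_compat => //; [| lra |].
      by apply: Rmult_le_pos; [apply: Rmult_le_pos; lra | lra].
    apply: Rmult_le_compat => //; [by apply: Rmult_le_pos; lra | lra |].
    by apply: Rmult_le_compat_l => //; lra.
  rewrite (_ : 2 * T * _ * _ * 1 = 2 * Kw * (q * Y) * y ^ k * (T * y) * exp (- (y / 2))); last by rewrite qY; ring.
  rewrite (_ : 2 * Kw * (q * Y) * y ^ k * (T * y) * exp (- (y / 2)) = 2 * Kw * q * y ^ k * (y ^ j * exp (- (y / 2)))); last by rewrite yj; ring.
  rewrite (_ : K2 * q * y ^ k = 2 * Kw * q * y ^ k * (2 * INR j.+1) ^ j); last by rewrite /K2; ring.
  apply: Rmult_le_compat_l => //; apply: Rmult_le_pos; last lra.
  by apply: Rmult_le_pos; lra.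
have B3 : W / (T * eta) <= Kw * q * y ^ k.
  have Te : T * eta = YD by rewrite TE /eta; field; lra.
  rewrite Te; apply: (Rmult_le_reg_r YD) => //.
  rewrite /Rdiv Rmult_assoc Rinv_l; last lra.
  rewrite Rmult_1_r; apply: (Rle_trans _ _ _ Wle); right.
  by rewrite YDE (_ : Kw * q * y ^ k * (Y * y) = Kw * (y ^ k * y) * (q * Y)); [rewrite qY; ring | ring].
have B4 : X1 + X2 <= K4 * q * y ^ k.
  have eh : exp (- (y / 2)) <= (2 * INR (2 * A).+1) ^ (2 * A) * q.
    have PH := @pow_exp_half y (2 * A) ltac:(lra).
    apply: (Rmult_le_reg_r Y) => //; rewrite Rmult_assoc qY Rmult_1_r.
    apply: (Rle_trans _ (exp (- (y / 2)) * ((2 * INR (2 * A).+1) ^ (2 * A) * exp (y / 2)))).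
      by apply: Rmult_le_compat_l => //; left; exact: exp_pos.
    rewrite (_ : exp (- (y / 2)) * (_ * exp (y / 2)) = (2 * INR (2 * A).+1) ^ (2 * A) * (exp (- (y / 2)) * exp (y / 2))); last by ring.
    by rewrite -exp_plus Rplus_opp_l exp_0; lra.
  pose Z := 4 * eta + exp (- (y / 2)).
  have Z0 : 0 <= Z by have := exp_pos (- (y / 2)); rewrite /Z; lra.
  have Zle : Z <= (4 + (2 * INR (2 * A).+1) ^ (2 * A)) * q by rewrite /Z; lra.
  have one w : 0 <= w + 1 <= 2 * y -> y / 2 <= w ->
     3 * (w + 1) ^ k * (4 * eta + exp (- w)) <= 3 * (2 ^ k * y ^ k) * Z.
    move=> w1 w2.
    have pw : (w + 1) ^ k <= 2 ^ k * y ^ k by rewrite -Rpow_mult_distr; apply: pow_incr.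
    have pw0 : 0 <= (w + 1) ^ k by apply: pow_le; lra.
    apply: Rmult_le_compat; [lra | | lra |].
      by have := exp_pos (- w); lra.
    by rewrite /Z; apply: Rplus_le_compat_l; apply: exp_le_mono; lra.
  have o1 := one v ltac:(lra) ltac:(lra); have o2 := one (v + h) ltac:(lra) ltac:(lra).
  have p2y : 0 <= 2 ^ k * y ^ k by apply: Rmult_le_pos; lra.
  have := Rmult_le_compat_l _ _ _ p2y Zle.
  rewrite /K4; lra.
have SAle : SA <= ((C1 * C2 + 1) + K2 + Kw + K4) * q * y ^ k.
  apply: (Rle_trans _ _ _ WW); move: B1 B2 B3 B4; clear.
  set a := T * _; set b := 2 * T * W * _; set c := W / _; set d := X1 + X2 => B1 B2 B3 B4.
  lra.
have fle : exp (s * v) / v ^ k <= 3 * 2 ^ k * exp v / y ^ k.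
  have e1 : exp (s * v) <= 3 * exp v.
    rewrite (_ : s * v = v + / y * v); last by rewrite /s; ring.
    rewrite exp_plus Rmult_comm; apply: Rmult_le_compat_r; first lra.
    apply: exp_le_1_3; apply: (Rmult_le_reg_l y); first lra.
    by rewrite -Rmult_assoc Rinv_r; lra.
  have vk : (y / 2) ^ k <= v ^ k by apply: pow_incr; lra.
  have y2k : 0 < (y / 2) ^ k by apply: pow_lt; lra.
  apply: (Rle_trans _ (3 * exp v * / (y / 2) ^ k)).
    apply: Rmult_le_compat => //; [by left; exact: exp_pos | by left; apply: Rinv_0_lt_compat; lra |].
    by apply: Rinv_le_contravar.
  right; rewrite /Rdiv Rpow_mult_distr pow_inv; field; lra.
have f0 : 0 <= exp (s * v) / v ^ k.
  by apply: Rdiv_le_0_compat; [left; exact: exp_pos | apply: pow_lt; lra].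
have SA0 : 0 <= SA := Cmod_ge_0 _.
have M1 : exp (s * v) / v ^ k * SA <= 3 * 2 ^ k * ((C1 * C2 + 1) + K2 + Kw + K4) * exp v * q.
  apply: (Rle_trans _ (3 * 2 ^ k * exp v / y ^ k * (((C1 * C2 + 1) + K2 + Kw + K4) * q * y ^ k))).
    exact: Rmult_le_compat.
  by right; field; lra.
have hle : h <= K5 * exp v * q.
  have -> : h = y ^ A * q by rewrite /q -qE /h; have := yp A => ?; field; lra.
  apply: Rmult_le_compat_r; first lra.
  apply: Rle_trans (@pow_exp_half y A _) _; first lra.
  by apply: Rmult_le_compat_l => //; apply: exp_le_mono; lra.
have M2 : (3 ^ k + 2) * h * (3 * h * exp v + 1) <= (3 ^ k + 2) * (3 + K5) * exp v * q.
  rewrite (_ : (3 ^ k + 2) * h * (3 * h * exp v + 1) = (3 ^ k + 2) * (3 * exp v * (h * h) + h)); last by ring.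
  rewrite qE -/q (_ : (3 ^ k + 2) * (3 + K5) * exp v * q = (3 ^ k + 2) * (3 * exp v * q + K5 * exp v * q)); last by ring.
  apply: Rmult_le_compat_l; lra.
apply: (Rle_trans _ _ _ WU); rewrite !Rmult_plus_distr_r.
rewrite !Rmult_plus_distr_l !Rmult_plus_distr_r in M1 M2 *; lra.
Qed.

(** On the logarithmic scale the range from about y/2 to y = log x is tiled by windows of length h,
    and below it the trivial bound is enough. Since e^{v+h} >= e^v (1+h), the window errors C0 e^v
    h^2 accumulate to no more than 2 C0 e^y h. *)
Lemma twisted_sum_bound (A : nat) : exists C0 X0, 0 <= C0 /\ forall x, X0 <= x ->
  Cmod (Psum g (flo x)) <= C0 * (x / ln x ^ A).
Proof.
have [C0 [C0p H]] := window_final A.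
pose K5 := (2 * INR A.+1) ^ A.
have K50 : 0 <= K5 by apply: pow_le; have := pos_INR A.+1; lra.
exists (2 * C0 + 3 * K5), (exp 4); split; first lra.
move=> x x4; have x0 : 0 < x by have := exp_pos 4; lra.
pose y := ln x.
have xE : exp y = x by rewrite /y exp_ln.
have y4 : 4 <= y by rewrite /y -(ln_exp 4); apply: ln_le => //; exact: exp_pos.
have yA : 1 <= y ^ A by apply: pow_R1_Rle; lra.
pose h := / y ^ A.
have h0 : 0 < h by apply: Rinv_0_lt_compat; lra.
have h1 : h <= 1 by rewrite -Rinv_1; apply: Rinv_le_contravar; lra.
pose J := flo (y / 2 / h).
have [J1 J2] : INR J <= y / 2 / h < INR J + 1 by apply: flo_spec; apply: Rdiv_le_0_compat; lra.
have Jh : INR J * h <= y / 2.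
  have := Rmult_le_compat_r h _ _ (Rlt_le _ _ h0) J1.
  by rewrite (_ : y / 2 / h * h = y / 2); [| field; lra].
have Jh2 : y / 2 < INR J * h + h.
  have := Rmult_lt_compat_r h _ _ h0 J2.
  by rewrite (_ : y / 2 / h * h = y / 2); [lra | field; lra].
pose v0 := y - INR J * h.
have triv v : Cmod (Psum g (flo (exp v))) <= exp v.
  apply: Rle_trans (Cmod_sum_le _ _ _) _.
  apply: (Rle_trans _ (\Rsum_(1 <= n < (flo (exp v)).+1) 1)); first by apply: Rsum_le => n _.
  rewrite Rsum_const_nat // subn1 Rmult_1_r /=.
  by have [] := @flo_spec (exp v) ltac:(left; exact: exp_pos).
have ind i : (i <= J)%N ->
  Cmod (Psum g (flo (exp (v0 + INR i * h)))) <= 2 * C0 * exp (v0 + INR i * h) * h + exp (y / 2 + 1).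
  elim: i => [_|i IH iJ].
    rewrite INR_0 Rmult_0_l Rplus_0_r; apply: Rle_trans (triv v0) _.
    have a1 : exp v0 <= exp (y / 2 + 1) by apply: exp_le_mono; rewrite /v0; lra.
    have : 0 <= 2 * C0 * exp v0 * h.
      by apply: Rmult_le_pos; [apply: Rmult_le_pos; [lra | left; exact: exp_pos] | lra].
    lra.
  have {}IH := IH (ltnW iJ); set v := v0 + INR i * h in IH.
  have iJ' : INR i + 1 <= INR J by rewrite -S_INR; apply: le_INR; lia.
  have i0 := pos_INR i.
  have ih : INR i * h + h <= INR J * h by nra.
  have ih0 : 0 <= INR i * h by nra.
  have vE : v0 + INR i.+1 * h = v + h by rewrite S_INR /v; ring.
  have Hw := H y v y4 ltac:(rewrite /v /v0; lra); rewrite -/h in Hw.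
  have mono : (flo (exp v) <= flo (exp (v + h)))%N.
    by apply: flo_mono; [left; exact: exp_pos | apply: exp_le_mono; lra].
  rewrite vE.
  have -> : Psum g (flo (exp (v + h))) = (Psum g (flo (exp v)) + (Psum g (flo (exp (v + h))) - Psum g (flo (exp v))))%C by ring.
  rewrite Psum_diff //; apply: Rle_trans (Cmod_triangle _ _) _.
  have E : exp v * (1 + h) <= exp (v + h).
    by rewrite exp_plus; apply: Rmult_le_compat_l; [left; exact: exp_pos | exact: exp_ineq1_le].
  have p : 0 <= 2 * C0 * h by apply: Rmult_le_pos; lra.
  have := Rmult_le_compat_l _ _ _ p E.
  have : 0 <= C0 * exp v * (h * h).
    by apply: Rmult_le_pos; [apply: Rmult_le_pos; [lra | left; exact: exp_pos] | nra].
  lra.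
have := ind J (leqnn J).
rewrite (_ : v0 + INR J * h = y); last by rewrite /v0; ring.
rewrite xE => HJ; apply: (Rle_trans _ _ _ HJ).
rewrite -/y /Rdiv -/h Rmult_plus_distr_r Rmult_assoc; apply: Rplus_le_compat_l.
have e1 : exp (y / 2 + 1) <= 3 * exp (y / 2).
  by rewrite exp_plus Rmult_comm; apply: Rmult_le_compat_r; [left; exact: exp_pos | exact: exp_le_3].
have e2 : exp (y / 2) <= K5 * (x * h).
  apply: (Rmult_le_reg_r (y ^ A)); first lra.
  rewrite (_ : K5 * (x * h) * y ^ A = K5 * x); last by rewrite /h; field; lra.
  apply: (Rle_trans _ (exp (y / 2) * (K5 * exp (y / 2)))).
    by apply: Rmult_le_compat_l; [left; exact: exp_pos | apply: pow_exp_half; lra].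
  right; rewrite -xE (_ : y = y / 2 + y / 2); last by field.
  rewrite [in RHS]exp_plus (_ : (y / 2 + y / 2) / 2 = y / 2); last by field.
  ring.
lra.
Qed.
End Final.

(** * Characters modulo a prime *)

Lemma mulmod_inj u M i j : (0 < M)%N -> coprime M u -> (i < M)%N -> (j < M)%N ->
  (u * i = u * j %[mod M])%N -> i = j.
Proof.
move=> M0 cu; wlog ij : i j / (i <= j)%N.
  by move=> W iM jM E; case/orP: (leq_total i j) => H; [exact: W | symmetry; apply: W].
move=> iM jM /esym /eqP; rewrite eqn_mod_dvd; last by rewrite leq_mul2l ij orbT.
rewrite -mulnBr Gauss_dvdr // => /dvdn_leq H.
by have [|] := posnP (j - i); [lia | move/H; lia].
Qed.

(** Multiplication by u permutes the residues, so the sum S over a period satisfies S = psi(u) S. At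
    the residue 0, multiplicativity is borrowed from M by periodicity. *)
Lemma zero_mean_of_nontrivial M psi u : (0 < M)%N -> cmult psi ->
  (forall n, psi (n + M)%N = psi n) -> (0 < u)%N -> coprime M u -> psi u <> RtoC 1 ->
  zero_mean M psi.
Proof.
move=> M0 [p1 pM pl] per u0 cu nu; split=> //.
have perk n k : psi (n + k * M)%N = psi n.
  elim: k => [|k IH]; first by rewrite mul0n addn0.
  by rewrite mulSn addnCA addnC per.
have pmod n : psi (n %% M)%N = psi n.
  by rewrite [in RHS](divn_eq n M) addnC perk.
have pu i : psi (u * i)%N = (psi u * psi i)%C.
  case: i => [|i]; last by apply: pM.
  by rewrite muln0 -{1}(perk 0%N u) add0n pM // -(per 0%N) add0n.
set S := \Csum_(0 <= i < M) psi i.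
have SE : S = (psi u * S)%C.
  rewrite {1}/S big_mkord.
  pose f (i : 'I_M) : 'I_M := Ordinal (ltn_pmod (u * i) M0).
  have finj : injective f.
    move=> i j /(congr1 val) /= E; apply: val_inj => /=.
    exact: (mulmod_inj M0 cu (ltn_ord i) (ltn_ord j)).
  rewrite (reindex_inj finj) /=.
  under eq_bigr => i _ do rewrite pmod pu.
  by rewrite -big_distrr /= /S big_mkord.
have E : ((RtoC 1 - psi u) * S = RtoC 0)%C by rewrite (_ : (RtoC 1 - psi u) * S = S - psi u * S)%C; [rewrite -SE; ring | ring].
have nz : (RtoC 1 - psi u <> RtoC 0)%C.
  move=> H; apply: nu; rewrite (_ : psi u = RtoC 1 - (RtoC 1 - psi u))%C; last by ring.
  by rewrite H; ring.
rewrite (_ : S = (RtoC 1 - psi u) * S / (RtoC 1 - psi u))%C; last by field.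
by rewrite E; field.
Qed.

Section Characters.
Variables (q gen : nat).
Hypothesis qp : prime q.
Hypothesis q4 : (q %% 4 = 1)%N.
Hypothesis Hgen : forall n, ~~ (q %| n)%N -> exists i, (i < q.-1)%N /\ (n = gen ^ i %[mod q])%N.
Hypothesis Hord : forall i, (gen ^ i = 1 %[mod q])%N <-> (q.-1 %| i)%N.

Let q5 : (4 < q)%N.
Proof.
have := prime_gt1 qp; have := divn_eq q 4; rewrite q4.
case: (q %/ 4)%N => [|k]; lia.
Qed.

Lemma gen_ndvd : ~~ (q %| gen)%N.
Proof.
apply/negP => qg; have /Hord : (q.-1 %| q.-1)%N by [].
rewrite -(prednK (_ : 0 < q.-1)%N); last by lia.
rewrite expnS -modnMml (eqP qg) mul0n mod0n modn_small //; lia.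
Qed.

Lemma gen_gt0 : (0 < gen)%N.
Proof. by case: (gen) gen_ndvd; rewrite ?dvdn0. Qed.

Lemma gen_pow_inj a b : (gen ^ a = gen ^ b %[mod q])%N -> (a = b %[mod q.-1])%N.
Proof.
wlog ab : a b / (a <= b)%N.
  by move=> W E; case/orP: (leq_total a b) => H; [exact: W | symmetry; apply: W].
move=> /esym /eqP; rewrite eqn_mod_dvd; last first.
  by rewrite leq_exp2l // ltn_neqAle gen_gt0 andbT; apply/negP => /eqP E; have := Hord 1; rewrite -E exp1n dvdn1 => -[/(_ erefl) /eqP]; lia.
rewrite -(subnKC ab) expnD -[X in (_ - X)%N]muln1 -mulnBr Euclid_dvdM //.
rewrite Euclid_dvdX // (negbTE gen_ndvd) andFb /= => H.
have /Hord : (gen ^ (b - a) = 1 %[mod q])%N.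
  by apply/eqP; rewrite eqn_mod_dvd // expn_gt0 gen_gt0.
by move=> /dvdnP [c ->]; rewrite addnC modnMDl.
Qed.

(** The discrete logarithm to the base [gen]. Several exponents below q may qualify; by
    [gen_pow_inj] they agree modulo q - 1, which is all that [om] sees. The default 0 is for
    multiples of q. *)
Definition ind (n : nat) : nat :=
  if [pick i : 'I_q | n == gen ^ i %[mod q]] is Some i then nat_of_ord i else 0%N.

Lemma indP n : ~~ (q %| n)%N -> (gen ^ ind n = n %[mod q])%N.
Proof.
move=> qn; rewrite /ind; case: pickP => [i /eqP -> //|H].
have [i [iq E]] := Hgen qn.
have iq' : (i < q)%N by lia.
by have := H (Ordinal iq'); rewrite /= E eqxx.
Qed.

Definition om (m : nat) : C :=
  (cos (2 * PI / INR q.-1 * INR m), sin (2 * PI / INR q.-1 * INR m)).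

Lemma omD m n : om (m + n) = (om m * om n)%C.
Proof.
rewrite /om plus_INR Rmult_plus_distr_l cos_plus sin_plus /Cmult /=; congr (_, _); ring.
Qed.

Lemma om0 : om 0 = RtoC 1.
Proof. by rewrite /om INR_0 Rmult_0_r cos_0 sin_0. Qed.

Lemma q1_pos : 0 < INR q.-1.
Proof. by apply: lt_0_INR; lia. Qed.

Lemma om_period : om q.-1 = RtoC 1.
Proof.
have Q := q1_pos; rewrite /om (_ : 2 * PI / INR q.-1 * INR q.-1 = 2 * PI); last by field; lra.
by rewrite cos_2PI sin_2PI.
Qed.

Lemma om_mul k : om (k * q.-1) = RtoC 1.
Proof.
elim: k => [|k IH]; first by rewrite mul0n om0.
by rewrite mulSn omD IH om_period; ring.
Qed.

Lemma om_mod m n : (m = n %[mod q.-1])%N -> om m = om n.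
Proof.
move=> E; rewrite (divn_eq m q.-1) (divn_eq n q.-1) E !omD !om_mul; ring.
Qed.

Lemma Cmod_om m : Cmod (om m) = 1.
Proof.
rewrite /om /Cmod /= -[RHS]sqrt_1; congr sqrt.
have := sin2_cos2 (2 * PI / INR q.-1 * INR m); rewrite /Rsqr; lra.
Qed.

Lemma cos_eq1 x : 0 <= x < 2 * PI -> cos x = 1 -> x = 0.
Proof.
move=> x02 cx; have P0 := PI_RGT_0.
have s2 : sin (x / 2) = 0.
  have E : cos x = 1 - 2 * sin (x / 2) * sin (x / 2).
    by rewrite -cos_2a_sin; congr cos; field.
  have : sin (x / 2) * sin (x / 2) = 0 by lra.
  by move/Rmult_integral; case.
have [//|x0] := Req_dec x 0.
by have := @sin_gt_0 (x / 2) ltac:(lra) ltac:(lra); lra.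
Qed.

Lemma om_eq1 m : om m = RtoC 1 -> (q.-1 %| m)%N.
Proof.
move=> E; have Q := q1_pos; have P0 := PI_RGT_0.
have E' : om (m %% q.-1) = RtoC 1 by rewrite (@om_mod _ m) // modn_mod.
have lt : (m %% q.-1 < q.-1)%N by rewrite ltn_mod; lia.
set r := (m %% q.-1)%N in E' lt.
have r0 := pos_INR r.
have rq : INR r < INR q.-1 by apply: lt_INR; lia.
have c1 : cos (2 * PI / INR q.-1 * INR r) = 1 by move/(congr1 fst): E'.
have d0 : 0 < 2 * PI / INR q.-1 by apply: Rdiv_lt_0_compat; lra.
have := @cos_eq1 (2 * PI / INR q.-1 * INR r) _ c1.
have up : 2 * PI / INR q.-1 * INR r < 2 * PI.
  have := Rmult_lt_compat_l _ _ _ d0 rq.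
  by rewrite (_ : 2 * PI / INR q.-1 * INR q.-1 = 2 * PI) //; field; lra.
move/(_ ltac:(split; [nra | lra])) => /Rmult_integral [|E0]; first lra.
by rewrite /dvdn -/r; apply/eqP; apply: INR_eq; rewrite E0 INR_0.
Qed.

(** The character that sends [gen] to the j-th power of a primitive (q-1)-th root of unity; j = 0 is
    the principal one, and j < q - 1 lists them all. *)
Definition chr (j n : nat) : C := if (q %| n)%N then RtoC 0 else om (j * ind n).

Lemma chr_mod j m n : (m = n %[mod q])%N -> chr j m = chr j n.
Proof.
move=> E; rewrite /chr.
have D : (q %| m)%N = (q %| n)%N by rewrite /dvdn E.
rewrite D; case: (boolP (q %| n)%N) => // qn.
have qm : ~~ (q %| m)%N by rewrite D.
have I : (ind m = ind n %[mod q.-1])%N by apply: gen_pow_inj; rewrite !indP.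
by apply: om_mod; rewrite -modnMmr I modnMmr.
Qed.

Lemma chrM j m n : chr j (m * n) = (chr j m * chr j n)%C.
Proof.
rewrite /chr Euclid_dvdM //.
case: (boolP (q %| m)%N) => qm /=; first by ring.
case: (boolP (q %| n)%N) => qn /=; first by ring.
have I : (ind (m * n) = ind m + ind n %[mod q.-1])%N.
  apply: gen_pow_inj; rewrite indP ?Euclid_dvdM ?negb_or ?qm //.
  by rewrite expnD -[RHS]modnMm !indP // modnMm.
by rewrite -omD -mulnDr; apply: om_mod; rewrite -modnMmr I modnMmr.
Qed.

Lemma ndvd_1 : ~~ (q %| 1)%N.
Proof. by rewrite dvdn1; apply/negP => /eqP; lia. Qed.

Lemma chr1 j : chr j 1 = RtoC 1.
Proof.
rewrite /chr (negbTE ndvd_1) (@om_mod _ 0%N) ?om0 //.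
have /Hord : (gen ^ ind 1 = 1 %[mod q])%N by apply: indP; exact: ndvd_1.
by move=> H; rewrite mod0n; apply/eqP; rewrite -/(dvdn _ _) dvdn_mull.
Qed.

Lemma chr_gen j : chr j gen = om j.
Proof.
rewrite /chr (negbTE gen_ndvd); apply: om_mod.
have I : (ind gen = 1 %[mod q.-1])%N.
  by apply: gen_pow_inj; rewrite expn1; apply: indP; exact: gen_ndvd.
by rewrite -modnMmr I modnMmr muln1.
Qed.

Lemma chr_le1 j n : Cmod (chr j n) <= 1.
Proof. by rewrite /chr; case: ifP => _; rewrite ?Cmod_0 ?Cmod_om; lra. Qed.

Lemma cmult_chr j : cmult (chr j).
Proof. by split; [exact: chr1 | move=> m n _ _; exact: chrM | exact: chr_le1]. Qed.

Lemma cmult_mul a b : cmult a -> cmult b -> cmult (fun n => a n * b n)%C.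
Proof.
move=> [a1 aM al] [b1 bM bl]; split; first by rewrite a1 b1; ring.
- by move=> m n m0 n0; rewrite aM // bM //; ring.
- by move=> n; rewrite Cmod_mult; have := al n; have := bl n; have := Cmod_ge_0 (a n); have := Cmod_ge_0 (b n); nra.
Qed.

Lemma cmult_chi4 : cmult (fun n => RtoC (chi4 n)).
Proof.
split=> //; first by move=> m n _ _; rewrite chi4M RtoC_mult.
move=> n; rewrite Cmod_R; apply: Rabs_le; case: (chi4_val n) => [->|[->|->]]; lra.
Qed.

(** A geometric sum whose ratio is a (q-1)-th root of unity, equal to 1 only if m is 1 mod q. *)
Lemma chr_orth m : ~~ (q %| m)%N ->
  \Csum_(0 <= j < q.-1) chr j m = if (m == 1 %[mod q])%N then RtoC (INR q.-1) else RtoC 0.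
Proof.
move=> qm; have Q := q1_pos.
case: ifP => [/eqP E|E].
  rewrite (eq_bigr (fun _ => RtoC 1)); last by move=> j _; rewrite (chr_mod _ E) chr1.
  by rewrite -RtoC_sum Rsum_const_nat // subn0 Rmult_1_r.
set z := om (ind m).
have zn1 : z <> RtoC 1.
  move=> /om_eq1 /Hord H; move/eqP: E; apply.
  by rewrite -H indP.
have nz : (RtoC 1 - z <> RtoC 0)%C.
  move=> H; apply: zn1; rewrite (_ : z = RtoC 1 - (RtoC 1 - z))%C; last by ring.
  by rewrite H; ring.
have geo K : ((RtoC 1 - z) * (\Csum_(0 <= j < K) chr j m) = RtoC 1 - om (K * ind m))%C.
  elim: K => [|K IH]; first by rewrite big_geq // mul0n om0; ring.
  rewrite big_nat_recr //= CmulDr IH mulSn omD -/z.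
  by rewrite {1}/chr (negbTE qm); ring.
have := geo q.-1; rewrite mulnC om_mul => G.
rewrite (_ : \Csum_(0 <= j < q.-1) chr j m = (RtoC 1 - z) * (\Csum_(0 <= j < q.-1) chr j m) / (RtoC 1 - z))%C; last by field.
by rewrite G; field.
Qed.

Lemma chr_per j n : chr j (n + q) = chr j n.
Proof. by apply: chr_mod; rewrite modnDr. Qed.

Lemma chr_per4 j n : chr j (n + 4 * q) = chr j n.
Proof. by apply: chr_mod; rewrite addnC modnMDl. Qed.

Lemma chi4_per n : chi4 (n + 4 * q) = chi4 n.
Proof. by rewrite -chi4_mod addnC mulnC modnMDl chi4_mod. Qed.

Lemma coprime_4q u : odd u -> ~~ (q %| u)%N -> coprime (4 * q) u.
Proof.
move=> ou qu; rewrite coprimeMl; apply/andP; split; last by rewrite prime_coprime.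
by rewrite -[4%N]/(2 ^ 2)%N coprimeXl // prime_coprime // dvdn2 negbK.
Qed.

Lemma q_odd : odd q.
Proof. by have := divn_eq q 4; rewrite q4; lia. Qed.

(** 2q + 1 is 1 mod q and 3 mod 4, so it witnesses nontriviality for every j, including j = 0. *)
Lemma chr_chi4_zm j : zero_mean (4 * q) (fun n => chr j n * RtoC (chi4 n))%C.
Proof.
apply: (@zero_mean_of_nontrivial _ _ (2 * q + 1)%N).
- lia.
- exact: cmult_mul (cmult_chr j) cmult_chi4.
- by move=> n; rewrite chr_per4 chi4_per.
- lia.
- apply: coprime_4q; first by rewrite oddD oddM.
  by rewrite dvdn_addr ?dvdn_mull // ndvd_1.
- rewrite (@chr_mod j _ 1); last by rewrite modnMDl.
  rewrite chr1 (_ : chi4 (2 * q + 1) = -1); last first.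
    by rewrite /chi4 (_ : ((2 * q + 1) %% 4 = 3)%N) //; have := divn_eq q 4; rewrite q4; lia.
  by rewrite Cmult_1_l => /(congr1 fst) /=; lra.
Qed.

Lemma chr_zm j : (0 < j < q.-1)%N -> zero_mean q (chr j).
Proof.
move=> /andP[j0 jq]; apply: (@zero_mean_of_nontrivial _ _ gen).
- lia.
- exact: cmult_chr.
- exact: chr_per.
- exact: gen_gt0.
- by rewrite prime_coprime // gen_ndvd.
- by rewrite chr_gen => /om_eq1 /dvdn_leq; lia.
Qed.

Lemma chr_sq_zm j : om (2 * j) <> RtoC 1 -> zero_mean q (fun n => chr j n * chr j n)%C.
Proof.
move=> nj; apply: (@zero_mean_of_nontrivial _ _ gen).
- lia.
- exact: cmult_sqr (cmult_chr j).
- by move=> n; rewrite chr_per.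
- exact: gen_gt0.
- by rewrite prime_coprime // gen_ndvd.
- by rewrite chr_gen -omD addnn -mul2n.
Qed.

Lemma chr_chi4_sq_zm j : om (2 * j) <> RtoC 1 ->
  zero_mean (4 * q) (fun n => (chr j n * RtoC (chi4 n)) * (chr j n * RtoC (chi4 n)))%C.
Proof.
(* An odd representative of [gen] mod q, so that chi_4(u)^2 = 1 and only the square of [chr j] is
   left at u. *)
move=> nj; pose u := if odd gen then gen else (gen + q)%N.
have ug : (u = gen %[mod q])%N by rewrite /u; case: ifP => // _; rewrite modnDr.
have ou : odd u by rewrite /u; case: ifP => // og; rewrite oddD og q_odd.
apply: (@zero_mean_of_nontrivial _ _ u).
- lia.
- by apply: cmult_sqr; apply: cmult_mul (cmult_chr j) cmult_chi4.
- by move=> n; rewrite chr_per4 chi4_per.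
- by move: ou; case: (u).
- by apply: coprime_4q => //; rewrite /dvdn ug -/(dvdn _ _) gen_ndvd.
- rewrite (chr_mod j ug) chr_gen.
  have c2 : chi4 u * chi4 u = 1.
    have : (u %% 4 < 4)%N by rewrite ltn_mod.
    have : odd (u %% 4) by have := divn_eq u 4; move: ou; lia.
    by rewrite /chi4; case: (u %% 4)%N => [|[|[|[|?]]]] //= _ _; ring.
  rewrite (_ : (om j * RtoC (chi4 u) * (om j * RtoC (chi4 u)) = om j * om j * RtoC (chi4 u * chi4 u))%C); last by rewrite RtoC_mult; ring.
  by rewrite c2 -omD addnn -mul2n Cmult_1_r.
Qed.

Lemma chr_real j : om (2 * j) = RtoC 1 ->
  forall n, chr j n = RtoC 1 \/ chr j n = RtoC 0 \/ chr j n = RtoC (-1).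
Proof.
move=> E n; rewrite /chr; case: ifP => _; first by right; left.
have : (om (j * ind n) * om (j * ind n) = RtoC 1)%C.
  rewrite -omD addnn -mul2n mulnA; elim: (ind n) => [|k IH]; first by rewrite muln0 om0.
  by rewrite mulnS omD E IH; ring.
set z := om _ => H.
have [z1|z1] := excluded_middle_informative (z = RtoC 1); first by left.
right; right.
have nz : (z - RtoC 1 <> RtoC 0)%C.
  move=> H2; apply: z1; rewrite (_ : z = (z - RtoC 1) + RtoC 1)%C; last by ring.
  by rewrite H2; ring.
have H3 : ((z - RtoC 1) * (z + RtoC 1) = RtoC 0)%C.
  by rewrite (_ : (z - RtoC 1) * (z + RtoC 1) = z * z - RtoC 1)%C; [rewrite H; ring | ring].
rewrite (_ : z = (z - RtoC 1) * (z + RtoC 1) / (z - RtoC 1) - RtoC 1)%C; last by field.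
rewrite H3 (_ : RtoC (-1) = - RtoC 1)%C; first by field.
by rewrite -RtoC_opp; congr RtoC; ring.
Qed.

Lemma good_real psi M : cmult psi -> zero_mean M psi ->
  (forall n, psi n = RtoC 1 \/ psi n = RtoC 0 \/ psi n = RtoC (-1)) -> good_char psi.
Proof.
move=> cp zp val.
pose chi n := Re (psi n).
have E : psi = fun n => RtoC (chi n).
  apply: functional_extensionality => n; rewrite /chi.
  by case: (val n) => [->|[->|->]].
split=> //; first by exists M.
rewrite E; apply: (@L_lower_real chi M).
- by move=> n; rewrite /chi; case: (val n) => [->|[->|->]] /=; auto.
- by rewrite /chi (cmult_1 cp).
- move=> m n m0 n0; rewrite /chi (cmult_M cp m0 n0).
  by case: (val m) => [->|[->|->]]; case: (val n) => [->|[->|->]] /=; ring.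
- by rewrite -E.
Qed.

Lemma good_chr j : (0 < j < q.-1)%N -> good_char (chr j).
Proof.
move=> jq; have [E|E] := excluded_middle_informative (om (2 * j) = RtoC 1).
  exact: good_real (cmult_chr j) (chr_zm jq) (chr_real E).
split; [exact: cmult_chr | by exists q; exact: chr_zm |].
exact: L_lower_complex (cmult_chr j) (chr_zm jq) (chr_sq_zm E).
Qed.

Lemma good_chr_chi4 j : good_char (fun n => chr j n * RtoC (chi4 n))%C.
Proof.
have cm := cmult_mul (cmult_chr j) cmult_chi4.
have [E|E] := excluded_middle_informative (om (2 * j) = RtoC 1).
  apply: good_real cm (chr_chi4_zm j) _ => n.
  case: (chr_real E n) => [->|[->|->]]; case: (chi4_val n) => [->|[->|->]];
    rewrite -RtoC_mult;
    first [left; congr RtoC; ring | right; left; congr RtoC; ring | right; right; congr RtoC; ring].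
split=> //; first by exists (4 * q)%N; exact: chr_chi4_zm.
exact: L_lower_complex cm (chr_chi4_zm j) (chr_chi4_sq_zm E).
Qed.

Lemma chr_sum_bound j (A : nat) : (0 < j < q.-1)%N -> exists C0 X0, 0 <= C0 /\
  forall x, X0 <= x -> Cmod (Psum (fun n => chr j n * RtoC (indE n))%C (flo x)) <= C0 * (x / ln x ^ A).
Proof.
move=> jq; apply: twisted_sum_bound.
  move=> n; rewrite Cmod_mult Cmod_R; have := indE_01 n => h.
  by rewrite Rabs_pos_eq; last lra; have := chr_le1 j n; have := Cmod_ge_0 (chr j n); nra.
exact: polylog_twisted_E (good_chr jq) (good_chr_chi4 j).
Qed.
End Characters.

(** * Asymptotic expansions *)

(** The coefficient of z^i in (1-z)^{-b}. The recursion in b mirrors the derivative b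
    (1-z)^{-b-1}. *)
Fixpoint binc (i : nat) (b : R) : R :=
  match i with
  | 0%N => 1
  | i'.+1 => b * binc i' (b + 1) / INR i
  end.

Lemma Rpower_pow1 z b : 0 <= z <= 1 / 2 -> 0 <= b -> 0 < Rpower (1 - z) (- b) <= Rpower 2 b.
Proof.
move=> z01 b0; split; first exact: exp_pos.
rewrite /Rpower; apply: exp_le_mono.
have l1 : - ln (1 - z) <= ln 2.
  rewrite -ln_Rinv; last lra.
  apply: ln_le; first by apply: Rinv_0_lt_compat; lra.
  by apply: (Rmult_le_reg_r (1 - z)); [lra | rewrite Rinv_l; lra].
nra.
Qed.

(** The derivative of the remainder of order m+1 at b is b times the remainder of order m at b+1, so
    each induction step is one integration from 0. The range z <= 1/2 bounds the initial (1-z)^{-b}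
    by 2^b. *)
Lemma binom_expand m b : 0 <= b -> exists C0, 0 <= C0 /\ forall z, 0 <= z <= 1 / 2 ->
  Rabs (Rpower (1 - z) (- b) - \Rsum_(0 <= i < m) (binc i b * z ^ i)) <= C0 * z ^ m.
Proof.
elim: m b => [|m IH] b b0.
  exists (Rpower 2 b); split; first by left; exact: exp_pos.
  move=> z z01; rewrite big_geq // Rminus_0_r pow_O Rmult_1_r.
  by have [h1 h2] := Rpower_pow1 z01 b0; rewrite Rabs_pos_eq; lra.
have [C0 [C0p H]] := IH (b + 1) ltac:(lra).
have m1 : 0 < INR m.+1 by apply: lt_0_INR; lia.
exists (b * C0 / INR m.+1); split; first by apply: Rdiv_le_0_compat => //; nra.
move=> z z01.
pose F z := Rpower (1 - z) (- b) - \Rsum_(0 <= i < m.+1) (binc i b * z ^ i).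
pose f z := b * (Rpower (1 - z) (- (b + 1)) - \Rsum_(0 <= i < m) (binc i (b + 1) * z ^ i)).
have F0 : F 0 = 0.
  rewrite /F Rminus_0_r /Rpower ln_1 Rmult_0_r exp_0 big_nat_recl // pow_O /=.
  rewrite big1 => [|i _]; last by rewrite /=; ring.
  ring.
have D t : 0 <= t <= z -> is_derive F t (f t).
  move=> tz; rewrite /F.
  have -> : f t = - (- b * Rpower (1 - t) (- (b + 1))) - \Rsum_(0 <= i < m.+1) (binc i b * (INR i * t ^ (Nat.pred i))).
    rewrite big_nat_recl // INR_0 Rmult_0_l Rmult_0_r Rplus_0_l /f Rmult_minus_distr_l big_distrr /=.
    congr (_ - _); first by ring.
    apply: eq_bigr => i _; have : 0 < INR i.+1 by apply: lt_0_INR; lia.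
    by move=> i0; field; lra.
  apply: is_derive_minus.
    rewrite /Rpower; auto_derive; first lra.
    rewrite (_ : - (b + 1) * ln (1 - t) = - b * ln (1 - t) + - ln (1 - t)); last by ring.
    rewrite exp_plus exp_Ropp exp_ln; last lra.
    rewrite (_ : 1 + - t = 1 - t); last by ring.
    by field; lra.
  apply: (@is_derive_ext _ _ (fun t => \Rsum_(0 <= i < m.+1) (binc i b * t ^ i))) => //.
  apply: is_derive_Rsum => i; apply: is_derive_scal.
  have := @is_derive_pow (fun x => x) i t 1 (is_derive_id _).
  by rewrite Rmult_1_r.
have := @Rabs_mean_value F f (fun z => b * C0 / INR m.+1 * z ^ m.+1) (fun z => b * (C0 * z ^ m)) 0 z ltac:(lra) D.
rewrite F0 Rminus_0_r -[0 ^ m.+1]/(0 * 0 ^ m) Rmult_0_l Rmult_0_r Rminus_0_r; apply.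
- move=> t tz; evar_last.
    by apply: is_derive_scal; apply: (@is_derive_pow (fun x => x) m.+1 t 1 (is_derive_id _)).
  by rewrite /=; field; lra.
- move=> t tz; rewrite /f Rabs_mult (Rabs_pos_eq b) //.
  by apply: Rmult_le_compat_l => //; apply: H; lra.
Qed.

Lemma Rpower_shift b lam y i : 0 < y -> 
  (lam / y) ^ i / Rpower y b = lam ^ i / Rpower y (b + INR i).
Proof.
move=> y0; rewrite Rpower_plus Rpower_pow //.
have := exp_pos (b * ln y); rewrite -/(Rpower y b) => p.
have yi : 0 < y ^ i by apply: pow_lt.
by rewrite /Rdiv Rpow_mult_distr pow_inv; field; lra.
Qed.

Lemma shift_one lam b m : 0 <= lam -> 0 <= b -> exists C0, 0 <= C0 /\ forall y, 2 * lam + 1 <= y ->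
  Rabs (/ Rpower (y - lam) b - \Rsum_(0 <= i < m) (binc i b * lam ^ i / Rpower y (b + INR i))) <=
  C0 / Rpower y (b + INR m).
Proof.
move=> l0 b0; have [C0 [C0p H]] := binom_expand m b0.
exists (C0 * lam ^ m); split; first by apply: Rmult_le_pos => //; exact: pow_le.
move=> y yl; have y0 : 0 < y by lra.
pose z := lam / y.
have z0 : 0 <= z by apply: Rdiv_le_0_compat.
have z1 : z <= 1 / 2.
  by apply: (Rmult_le_reg_r y) => //; rewrite /z /Rdiv Rmult_assoc Rinv_l; lra.
have p0 : 0 < Rpower y b := exp_pos _.
have E1 : / Rpower (y - lam) b = Rpower (1 - z) (- b) / Rpower y b.
  have -> : y - lam = y * (1 - z) by rewrite /z; field; lra.
  rewrite -Rpower_mult_distr; [|lra|lra].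
  rewrite Rpower_Ropp; have p1 : 0 < Rpower (1 - z) b := exp_pos _.
  by field; lra.
have E2 : \Rsum_(0 <= i < m) (binc i b * lam ^ i / Rpower y (b + INR i)) =
    (\Rsum_(0 <= i < m) (binc i b * z ^ i)) / Rpower y b.
  rewrite /Rdiv big_distrl /=; apply: eq_bigr => i _.
  have := @Rpower_shift b lam y i y0; rewrite -/z /Rdiv => E.
  by rewrite Rmult_assoc -E; ring.
rewrite E1 E2 /Rdiv -Rmult_minus_distr_r Rabs_mult -!/(Rdiv _ _).
have ip : 0 < / Rpower y b by apply: Rinv_0_lt_compat.
rewrite (Rabs_pos_eq (/ Rpower y b)); last lra.
have -> : C0 * lam ^ m / Rpower y (b + INR m) = C0 * z ^ m / Rpower y b.
  by have := @Rpower_shift b lam y m y0; rewrite -/z /Rdiv => E; rewrite Rmult_assoc -E; ring.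
apply: Rmult_le_compat_r; first by left; apply: Rinv_0_lt_compat.
by apply: H.
Qed.

(** The coefficients obtained by re-expanding the sum of c_j (y - lam)^{-1/2-j} in powers of 1/y. *)
Definition shiftc (lam : R) (c : nat -> R) (l : nat) : R :=
  \Rsum_(0 <= j < l.+1) (c j * binc (l - j) (1/2 + INR j) * lam ^ (l - j)).

Lemma triangle_sum (F : nat -> nat -> R) n :
  \Rsum_(0 <= j < n) \Rsum_(0 <= i < n - j) F j i =
  \Rsum_(0 <= l < n) \Rsum_(0 <= j < l.+1) F j (l - j)%N.
Proof.
elim: n => [|n IH]; first by rewrite !big_geq.
rewrite [RHS]big_nat_recr //= -IH.
transitivity (\Rsum_(0 <= j < n.+1) (\Rsum_(0 <= i < n - j) F j i + F j (n - j)%N)).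
  by apply: eq_big_nat => j /andP[_ jn]; rewrite subSn // big_nat_recr.
rewrite big_split /=; congr Rplus.
by rewrite big_nat_recr //= subnn [X in _ + X]big_geq // Rplus_0_r.
Qed.

(** The term of index j is expanded to J + 1 - j terms, so that every remainder has the same order
    y^{-J-3/2}. *)
Lemma shift_expansion lam c J : 0 <= lam -> exists C0, 0 <= C0 /\ forall y, 2 * lam + 1 <= y ->
  Rabs (\Rsum_(0 <= j < J.+1) (c j / Rpower (y - lam) (1/2 + INR j)) -
        \Rsum_(0 <= l < J.+1) (shiftc lam c l / Rpower y (1/2 + INR l))) <=
  C0 / Rpower y (INR J + 3/2).
Proof.
move=> l0.
have term j : (j <= J)%N -> exists C0, 0 <= C0 /\ forall y, 2 * lam + 1 <= y ->
    Rabs (c j / Rpower (y - lam) (1/2 + INR j) -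
      \Rsum_(0 <= i < J.+1 - j) (c j * binc i (1/2 + INR j) * lam ^ i / Rpower y (1/2 + INR j + INR i))) <=
    C0 / Rpower y (INR J + 3/2).
  move=> jJ; have [C0 [C0p H]] := @shift_one lam (1/2 + INR j) (J.+1 - j) l0 ltac:(have := pos_INR j; lra).
  exists (Rabs (c j) * C0); split; first by apply: Rmult_le_pos => //; exact: Rabs_pos.
  move=> y yl; have {H} := H y yl.
  have -> : 1 / 2 + INR j + INR (J.+1 - j) = INR J + 3 / 2.
    by rewrite minus_INR ?S_INR; [field | lia].
  move=> H.
  have -> : c j / Rpower (y - lam) (1/2 + INR j) -
      \Rsum_(0 <= i < J.+1 - j) (c j * binc i (1/2 + INR j) * lam ^ i / Rpower y (1/2 + INR j + INR i)) =
     c j * (/ Rpower (y - lam) (1/2 + INR j) -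
      \Rsum_(0 <= i < J.+1 - j) (binc i (1/2 + INR j) * lam ^ i / Rpower y (1/2 + INR j + INR i))).
    rewrite Rmult_minus_distr_l big_distrr /=; congr (_ - _).
    by apply: eq_bigr => i _; rewrite /Rdiv; ring.
  rewrite Rabs_mult /Rdiv Rmult_assoc; apply: Rmult_le_compat_l; first exact: Rabs_pos.
  exact: H.
have acc n : (n <= J.+1)%N -> exists C0, 0 <= C0 /\ forall y, 2 * lam + 1 <= y ->
    Rabs (\Rsum_(0 <= j < n) (c j / Rpower (y - lam) (1/2 + INR j)) -
      \Rsum_(0 <= j < n) \Rsum_(0 <= i < J.+1 - j) (c j * binc i (1/2 + INR j) * lam ^ i / Rpower y (1/2 + INR j + INR i))) <=
    C0 / Rpower y (INR J + 3/2).
  elim: n => [_|n IH nJ].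
    by exists 0; split; [lra | move=> y _; rewrite !big_geq // Rminus_0_r Rabs_R0 /Rdiv Rmult_0_l; lra].
  have [C1 [C1p H1]] := IH (ltnW nJ); have [C2 [C2p H2]] := term n nJ.
  exists (C1 + C2); split; first lra.
  move=> y yl; have h1 := H1 y yl; have h2 := H2 y yl.
  rewrite big_nat_recr //= [X in Rabs (_ - X)]big_nat_recr //=.
  set a1 := \Rsum_(0 <= j < n) _ in h1 *; set a2 := \Rsum_(0 <= j < n) _ in h1 *.
  set b2 := \Rsum_(0 <= i < _) _ in h2 *; set b1 := c n / _ in h2 *.
  rewrite (_ : a1 + b1 - (a2 + b2) = (a1 - a2) + (b1 - b2)); last by ring.
  apply: Rle_trans (Rabs_triang _ _) _.
  by rewrite /Rdiv Rmult_plus_distr_r -!/(Rdiv _ _); lra.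
have [C0 [C0p H]] := acc J.+1 (leqnn _).
exists C0; split=> // y yl; have := H y yl.
rewrite (@triangle_sum (fun j i => c j * binc i (1/2 + INR j) * lam ^ i / Rpower y (1/2 + INR j + INR i))).
have -> : \Rsum_(0 <= l < J.+1) \Rsum_(0 <= j < l.+1)
    (c j * binc (l - j) (1/2 + INR j) * lam ^ (l - j) / Rpower y (1/2 + INR j + INR (l - j))) =
   \Rsum_(0 <= l < J.+1) (shiftc lam c l / Rpower y (1/2 + INR l)).
  apply: eq_bigr => l _; rewrite /shiftc /Rdiv big_distrl /=; apply: eq_big_nat => j /andP[_ jl].
  congr (_ * / Rpower y _); rewrite minus_INR; [ring | lia].
by [].
Qed.

Lemma shiftc0 lam c : shiftc lam c 0 = c 0%N.
Proof. by rewrite /shiftc big_nat1 subnn /=; ring. Qed.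

Lemma shiftc1 lam c : shiftc lam c 1 = c 1%N + c 0%N * lam / 2.
Proof.
rewrite /shiftc big_nat_recr //= big_nat1 /= INR_0 INR_1; field.
Qed.

Definition inv_pow_sum (c : nat -> R) (y : R) (J : nat) : R :=
  \Rsum_(0 <= j < J.+1) (c j / Rpower y (1/2 + INR j)).

Lemma sum_f_R0_big f J : sum_f_R0 f J = \Rsum_(0 <= j < J.+1) f j.
Proof.
elim: J => [|J IH] /=; first by rewrite big_nat1.
by rewrite IH [RHS]big_nat_recr.
Qed.

Definition has_expansion (K : R) (f : R -> R) (c : nat -> R) : Prop :=
  forall J : nat, (1 <= J)%N -> exists C0 X0, 0 <= C0 /\ forall x, X0 <= x ->
    Rabs (f x - K * x * inv_pow_sum c (ln x) J) <= C0 * (x / Rpower (ln x) (INR J + 3/2)).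

Lemma Rpower_pos x y : 0 < Rpower x y.
Proof. exact: exp_pos. Qed.

(** The expansion at x/q is rewritten in log x by [shift_expansion]. The error term at x/q costs a
    factor 2^b, since log x <= 2 (log x - log q) for the x considered. *)
Lemma has_expansion_dilate K f c q : 1 < q -> has_expansion K f c ->
  has_expansion (K / q) (fun x => f (x / q)) (shiftc (ln q) c).
Proof.
move=> q1 H J J1; have [C1 [X1 [C1p H1]]] := H J J1.
have l0 : 0 < ln q by rewrite -ln_1; apply: ln_increasing; lra.
have [C2 [C2p H2]] := @shift_expansion (ln q) c J ltac:(lra).
set b := INR J + 3 / 2 in H1 H2 *.
have b0 : 0 < b by rewrite /b; have := pos_INR J; lra.
exists (Rabs K * C2 / q + C1 * Rpower 2 b / q).
exists (Rmax (q * X1) (exp (2 * ln q + 1))).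
have K0 := Rabs_pos K.
split.
  apply: Rplus_le_le_0_compat; apply: Rdiv_le_0_compat; try lra; apply: Rmult_le_pos => //; try lra.
  by left; exact: Rpower_pos.
move=> x xX.
have x1 : X1 <= x / q.
  apply: (Rmult_le_reg_l q); first lra.
  rewrite (_ : q * (x / q) = x); last by field; lra.
  by apply: Rle_trans xX; exact: Rmax_l.
have x2 : exp (2 * ln q + 1) <= x by apply: Rle_trans xX; exact: Rmax_r.
have x0 : 0 < x by have := exp_pos (2 * ln q + 1); lra.
have y1 : 2 * ln q + 1 <= ln x.
  by rewrite -(ln_exp (2 * ln q + 1)); apply: ln_le => //; exact: exp_pos.
set y := ln x in y1 *.
have lnq : ln (x / q) = y - ln q by rewrite /y ln_div //; lra.
have h1 := H1 _ x1; rewrite lnq in h1.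
have h2 := H2 y y1.
set R1 := inv_pow_sum c (y - ln q) J in h1 *; set R2 := inv_pow_sum _ y J.
rewrite -/(inv_pow_sum c (y - ln q) J) -/(inv_pow_sum (shiftc (ln q) c) y J) -/R1 -/R2 in h2.
have -> : f (x / q) - K / q * x * R2 = (f (x / q) - K * (x / q) * R1) + K / q * x * (R1 - R2).
  by field; lra.
apply: Rle_trans (Rabs_triang _ _) _.
have xq : 0 < x / q by apply: Rdiv_lt_0_compat; lra.
have T1 : Rabs (K / q * x * (R1 - R2)) <= Rabs K * C2 / q * (x / Rpower y b).
  rewrite (_ : K / q * x * (R1 - R2) = K * (x / q) * (R1 - R2)); last by field; lra.
  rewrite Rabs_mult [Rabs (K * _)]Rabs_mult (Rabs_pos_eq (x / q)); last lra.
  rewrite (_ : Rabs K * C2 / q * (x / Rpower y b) = Rabs K * (x / q) * (C2 / Rpower y b)); last first.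
    by have := Rpower_pos y b => p; field; lra.
  apply: Rmult_le_compat_l => //; apply: Rmult_le_pos; lra.
have T2 : C1 * (x / q / Rpower (y - ln q) b) <= C1 * Rpower 2 b / q * (x / Rpower y b).
  rewrite (_ : C1 * Rpower 2 b / q * (x / Rpower y b) = C1 * (x / q * (Rpower 2 b / Rpower y b))); last first.
    by have := Rpower_pos y b => p; field; lra.
  apply: Rmult_le_compat_l => //; apply: Rmult_le_compat_l; first lra.
  apply: (Rmult_le_reg_r (Rpower (y - ln q) b * Rpower y b)).
    by apply: Rmult_lt_0_compat; exact: Rpower_pos.
  have p1 := Rpower_pos y b; have p2 := Rpower_pos (y - ln q) b.
  rewrite (_ : / Rpower (y - ln q) b * (Rpower (y - ln q) b * Rpower y b) = Rpower y b); last by field; lra.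
  rewrite (_ : Rpower 2 b / Rpower y b * (Rpower (y - ln q) b * Rpower y b) = Rpower 2 b * Rpower (y - ln q) b); last by field; lra.
  rewrite Rpower_mult_distr; [|lra|lra].
  rewrite /Rpower; apply: exp_le_mono; apply: Rmult_le_compat_l; first lra.
  by apply: ln_le; lra.
rewrite Rmult_plus_distr_r; lra.
Qed.

(** * Counting in residue classes *)

Lemma count_upto_big P N : count_upto P N =
  \Rsum_(1 <= n < N.+1) (if excluded_middle_informative (P n) then 1 else 0).
Proof.
elim: N => [|N IH]; first by rewrite big_geq.
by rewrite big_nat_recr //= IH; case: excluded_middle_informative.
Qed.

Lemma count_leE P x : count_le P x =
  \Rsum_(1 <= n < (flo x).+1) (if excluded_middle_informative (P n) then 1 else 0).
Proof. exact: count_upto_big. Qed.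

Lemma flo_div x q : 0 <= x -> (0 < q)%N -> (flo x %/ q)%N = flo (x / INR q).
Proof.
move=> x0 q0; have q1 := INR_ge1 q0.
have xq : 0 <= x / INR q by apply: Rdiv_le_0_compat; lra.
apply/eqP; rewrite eqn_leq; apply/andP; split.
  apply/flo_le => //; apply: (Rmult_le_reg_r (INR q)); first lra.
  rewrite (_ : x / INR q * INR q = x); last by field; lra.
  rewrite -mult_INR; apply: (Rle_trans _ (INR (flo x))); last by have := flo_spec x0; lra.
  by apply: le_INR; apply/leP; exact: leq_divM.
rewrite leq_divRL //; apply/flo_le => //; rewrite mult_INR.
have [h1 _] := flo_spec xq.
have := Rmult_le_compat_r (INR q) _ _ ltac:(lra) h1.
by rewrite (_ : x / INR q * INR q = x) //; field; lra.
Qed.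

Lemma sum_indE_multiples q x : prime q -> (q %% 4 = 1)%N -> 0 <= x ->
  \Rsum_(1 <= n < (flo x).+1 | (q %| n)%N) indE n = count_le inE (x / INR q).
Proof.
move=> qp q4 x0; rewrite (@big_multiples _ _ _ indE) ?prime_gt0 // flo_div ?prime_gt0 //.
rewrite count_leE; apply: eq_bigr => e _.
rewrite -/(indE e); apply: indE_eq; rewrite -{1}(expn1 q).
by apply: inE_pow_good => //; rewrite q4.
Qed.

(** Orthogonality of characters: the term j = 0 is the count of all n prime to q, and the others are
    small by [chr_sum_bound]. *)
Lemma sum_indE_class q a (A : nat) : prime q -> (q %% 4 = 1)%N -> ~~ (q %| a)%N ->
  exists C0 X0, 0 <= C0 /\ forall x, X0 <= x ->
  Rabs (\Rsum_(1 <= n < (flo x).+1 | (n == a %[mod q])%N) indE n -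
        / INR q.-1 * \Rsum_(1 <= n < (flo x).+1 | ~~ (q %| n)%N) indE n) <=
  C0 * (x / ln x ^ A).
Proof.
move=> qp q4 qa.
have [gen [Hgen Hord]] := primitive_root qp.
have q1 : (1 < q)%N := prime_gt1 qp.
have Q : 0 < INR q.-1 by apply: lt_0_INR; lia.
pose a' := (a ^ q.-2)%N.
have aa : (a * a' = 1 %[mod q])%N.
  by rewrite /a' -expnS prednK; [exact: fermat_unit | lia].
have qa' : ~~ (q %| a')%N.
  apply/negP => H; move: aa; rewrite -modnMmr (eqP H) muln0 mod0n modn_small //; lia.
pose ps j x := Psum (fun n => chr q gen j n * RtoC (indE n))%C (flo x).
have id x' : RtoC (\Rsum_(1 <= n < (flo x').+1 | (n == a %[mod q])%N) indE n -
        / INR q.-1 * \Rsum_(1 <= n < (flo x').+1 | ~~ (q %| n)%N) indE n) =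
     (RtoC (/ INR q.-1) * \Csum_(1 <= j < q.-1) (chr q gen j a' * ps j x'))%C.
  have E0 : ps 0%N x' = RtoC (\Rsum_(1 <= n < (flo x').+1 | ~~ (q %| n)%N) indE n).
    rewrite /ps /Psum RtoC_sum [RHS]big_mkcond; apply: eq_bigr => n _.
    rewrite /chr; case: (boolP (q %| n)%N) => qn /=; first by ring.
    by rewrite mul0n om0; ring.
  have C0 : chr q gen 0 a' = RtoC 1 by rewrite /chr (negbTE qa') mul0n om0.
  have E1 : \Csum_(0 <= j < q.-1) (chr q gen j a' * ps j x') =
     RtoC (INR q.-1 * \Rsum_(1 <= n < (flo x').+1 | (n == a %[mod q])%N) indE n).
    rewrite RtoC_mult RtoC_sum [in RHS]big_mkcond /=.
    transitivity (\Csum_(1 <= n < (flo x').+1) (RtoC (indE n) * \Csum_(0 <= j < q.-1) chr q gen j (n * a'))).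
      rewrite /ps /Psum.
      under eq_bigr => j _ do rewrite big_distrr /=.
      rewrite exchange_big /=; apply: eq_bigr => n _; rewrite big_distrr /=.
      by apply: eq_bigr => j _; rewrite chrM //; ring.
    rewrite [RHS]big_distrr /=; apply: eq_bigr => n _.
    case: (boolP (q %| n)%N) => qn.
      rewrite big1 => [|j _]; last by rewrite /chr dvdn_mulr.
      case: ifP => [/eqP E|_]; last by ring.
      by case/negP: qa; rewrite /dvdn -E.
    rewrite chr_orth // ?Euclid_dvdM ?negb_or ?qn //.
    have -> : (n * a' == 1 %[mod q])%N = (n == a %[mod q])%N.
      apply/eqP/eqP => E.
        rewrite -[n]muln1 -modnMmr -aa modnMmr mulnCA -modnMmr E modnMmr.
        by rewrite muln1.
      by rewrite -modnMml E modnMml.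
    by case: ifP => _; ring.
  have : \Csum_(0 <= j < q.-1) (chr q gen j a' * ps j x') =
     (chr q gen 0 a' * ps 0%N x' + \Csum_(1 <= j < q.-1) (chr q gen j a' * ps j x'))%C.
    by rewrite big_ltn //; lia.
  rewrite E1 E0 C0 Cmult_1_l => E.
  set T := \Csum_(1 <= j < q.-1) _ in E *; set S1 := \Rsum_(1 <= n < _ | (n == _ %[mod _])%N) _ in E *.
  set S2 := \Rsum_(1 <= n < _ | ~~ _) _ in E *.
  have -> : T = (RtoC (INR q.-1 * S1) - RtoC S2)%C by rewrite E; ring.
  by rewrite -RtoC_minus -RtoC_mult; congr RtoC; field; lra.
have acc n : (n <= q.-1)%N -> exists C0 X0, 0 <= C0 /\ forall x, X0 <= x ->
    Cmod (\Csum_(1 <= j < n) (chr q gen j a' * ps j x)) <= C0 * (x / ln x ^ A).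
  elim: n => [_|n IH nq].
    exists 0, 0; split; first lra.
    by move=> x' _; rewrite big_geq // Cmod_0 Rmult_0_l; lra.
  have [C1 [X1 [C1p H1]]] := IH (ltnW nq).
  have [n0|n0] := posnP n.
    exists 0, 0; split; first lra.
    by move=> x' _; rewrite n0 big_geq // Cmod_0 Rmult_0_l; lra.
  have nn : (0 < n < q.-1)%N by rewrite n0.
  have [C2 [X2 [C2p H2]]] := chr_sum_bound qp q4 Hgen Hord A nn.
  exists (C1 + C2), (Rmax X1 X2); split; first lra.
  move=> x' xX; rewrite big_nat_recr //=.
  apply: Rle_trans (Cmod_triangle _ _) _.
  have h1 := H1 x' (Rle_trans _ _ _ (Rmax_l _ _) xX).
  have h2 := H2 x' (Rle_trans _ _ _ (Rmax_r _ _) xX).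
  rewrite Cmod_mult Rmult_plus_distr_r.
  have := @chr_le1 q gen n a'; have := Cmod_ge_0 (chr q gen n a').
  have := Cmod_ge_0 (ps n x'); rewrite -/(ps n x') in h2; nra.
have [C0 [X0 [C0p H]]] := acc q.-1 (leqnn _).
exists (/ INR q.-1 * C0), X0; split.
  by apply: Rmult_le_pos => //; left; apply: Rinv_0_lt_compat.
move=> x' xX; rewrite -Cmod_R id Cmod_mult Cmod_R Rabs_pos_eq; last by left; apply: Rinv_0_lt_compat.
rewrite Rmult_assoc; apply: Rmult_le_compat_l; first by left; apply: Rinv_0_lt_compat.
exact: H.
Qed.

(** The bridge to the form used in the theorem. The sign condition on the constant is obtained by
    enlarging it to its maximum with 0, at nonnegative x. *)
Lemma has_expansion_sum K f c : has_expansion K f c <->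
  (forall J : nat, (1 <= J)%coq_nat -> exists C0 X0 : R, forall x : R, X0 <= x ->
    Rabs (f x - K * x * sum_f_R0 (fun j => c j / Rpower (ln x) (1/2 + INR j)) J)
    <= C0 * (x / Rpower (ln x) (INR J + 3/2))).
Proof.
split=> H J J1.
  have [C0 [X0 [_ HX]]] := H J (introT leP J1).
  by exists C0, X0 => x /HX; rewrite sum_f_R0_big.
have [C0 [X0 HX]] := H J (elimT leP J1).
exists (Rmax C0 0), (Rmax X0 0); split; first exact: Rmax_r.
move=> x xX.
have x1 : X0 <= x by apply: Rle_trans xX; exact: Rmax_l.
have x2 : 0 <= x by apply: Rle_trans xX; exact: Rmax_r.
have := HX x x1; rewrite sum_f_R0_big -/(inv_pow_sum c (ln x) J) => h.
apply: (Rle_trans _ _ _ h); apply: Rmult_le_compat_r; last exact: Rmax_l.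
by apply: Rdiv_le_0_compat => //; exact: Rpower_pos.
Qed.

(** With the common factor K/q taken out, B(x) contributes q c_j and B(x/q) the shifted coefficient;
    their difference is divided by q - 1. *)
Lemma has_expansion_class_nonzero K c q a : prime q -> (q %% 4 = 1)%N -> ~~ (q %| a)%N ->
  has_expansion K (count_le inE) c ->
  has_expansion (K / INR q) (fun x => \Rsum_(1 <= n < (flo x).+1 | (n == a %[mod q])%N) indE n)
    (fun j => (INR q * c j - shiftc (ln (INR q)) c j) / (INR q - 1)).
Proof.
move=> qp q4 qa H J J1.
have q1 : 1 < INR q by rewrite -INR_1; apply: lt_INR; have := prime_gt1 qp; lia.
have [C1 [X1 [C1p H1]]] := H J J1.
have [C2 [X2 [C2p H2]]] := has_expansion_dilate q1 H J1.
(* J + 2 is the least integer exponent beyond J + 3/2. *)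
have [C3 [X3 [C3p H3]]] := @sum_indE_class q a (J + 2) qp q4 qa.
set b := INR J + 3 / 2 in H1 H2 *.
pose i := / (INR q - 1).
have i0 : 0 < i by apply: Rinv_0_lt_compat; lra.
have qE : INR q.-1 = INR q - 1.
  by rewrite -{2}(prednK (prime_gt0 qp)) S_INR; ring.
exists (C3 + i * (C1 + C2)), (Rmax (Rmax X1 X2) (Rmax X3 (exp 1))); split.
  have := Rmult_le_pos i (C1 + C2); lra.
move=> x xX.
have [x12 x34] : Rmax X1 X2 <= x /\ Rmax X3 (exp 1) <= x.
  by split; apply: Rle_trans xX; [exact: Rmax_l | exact: Rmax_r].
have h1 := H1 x (Rle_trans _ _ _ (Rmax_l _ _) x12).
have h2 := H2 x (Rle_trans _ _ _ (Rmax_r _ _) x12).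
have h3 := H3 x (Rle_trans _ _ _ (Rmax_l _ _) x34).
have x1 : exp 1 <= x := Rle_trans _ _ _ (Rmax_r _ _) x34.
have x0 : 0 < x by have := exp_pos 1; lra.
have y1 : 1 <= ln x by rewrite -(ln_exp 1); apply: ln_le => //; exact: exp_pos.
set y := ln x in h1 h2 h3 y1 *.
have e : x / y ^ (J + 2) <= x / Rpower y b.
  apply: Rmult_le_compat_l; first lra.
  apply: Rinv_le_contravar; first exact: Rpower_pos.
  rewrite -Rpower_pow; last lra.
  apply: Rle_Rpower => //; rewrite -[(_ + 2)%N]/(Nat.add _ _) plus_INR /b.
  by rewrite (_ : INR 2 = 2); [lra | rewrite INR_IZR_INZ].
set S := \Rsum_(1 <= n < _ | (n == _ %[mod _])%N) _ in h3 *.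
set N' := \Rsum_(1 <= n < _ | ~~ _) _ in h3.
have NE : N' = count_le inE x - count_le inE (x / INR q).
  rewrite -(@sum_indE_multiples q x) //; last lra.
  rewrite count_leE /N' [X in X - _](_ : _ = \Rsum_(1 <= n < (flo x).+1) indE n); last first.
    by apply: eq_bigr => n _.
  rewrite [X in _ = X - _](bigID (fun n => (q %| n)%N)) /=; ring.
rewrite qE -/i NE in h3.
set B1 := count_le inE x in h1 h3; set B2 := count_le inE (x / INR q) in h2 h3.
have RE : inv_pow_sum (fun j => (INR q * c j - shiftc (ln (INR q)) c j) / (INR q - 1)) y J =
   i * (INR q * inv_pow_sum c y J - inv_pow_sum (shiftc (ln (INR q)) c) y J).
  rewrite /inv_pow_sum Rmult_minus_distr_l !big_distrr /= /Rminus -Rsum_opp -big_split /=.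
  by apply: eq_bigr => j _; rewrite /i /Rdiv /Rminus; ring.
rewrite RE; set R1 := inv_pow_sum c y J in h1 *; set R2 := inv_pow_sum _ y J in h2 *.
have -> : S - K / INR q * x * (i * (INR q * R1 - R2)) =
  (S - i * (B1 - B2)) + i * ((B1 - K * x * R1) - (B2 - K / INR q * x * R2)).
  by field; lra.
apply: Rle_trans (Rabs_triang _ _) _; rewrite Rabs_mult (Rabs_pos_eq i); last lra.
have T : Rabs (B1 - K * x * R1 - (B2 - K / INR q * x * R2)) <= (C1 + C2) * (x / Rpower y b).
  by apply: Rle_trans (Rabs_triang _ _) _; rewrite Rabs_Ropp Rmult_plus_distr_r; lra.
have T3 := Rmult_le_compat_l _ _ _ C3p e.
have := Rmult_le_compat_l _ _ _ (Rlt_le _ _ i0) T; lra.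
Qed.

Lemma has_expansion_ext K f g c : (forall x, 0 <= x -> f x = g x) -> has_expansion K f c -> has_expansion K g c.
Proof.
move=> fg H J J1; have [C0 [X0 [C0p HX]]] := H J J1.
exists C0, (Rmax X0 0); split=> // x xX.
have x1 : X0 <= x by apply: Rle_trans xX; exact: Rmax_l.
have x2 : 0 <= x by apply: Rle_trans xX; exact: Rmax_r.
by rewrite -fg //; apply: HX.
Qed.

Lemma Zof_nat_modn m n : (0 < n)%N -> Z.of_nat (m %% n) = (Z.of_nat m mod Z.of_nat n)%Z.
Proof.
move=> n0; apply: (Z.mod_unique_pos _ _ (Z.of_nat (m %/ n))).
  by have := ltn_pmod m n0; lia.
by rewrite {1}(divn_eq m n); lia.
Qed.

Lemma has_expansion_class K c (q a : Z) : Znumtheory.prime q -> (q mod 4 = 1)%Z ->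
  has_expansion K (count_le inE) c ->
  has_expansion (K / IZR q)
    (count_le (fun n => inE n /\ (Z.of_nat n mod q = a mod q)%Z))
    (if Z.eqb (a mod q) 0 then shiftc (ln (IZR q)) c
     else fun j => (IZR q * c j - shiftc (ln (IZR q)) c j) / (IZR q - 1)).
Proof.
move=> Zq q4 H.
have q2 := prime_ge_2 _ Zq.
have [p qE] : exists p, q = Z.of_nat p by exists (Z.to_nat q); lia.
have [a0 aE] : exists a0, (a mod q = Z.of_nat a0)%Z.
  by exists (Z.to_nat (a mod q)); have := Z.mod_pos_bound a q; lia.
have a0p : (a0 < p)%N by have := Z.mod_pos_bound a q; lia.
have pp : prime p by apply/prime_natZ; rewrite -qE.
have p4 : (p %% 4 = 1)%N by apply: Nat2Z.inj; rewrite Zof_nat_modn // -qE q4.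
have IE : IZR q = INR p by rewrite qE INR_IZR_INZ.
have p1 : 1 < INR p by rewrite -INR_1; apply: lt_INR; lia.
have CE x : count_le (fun n => inE n /\ (Z.of_nat n mod q = a mod q)%Z) x =
    \Rsum_(1 <= n < (flo x).+1 | (n == a0 %[mod p])%N) indE n.
  rewrite count_leE [RHS]big_mkcond; apply: eq_bigr => n _.
  have M : (Z.of_nat n mod q = a mod q)%Z <-> (n == a0 %[mod p])%N.
    rewrite aE qE (modn_small a0p) -Zof_nat_modn; last lia.
    by split=> [/Nat2Z.inj /eqP|/eqP ->].
  rewrite /indE; case: excluded_middle_informative => [[h1 h2]|h].
    by rewrite (proj1 M h2); case: excluded_middle_informative.
  case: ifP => // h2; case: excluded_middle_informative => // h1.
  by case: h; split=> //; apply/M.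
rewrite aE in CE *; rewrite IE; case: Z.eqb_spec => a00.
  apply: has_expansion_ext (has_expansion_dilate p1 H) => x x0.
  rewrite CE -(@sum_indE_multiples p x) //; apply: eq_bigl => n.
  by rewrite (_ : a0 = 0%N) ?mod0n //; lia.
apply: has_expansion_ext (has_expansion_class_nonzero pp p4 _ H) => [x _|]; first by rewrite CE.
by rewrite gtnNdvd //; lia.
Qed.

End Equidistribution.

Theorem theorem2p7 (c1 : R) (Hc1 : classical_c1 c1)
  (q : Z) (Hq : prime q) (Hq4 : Z.modulo q 4 = 1%Z) (a : Z) :
  exists c : nat -> R,
    c 0%nat = 1 /\
    c 1%nat = (if Z.eqb (Z.modulo a q) 0
               then c1 + ln (IZR q) / 2
               else c1 - ln (IZR q) / (2 * (IZR q - 1))) /\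
    forall J : nat, (1 <= J)%nat ->
      exists C X0 : R, forall x : R, X0 <= x ->
        Rabs (count_le (fun n => inE n /\ Z.modulo (Z.of_nat n) q = Z.modulo a q) x
              - Kconst / IZR q * x *
                  sum_f_R0 (fun j => c j / Rpower (ln x) (1/2 + INR j)) J)
        <= C * (x / Rpower (ln x) (INR J + 3/2)).
Proof.
destruct Hc1 as [c [c_0 [c_1 Hc]]].
apply Equidistribution.has_expansion_sum in Hc.
pose proof (@Equidistribution.has_expansion_class Kconst c q a Hq Hq4 Hc) as H.
assert (q1 : 1 < IZR q) by (apply IZR_lt; pose proof (prime_ge_2 q Hq); lia).
set (d := if Z.eqb (a mod q) 0 then _ else _) in H.
exists d; split; [|split].
- unfold d; destruct (Z.eqb (a mod q) 0); rewrite Equidistribution.shiftc0, c_0; [reflexivity|field; lra].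
(* The shift turns c_1 into c_1 + (log q)/2; outside the class 0, (q c_1 - c_1 - (log q)/2)/(q-1) =
   c_1 - (log q)/(2(q-1)). *)
- unfold d; destruct (Z.eqb (a mod q) 0); rewrite Equidistribution.shiftc1, c_0, c_1; field; lra.
- exact (proj1 (Equidistribution.has_expansion_sum _ _ _) H).
Qed.
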